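(* For every $p>1$, $$A_p=W_p\cap C_p.$$ That is, a weight $w$ on $\mathbb{R}^n$ belongs to $A_p$ if and only if $w\in W_p$ and $w\in C_p$.
   Context: Throughout, $\mathbb{R}^n$ carries Lebesgue measure. Cubes have sides parallel to the axes. A weight is a non-negative locally integrable function on $\mathbb{R}^n$; write $w(E)=\int_E w$. The Hardy–Littlewood maximal operator is $$Mf(x)=\sup_{Q\ni x}\frac{1}{|Q|}\int_Q|f|,$$ where the supremum is over all cubes $Q$ containing $x$. For $p>1$, $w\in A_p$ means $$[w]_{A_p}:=\sup_Q\Big(\frac1{|Q|}\int_Q w\Big)\Big(\frac1{|Q|}\int_Q w^{-\frac1{p-1}}\Big)^{p-1}<\infty.$$ For $p>1$, $N_p$ is the class of weights with $$\int_{\mathbb{R}^n}\frac{w(x)}{(1+|x|)^{np}}\,dx<\infty.$$ For $p>1$, $W_p$ is the class of weights $w\in N_p$ for which there is $C>0$ such that $$\int_{\mathbb{R}^n}(M(Mf))^p w\le C\int_{\mathbb{R}^n}(Mf)^p w$$ whenever the right-hand side is finite. For $p>0$, $w\in C_p$ means there exist $C,\delta>0$ such that for every cube $Q$ and every measurable $E\subset Q$, $$\int_E w\le C\Big(\frac{|E|}{|Q|}\Big)^{\delta}\int_{\mathbb{R}^n}(M\chi_Q)^p w.$$ *)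

(* Defs.v *)
From HB Require Import structures.
From mathcomp Require Import all_boot all_order all_algebra.
From mathcomp Require Import all_classical all_reals all_analysis.
Import Order.TTheory GRing.Theory Num.Theory.
Import numFieldNormedType.Exports.

Set Implicit Arguments.
Unset Strict Implicit.
Unset Printing Implicit Defensive.

Local Open Scope classical_set_scope.
Local Open Scope ring_scope.

(* ---------- Lebesgue integral on R^n (nonnegative integrands) ----------
   [lint f] is the iterated one-dimensional Lebesgue integral
   \int dx_1 ... \int dx_n f(x_1,...,x_n).  By Tonelli it coincides with the
   integral against n-dimensional Lebesgue measure for every nonnegative
   (Lebesgue-)measurable f : R^n -> [0,+oo]; all integrands below are of
   this kind. *)
Fixpoint lint {R : realType} (n : nat) : ('rV[R]_n -> \bar R) -> \bar R :=
  match n with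
  | 0 => fun f => f 0
  | n'.+1 => fun f =>
      (\int[@lebesgue_measure R]_(t in [set: R])
          lint (fun y : 'rV[R]_n' => f (row_mx (t%:M : 'rV[R]_1) y)))%E
  end.

Definition integ {R : realType} {n : nat} (E : set 'rV[R]_n)
  (f : 'rV[R]_n -> \bar R) : \bar R :=
  lint (fun x => if x \in E then f x else 0%E).

Definition leb {R : realType} {n : nat} (E : set 'rV[R]_n) : \bar R :=
  integ E (fun _ => 1%E).

Definition borel {R : realType} {n : nat} (E : set 'rV[R]_n) : Prop :=
  <<s (@open 'rV[R]_n) >> E.

Definition lebmeas {R : realType} {n : nat} (E : set 'rV[R]_n) : Prop :=
  exists A B : set 'rV[R]_n,
    [/\ borel A, borel B, A `<=` E, E `<=` B & leb (B `\` A) = 0%E].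

Definition lebmeas_fun {R : realType} {n : nat} (f : 'rV[R]_n -> \bar R) : Prop :=
  forall a : R, lebmeas [set x | (f x < a%:E)%E].

Definition enorm {R : realType} {n : nat} (x : 'rV[R]_n) : R :=
  Num.sqrt (\sum_(i < n) x 0 i ^+ 2).

Definition cube {R : realType} {n : nat} (c : 'rV[R]_n) (l : R) : set 'rV[R]_n :=
  [set x | forall i : 'I_n, c 0 i <= x 0 i <= c 0 i + l].

Definition cavg {R : realType} {n : nat} (c : 'rV[R]_n) (l : R)
  (g : 'rV[R]_n -> \bar R) : \bar R :=
  (((l ^+ n)^-1)%:E * integ (cube c l) g)%E.

Definition maxop {R : realType} {n : nat} (g : 'rV[R]_n -> \bar R)
  (x : 'rV[R]_n) : \bar R :=
  ereal_sup [set a | exists (c : 'rV[R]_n) (l : R),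
    [/\ 0 < l, cube c l x & a = cavg c l (fun y => `|g y|%E)]].

Definition weight {R : realType} {n : nat} (w : 'rV[R]_n -> R) : Prop :=
  [/\ forall x, 0 <= w x,
      lebmeas_fun (fun x => (w x)%:E)
    & forall (c : 'rV[R]_n) (l : R), 0 < l ->
        (integ (cube c l) (fun x => (w x)%:E) < +oo)%E].

(* w^{-1/(p-1)}, with the convention 0^{-1/(p-1)} = +oo *)
Definition dualw {R : realType} {n : nat} (p : R) (w : 'rV[R]_n -> R)
  (x : 'rV[R]_n) : \bar R :=
  if w x == 0 then +oo%E else (w x `^ (- (p - 1)^-1))%:E.

Definition Ap {R : realType} {n : nat} (p : R) (w : 'rV[R]_n -> R) : Prop :=
  (ereal_sup [set a | exists (c : 'rV[R]_n) (l : R), (0 < l)%R /\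
     a = (cavg c l (fun x => (w x)%:E)
          * (cavg c l (dualw p w)) `^ (p - 1))%E] < +oo)%E.

Definition Np {R : realType} {n : nat} (p : R) (w : 'rV[R]_n -> R) : Prop :=
  (integ [set: 'rV[R]_n]
     (fun x => ((w x) / (1 + enorm x) `^ (n%:R * p))%:E) < +oo)%E.

Definition Wp {R : realType} {n : nat} (p : R) (w : 'rV[R]_n -> R) : Prop :=
  Np p w /\
  exists C : R, 0 < C /\
    forall f : 'rV[R]_n -> R, lebmeas_fun (fun x => (f x)%:E) ->
      let Mf := maxop (fun x => (f x)%:E) in
      (integ [set: 'rV[R]_n] (fun x => (Mf x `^ p * (w x)%:E)%E) < +oo)%E ->
      (integ [set: 'rV[R]_n] (fun x => (maxop Mf x `^ p * (w x)%:E)%E)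
       <= C%:E * integ [set: 'rV[R]_n] (fun x => (Mf x `^ p * (w x)%:E)%E))%E.

Definition Cp {R : realType} {n : nat} (p : R) (w : 'rV[R]_n -> R) : Prop :=
  exists C delta : R, [/\ 0 < C, 0 < delta &
    forall (c : 'rV[R]_n) (l : R) (E : set 'rV[R]_n),
      0 < l -> lebmeas E -> E `<=` cube c l ->
      (integ E (fun x => (w x)%:E)
       <= C%:E * ((fine (leb E) / l ^+ n) `^ delta)%:E
          * integ [set: 'rV[R]_n]
              (fun x => (maxop (fun y => (\1_(cube c l) y)%:E) x `^ p
                         * (w x)%:E)%E))%E].

(* Main.v *)
Require Import Defs.
From HB Require Import structures.
From mathcomp Require Import all_boot all_order all_algebra.
From mathcomp Require Import all_classical all_reals all_analysis.
From mathcomp Require Import measurable_realfun ring lra zify.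
Import Order.TTheory GRing.Theory Num.Theory.
Import numFieldNormedType.Exports.
Set Implicit Arguments.
Unset Strict Implicit.
Unset Printing Implicit Defensive.
Local Open Scope classical_set_scope.
Local Open Scope ring_scope.

(* From A_p to W_p and C_p.  Up to null sets w is positive or zero.  If w is
   positive, Lerner's pointwise bound
     (M g)^(p-1) <= K M_w ((M_sigma (g / sigma))^(p-1) / w),  sigma = w^(-1/(p-1)),
   for dyadic maximal operators and two Doob inequalities give Muckenhoupt's
   theorem on a dyadic grid, and 2^n shifted grids suffice for all cubes.  Applied
   to the indicator of the unit cube it gives N_p, applied to Mf it gives W_p, and
   applied to indicators of subsets of a cube it gives w(F) <= b w(Q) with b < 1 when
   |F| <= |Q|/2, an estimate whose iteration is C_p.

   From W_p and C_p to A_p.  Let a = 2^(n+1) and let E be a subset of a cube Q of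
   density t <= a^-j.  Averaging over the level sets of the dyadic maximal function
   of E yields M M chi_E >= c j t and M M M chi_E >= c j(j-1) t on Q.  Two uses of W_p
   bound the L^p(w) norm of M M M chi_E by that of M chi_E, and the part of the latter
   where M chi_E <= a^-J is absorbed since the gain c J(J-1) is large.  Taking E = Q
   shows that the integral in C_p is comparable to w(Q); so w is doubling and subsets
   of Q of density bounded below carry a fixed proportion of w(Q), whence
   w {M chi_E > a^-J} <= C w(E) and (j^2 t)^p w(Q) <= C w(E).  For E = {w < c A a^(-i(p-1))}
   in Q, with A the average of w on Q, this gives |E| / |Q| <= C a^-i / i^2, and the
   summability of 1/i^2 bounds the average of w^(-1/(p-1)). *)

(** * Lebesgue measure on the Borel sets of R^n *)

(** One iteration, [measure_decay], serves both directions with the two measures exchanged. For A_p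
    to C_p Lebesgue measure is the reference and doubling is trivial; for the converse the weight is
    the reference, so doubling of w must come beforehand. It is not a hypothesis: it follows once
    the integral in C_p is comparable to w(Q), and there iterating M is decisive. The finiteness
    condition in W_p shapes that step. N_p makes (M chi_E)^p w integrable, which licenses the use of
    W_p on chi_E; the conclusion licenses the use on M chi_E; and a fraction of a finite integral
    can be subtracted from both sides. The exponent 2 in i^2 comes from the third iterate: sums of 1
    give j, sums of i give j(j-1)/2, whose reciprocals telescope whatever p is. A grid has a largest
    scale L. For Muckenhoupt's theorem L tends to infinity and Fatou's lemma recovers all cubes; for
    a superlevel set of M chi_E one finite L is enough. Weights vanishing almost everywhere are
    treated apart, with 0 times infinity equal to 0. *)

Definition borelT (R : realType) (n : nat) := g_sigma_algebraType (@open 'rV[R]_n).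
HB.instance Definition _ (R : realType) (n : nat) :=
  Measurable.copy (borelT R n) (g_sigma_algebraType (@open 'rV[R]_n)).

Lemma bigcup_count_measurable d (T : measurableType d) (I : countType)
    (P : set I) (F : I -> set T) :
  (forall i, P i -> measurable (F i)) -> measurable (\bigcup_(i in P) F i).
Proof.
move=> mF; rewrite bigcup_mkcond; apply: countable_bigcupT_measurable.
  exact: countableP.
by move=> i; case: ifPn => // /set_mem /mF.
Qed.

Section borel_space.
Variable R : realType.

Definition qbox n (a b : 'rV[rat]_n) : set 'rV[R]_n :=
  [set x | forall i, ratr (a 0 i) < x 0 i < ratr (b 0 i)].

(** Rational boxes are countably many and are products of intervals, so measurability of the maps
    between R x R^n and R^(n+1) can be tested one coordinate at a time. *)
Lemma open_bigcup_qbox n (U : set 'rV[R]_n) : open U ->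
  U = \bigcup_(ab in [set ab : 'rV[rat]_n * 'rV[rat]_n | qbox ab.1 ab.2 `<=` U])
        qbox ab.1 ab.2.
Proof.
move=> oU; apply/seteqP; split=> [x Ux|x [ab /= abU]]; last exact: abU.
have /nbhs_ballP[e /= e0 eU] : nbhs x U by move: oU; rewrite openE => /(_ x Ux).
have /choice[a aP] : forall i, exists q : rat, x 0 i - e < ratr q < x 0 i.
  move=> i; have : x 0 i - e < x 0 i by rewrite ltrBlDr ltrDl.
  by move=> /rat_in_itvoo[q]; rewrite in_itv/= => qP; exists q.
have /choice[b bP] : forall i, exists q : rat, x 0 i < ratr q < x 0 i + e.
  move=> i; have : x 0 i < x 0 i + e by rewrite ltrDl.
  by move=> /rat_in_itvoo[q]; rewrite in_itv/= => qP; exists q.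
exists (\row_i a i, \row_i b i) => /=; last first.
  by move=> i; rewrite !mxE; have /andP[_ ->] := aP i; have /andP[-> _] := bP i.
move=> y yP; apply: eU; split => // i j; rewrite ord1.
have := yP j; rewrite !mxE => /andP[y1 y2].
have /andP[a1 a2] := aP j; have /andP[b1 b2] := bP j.
rewrite /ball/= ltr_distlC; apply/andP; split; first exact: lt_trans y1.
exact: lt_trans b2.
Qed.

Lemma measurable_open n (U : set 'rV[R]_n) : open U -> measurable (U : set (borelT R n)).
Proof. by move=> oU; apply: sub_sigma_algebra. Qed.

Lemma measurable_to_borelT d (T : measurableType d) n (f : T -> borelT R n) :
  (forall U : set 'rV[R]_n, open U -> measurable (f @^-1` U)) ->
  measurable_fun setT f.
Proof.
move=> mf; apply: (@measurability _ _ T (borelT R n) setT f (@open 'rV[R]_n) erefl).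
by move=> _ [U oU <-]; rewrite setTI; exact: mf.
Qed.

Lemma open_measurable_funE n (f : borelT R n -> \bar R) :
  (forall a : R, open ([set x | (a%:E < f x)%E] : set 'rV[R]_n)) ->
  measurable_fun setT f.
Proof.
move=> fo; apply: (measurability _ (ErealGenOInfty.measurableE R)) => //.
move=> _ [_ [y ->] <-]; rewrite setTI; apply: measurable_open.
rewrite (_ : _ @^-1` _ = [set x | (y%:E < f x)%E])//.
by apply/seteqP; split => x /=; rewrite in_itv/= andbT.
Qed.

Lemma continuous_measurable n (f : 'rV[R]_n -> R) :
  continuous f -> measurable_fun setT (f : borelT R n -> R).
Proof.
move=> /continuousP cf; apply: (measurability _ (RGenOInfty.measurableE R)) => //.
move=> _ [_ [y ->] <-]; rewrite setTI.
by apply: measurable_open; apply: (cf `]y, +oo[%classic); exact: interval_open.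
Qed.

Lemma measurable_coord n (i : 'I_n) :
  measurable_fun setT (fun x : borelT R n => x 0 i).
Proof. by apply: continuous_measurable; exact: coord_continuous. Qed.

Lemma measurable_forall_coord n (J : 'I_n -> set R) :
  (forall i, measurable (J i : set (measurableTypeR R))) ->
  measurable ([set x : borelT R n | forall i, J i (x 0 i)]).
Proof.
move=> mJ.
rewrite (_ : mkset _ = \bigcap_(i in [set` enum 'I_n]) (fun x : borelT R n => x 0 i) @^-1` J i).
  apply: fin_bigcap_measurable => // i _; rewrite -[X in measurable X]setTI.
  by apply: measurable_coord => //; exact: mJ.
by apply/seteqP; split=> [x xJ i _|x xJ i]; [exact: xJ|apply: xJ => /=; rewrite mem_enum].
Qed.

Lemma measurable_qbox n (a b : 'rV[rat]_n) : measurable (qbox a b : set (borelT R n)).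
Proof.
apply: (@measurable_forall_coord n (fun i => `]ratr (a 0 i), ratr (b 0 i)[%classic)).
by move=> i; exact: measurable_itv.
Qed.

Definition rcons_pt n (z : measurableTypeR R * borelT R n) : borelT R n.+1 :=
  row_mx (z.1%:M : 'rV[R]_1) (z.2 : 'rV[R]_n).

Lemma rcons_pt0 n (z : measurableTypeR R * borelT R n) : rcons_pt z 0 0 = z.1.
Proof.
have -> : 0 = lshift n (0 : 'I_1) by apply: val_inj.
rewrite -[LHS]/(row_mx (z.1%:M : 'rV[R]_1) (z.2 : 'rV[R]_n) 0 (lshift n (0 : 'I_1))).
by rewrite row_mxEl mxE eqxx.
Qed.

Lemma rcons_ptS n (z : measurableTypeR R * borelT R n) (i : 'I_n) :
  rcons_pt z 0 (lift 0 i) = z.2 0 i.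
Proof.
have -> : lift 0 i = rshift 1 i by apply: val_inj.
rewrite -[LHS]/(row_mx (z.1%:M : 'rV[R]_1) (z.2 : 'rV[R]_n) 0 (rshift 1 i)).
by rewrite row_mxEr.
Qed.

Lemma measurable_rcons_pt n : measurable_fun setT (@rcons_pt n).
Proof.
apply: measurable_to_borelT => U oU; rewrite (open_bigcup_qbox oU) preimage_bigcup.
apply: bigcup_count_measurable => -[a b] _ /=.
rewrite (_ : _ @^-1` _ = `]ratr (a 0 0), ratr (b 0 0)[%classic `*`
    qbox (\row_i a 0 (lift 0 i)) (\row_i b 0 (lift 0 i))).
  by apply: measurableX; [exact: measurable_itv|exact: measurable_qbox].
apply/seteqP; split=> [z zP|z [z1 z2] i].
  split => /=; first by rewrite in_itv/=; have := zP 0; rewrite rcons_pt0.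
  by move=> i; rewrite !mxE -rcons_ptS.
have [j ->|->] := unliftP 0 i; last by rewrite rcons_pt0; move: z1; rewrite /= in_itv.
by rewrite rcons_ptS; have := z2 j; rewrite !mxE.
Qed.

Definition split_pt n (x : borelT R n.+1) : measurableTypeR R * borelT R n :=
  (x 0 0, (\row_i x 0 (lift 0 i))).

Lemma rcons_ptK n : cancel (@rcons_pt n) (@split_pt n).
Proof.
move=> [t y]; rewrite /split_pt rcons_pt0; congr pair.
by apply/rowP => i; rewrite mxE rcons_ptS.
Qed.

Lemma measurable_split_pt n : measurable_fun setT (@split_pt n).
Proof.
apply/measurable_fun_pairP; split; first exact: measurable_coord.
apply: measurable_to_borelT => U oU; rewrite (open_bigcup_qbox oU) preimage_bigcup.
apply: bigcup_count_measurable => -[a b] _ /=.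
rewrite (_ : _ @^-1` _ = [set x : borelT R n.+1 | forall i,
    (if unlift 0 i is Some j then `]ratr (a 0 j), ratr (b 0 j)[%classic else setT) (x 0 i)]).
  apply: (@measurable_forall_coord n.+1 (fun i => if unlift 0 i is Some j then
    `]ratr (a 0 j), ratr (b 0 j)[%classic else setT)) => i.
  by case: unlift => // j; exact: measurable_itv.
apply/seteqP; split=> [x xP i|x xP i].
  have [j ->|->] := unliftP 0 i => //.
  by have := xP j; rewrite /split_pt/= mxE in_itv.
by have := xP (lift 0 i); rewrite liftK /split_pt/= mxE in_itv.
Qed.

Section rcons_measure.
Variables (n : nat) (mu : {sigma_finite_measure set (borelT R n) -> \bar R}).

(** This is Lebesgue measure one dimension up: the product measure carried over by the same [row_mx]
    that [lint] uses. Its sigma-finiteness, proved below, lets Tonelli apply at the next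
    dimension. *)
Definition rcons_measure : set (borelT R n.+1) -> \bar R :=
  pushforward (@lebesgue_measure R \x mu)%E (@rcons_pt n).

Let rcons_measure0 : rcons_measure set0 = 0%E.
Proof. by rewrite /rcons_measure /pushforward preimage_set0 measure0. Qed.

Let rcons_measure_ge0 A : (0 <= rcons_measure A)%E.
Proof. exact: (measure_ge0 (@lebesgue_measure R \x mu)%E). Qed.

Let rcons_measure_sigma_additive : semi_sigma_additive rcons_measure.
Proof.
by apply: measure_semi_sigma_additive; exact: measurable_rcons_pt.
Qed.

HB.instance Definition _ := isMeasure.Build _ _ _ rcons_measure
  rcons_measure0 rcons_measure_ge0 rcons_measure_sigma_additive.

Let rcons_measure_sigma_finite : sigma_finite setT rcons_measure.
Proof.
have /sigma_finiteP[F [FT Fnd Ffin]] := sigma_finiteT (@lebesgue_measure R).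
have /sigma_finiteP[G [GT Gnd Gfin]] := sigma_finiteT mu.
have mFG k : measurable (F k `*` G k).
  by apply: measurableX; [have [] := Ffin k|have [] := Gfin k].
exists (fun k => @split_pt n @^-1` (F k `*` G k)).
  rewrite -preimage_bigcup; apply/esym/seteqP; split => // x _ /=.
  have [k _ Fk] : (\bigcup_k F k) (split_pt x).1 by rewrite -FT.
  have [l _ Gl] : (\bigcup_k G k) (split_pt x).2 by rewrite -GT.
  exists (maxn k l) => //; split.
    by move: Fk; apply/subsetPset/Fnd; exact: leq_maxl.
  by move: Gl; apply/subsetPset/Gnd; exact: leq_maxr.
move=> k; split.
  by rewrite -[X in measurable X]setTI; apply: measurable_split_pt.
rewrite /rcons_measure /pushforward (_ : _ @^-1` _ = F k `*` G k).
  have [mF Fk] := Ffin k; have [mG Gk] := Gfin k.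
  by rewrite [ltLHS]product_measure1E//; apply: lte_mul_pinfty => //; rewrite ge0_fin_numE.
by apply/seteqP; split => z; rewrite /preimage/mkset rcons_ptK.
Qed.

HB.instance Definition _ := Measure_isSigmaFinite.Build _ _ _ rcons_measure
  rcons_measure_sigma_finite.

End rcons_measure.

(** Tonelli turns one more iterated integral into an integral against [rcons_measure], so the
    sigma-finite structure must travel with the measure through the induction. In dimension 0 the
    measure is the point mass at 0. *)
Lemma lintE_ex n : exists mu : {sigma_finite_measure set (borelT R n) -> \bar R},
  forall f : borelT R n -> \bar R, (forall x, 0 <= f x)%E -> measurable_fun setT f ->
    lint (f : 'rV[R]_n -> \bar R) = (\int[mu]_x f x)%E.
Proof.
elim: n => [|n [mu muP]].
  exists (\d_(0 : borelT R 0)) => f f0 mf.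
  by rewrite integral_dirac// diracT mul1e.
exists (rcons_measure mu) => f f0 mf.
rewrite [RHS]ge0_integral_pushforward//=; last exact: measurable_rcons_pt.
have mfr : measurable_fun setT (f \o @rcons_pt n).
  by apply: measurableT_comp => //; exact: measurable_rcons_pt.
rewrite preimage_setT fubini_tonelli1//.
apply: eq_integral => t _; rewrite /fubini_F/= -muP//=.
by apply: measurableT_comp mfr _; exact: measurable_pair1.
Qed.

Definition mu n : {measure set (borelT R n) -> \bar R} :=
  sval (cid (lintE_ex n)).

Lemma lintE n (f : borelT R n -> \bar R) : (forall x, 0 <= f x)%E ->
  measurable_fun setT f -> lint (f : 'rV[R]_n -> \bar R) = (\int[mu n]_x f x)%E.
Proof. exact: (svalP (cid (lintE_ex n))). Qed.

(** The integral of a nonnegative function is a supremum over the simple functions below it, hence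
    monotone on arbitrary functions. This matters because many integrands below are measurable only
    up to a null set. *)
Lemma le_lint n (f g : 'rV[R]_n -> \bar R) : (forall x, 0 <= f x)%E ->
  (forall x, f x <= g x)%E -> (0 <= lint f <= lint g)%E.
Proof.
elim: n => [|n IH] in f g *; first by move=> f0 fg /=; rewrite f0 fg.
move=> f0 fg /=; apply/andP; split.
  by apply: integral_ge0 => t _; have /andP[] := IH _ (fun y => g (row_mx t%:M y))
    (fun y => f0 (row_mx t%:M y)) (fun y => fg (row_mx t%:M y)).
have IHt t := IH _ _ (fun y => f0 (row_mx t%:M y)) (fun y => fg (row_mx t%:M y)).
rewrite !ge0_integralTE; last 2 first.
- by move=> t; have /andP[/le_trans] := IHt t; apply.
- by move=> t; have /andP[] := IHt t.
apply: le_ereal_sup => _ [h /= hf <-]; exists h => //= t.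
by apply: le_trans (hf t) _; have /andP[] := IHt t.
Qed.

Lemma lint_ae n (N : set 'rV[R]_n) (f : 'rV[R]_n -> \bar R) (g : borelT R n -> \bar R) :
  measurable (N : set (borelT R n)) -> mu n N = 0%E ->
  (forall x, 0 <= f x)%E -> (forall x, 0 <= g x)%E -> measurable_fun setT g ->
  (forall x, ~ N x -> f x = g x) -> lint f = (\int[mu n]_x g x)%E.
Proof.
move=> mN N0 f0 g0 mg fg.
(* [f] itself may fail to be Borel, so it is squeezed between two Borel functions that agree with
   [g] off [N]: on [N] one is zero, the other infinite. *)
pose lo x := (g x * (\1_(~` N) x)%:E)%E; pose hi x := (g x + +oo * (\1_N x)%:E)%E.
have lo0 x : (0 <= lo x)%E by rewrite mule_ge0.
have hi0 x : (0 <= hi x)%E by rewrite adde_ge0// mule_ge0.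
have mlo : measurable_fun setT lo.
  apply: emeasurable_funM => //; apply/measurable_EFinP.
  by apply: measurable_indic; exact: measurableC.
have mN1 : measurable_fun setT (fun x : borelT R n => (\1_N x)%:E : \bar R).
  by apply/measurable_EFinP; exact: measurable_indic.
have mhi : measurable_fun setT hi.
  by apply: emeasurable_funD => //; exact: measurable_funeM.
have lof x : (lo x <= f x)%E.
  rewrite /lo indicE; have [xN|xN] := boolP (x \in ~` N); last by rewrite mule0.
  by rewrite mule1 fg //; move: xN; rewrite inE.
have fhi x : (f x <= hi x)%E.
  rewrite /hi indicE; have [xN|xN] := boolP (x \in N).
    by rewrite mule1 addey ?leey// gt_eqF// (lt_le_trans _ (g0 x)).
  by rewrite mule0 adde0 fg //; move: xN; rewrite notin_setE.
have aehi : ae_eq (mu n) setT hi g.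
  exists N; split => // x /= /not_implyP[_]; apply: contra_notP => xN.
  by rewrite /hi indicE memNset// mule0 adde0.
have aelo : ae_eq (mu n) setT lo g.
  exists N; split => // x /= /not_implyP[_]; apply: contra_notP => xN.
  by rewrite /lo indicE mem_set// mule1.
have /andP[_ H1] := le_lint lo0 lof; have /andP[_ H2] := le_lint f0 fhi.
rewrite (lintE lo0 mlo) in H1; rewrite (lintE hi0 mhi) in H2.
rewrite (ge0_ae_eq_integral measurableT mlo mg) in H1 => //.
rewrite (ge0_ae_eq_integral measurableT mhi mg) in H2 => //.
by apply/le_anti/andP.
Qed.

Lemma integE n (E : set 'rV[R]_n) (f : borelT R n -> \bar R) :
  measurable (E : set (borelT R n)) -> (forall x, 0 <= f x)%E ->
  measurable_fun setT f -> integ E f = (\int[mu n]_(x in E) f x)%E.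
Proof.
move=> mE f0 mf; rewrite integral_mkcond -lintE//.
- by move=> x; rewrite patchE; case: ifP.
- by apply/(measurable_restrictT _ mE); exact: measurable_funS mf.
Qed.

Lemma lebE n (E : set 'rV[R]_n) : measurable (E : set (borelT R n)) -> leb E = mu n E.
Proof. by move=> mE; rewrite /leb integE// integral_cst// mul1e. Qed.

Lemma mu_box n (J : 'I_n -> set R) (a : 'I_n -> R) :
  (forall i, measurable (J i : set (measurableTypeR R))) ->
  (forall i, lebesgue_measure (J i) = (a i)%:E) ->
  mu n [set x : borelT R n | forall i, J i (x 0 i)] = (\prod_i a i)%:E.
Proof.
move=> mJ Ja; rewrite -lebE; last exact: measurable_forall_coord.
elim: n => [|n IH] in J a mJ Ja *.
  by rewrite /leb/integ/= big_ord0 mem_set//; case.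
rewrite big_ord_recl /leb/integ/=.
rewrite (eq_integral (fun t : measurableTypeR R => (\prod_(i < n) a (lift ord0 i))%:E * (\1_(J ord0) t)%:E)%E); last first.
  move=> t _; rewrite -(IH (fun i => J (lift ord0 i)))// indicE /leb/integ.
  have [/set_mem tJ|tJ] := boolP (t \in J ord0).
    rewrite mule1; congr lint; apply/funext => y; congr (if _ then _ else _).
    apply/idP/idP => /set_mem /= yP; apply/mem_set => /= i.
      by have := yP (lift ord0 i); rewrite (rcons_ptS (t, y)).
    by have [j ->|->] := unliftP ord0 i; rewrite ?(rcons_ptS (t, y)) ?(rcons_pt0 (t, y)).
  rewrite mule0; transitivity (lint (fun _ : 'rV[R]_n => 0%:E : \bar R)).
    congr lint; apply/funext => y; rewrite ifF//; apply/negbTE; apply: contra tJ.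
    by move=> /set_mem/= /(_ ord0); rewrite (rcons_pt0 (t, y)) => /mem_set.
  by rewrite lintE//= integral0.
rewrite ge0_integralZl//=; last 2 first.
- by apply/measurable_EFinP; exact: measurable_indic.
- rewrite lee_fin; apply: prodr_ge0 => i _; rewrite -lee_fin -Ja; exact: measure_ge0.
rewrite integral_indic//.
rewrite [X in (_ * X)%E](_ : _ = (a ord0)%:E); last by rewrite setIT; exact: Ja.
by rewrite -EFinM mulrC.
Qed.

End borel_space.

(** * Measures with a density *)

Section density_measure.
Context d (T : measurableType d) (R : realType) (m : {measure set T -> \bar R}).
Variables (h : T -> \bar R) (h0 : forall x, (0 <= h x)%E) (mh : measurable_fun setT h).

(** Carrying the two proofs as arguments lets the measure structure be attached to [mdens h0 mh]
    canonically. *)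
Definition mdens (h0 : forall x, (0 <= h x)%E) (mh : measurable_fun setT h) :
  set T -> \bar R := fun A => (\int[m]_(x in A) h x)%E.

Let mdens0 : mdens h0 mh set0 = 0%E.
Proof. exact: integral_set0. Qed.

Let mdens_ge0 A : (0 <= mdens h0 mh A)%E.
Proof. by apply: integral_ge0 => x _. Qed.

Let mdens_sigma_additive : semi_sigma_additive (mdens h0 mh).
Proof.
move=> F mF tF mUF; rewrite /mdens ge0_integral_bigcup//; last first.
  exact: measurable_funS mh.
by apply: is_cvg_nneseries => n _ _; exact: integral_ge0.
Qed.

HB.instance Definition _ := isMeasure.Build _ _ _ (mdens h0 mh)
  mdens0 mdens_ge0 mdens_sigma_additive.

Import HBNNSimple.

(** Simple functions and monotone convergence; finiteness of [h] makes multiplication by [h x]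
    commute with the limit. *)
Lemma integral_mdens (f : T -> \bar R) : (forall x, h x < +oo)%E ->
  (forall x, 0 <= f x)%E ->
  measurable_fun setT f ->
  (\int[mdens h0 mh]_x f x = \int[m]_x (f x * h x))%E.
Proof.
move=> hfin f0 mf; pose f_ := nnsfun_approx measurableT mf.
transitivity (limn (fun n => \int[mdens h0 mh]_x (f_ n x)%:E)%E).
  rewrite -monotone_convergence//.
  - apply: eq_integral => y _; apply/esym/cvg_lim => //.
    by apply: cvg_nnsfun_approx => // *; exact: f0.
  - by move=> n; exact/measurable_EFinP/measurable_funP.
  - by move=> n y _; rewrite lee_fin.
  - by move=> y _ k n kn; rewrite lee_fin; exact/lefP/nd_nnsfun_approx.
have mfh n : measurable_fun setT (fun x => ((f_ n x)%:E * h x)%E).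
  by apply: emeasurable_funM => //; exact/measurable_EFinP/measurable_funP.
transitivity (limn (fun n => \int[m]_x ((f_ n x)%:E * h x))%E); last first.
  rewrite -monotone_convergence//.
  - apply: eq_integral => y _; apply/cvg_lim => //.
    apply: cvgeZr; first by rewrite ge0_fin_numE.
    by apply: cvg_nnsfun_approx => // *; exact: f0.
  - by move=> n y _; rewrite mule_ge0// lee_fin.
  - move=> y _ k n kn; apply: lee_wpmul2r => //.
    by rewrite lee_fin; exact/lefP/nd_nnsfun_approx.
congr (limn _); apply/funext => n.
under [LHS]eq_integral do rewrite fimfunE -fsumEFin//.
rewrite ge0_integral_fsum//; last 2 first.
- by move=> y; exact/measurable_EFinP/measurable_funM.
- by move=> y x _; rewrite nnfun_muleindic_ge0.
rewrite [RHS](eq_integral (fun x => \sum_(y \in range (f_ n))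
    (y%:E * (\1_(f_ n @^-1` [set y]) x)%:E * h x))%E); last first.
  move=> x _; rewrite fimfunE -fsumEFin// ge0_mule_fsuml//.
  by move=> y; rewrite nnfun_muleindic_ge0.
rewrite ge0_integral_fsum//; last 2 first.
- move=> y; apply: emeasurable_funM => //.
  by apply/measurable_EFinP/measurable_funM => //; exact: measurable_indic.
- by move=> y x _; rewrite mule_ge0// nnfun_muleindic_ge0.
apply: eq_fsbigr => y; rewrite inE => -[x _ <-].
have fy0 : (0 <= f_ n x)%R by [].
under [RHS]eq_integral do rewrite -muleA.
rewrite integralZl_indic_nnsfun// ge0_integralZl//; last 2 first.
- by apply: emeasurable_funM => //; apply/measurable_EFinP; exact: measurable_indic.
- by move=> z _; rewrite mule_ge0.
congr (_ * _)%E; rewrite integral_indic// setIT.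
rewrite -[LHS]/(\int[m]_(z in f_ n @^-1` [set f_ n x]) h z)%E [LHS]integral_mkcond.
apply: eq_integral => z _; rewrite patchE indicE.
by case: ifPn => _; rewrite ?mul1e ?mul0e.
Qed.

Lemma integral_mdens_set (D : set T) (f : T -> \bar R) : measurable D ->
  (forall x, h x < +oo)%E -> (forall x, 0 <= f x)%E -> measurable_fun setT f ->
  (\int[mdens h0 mh]_(x in D) f x = \int[m]_(x in D) (f x * h x))%E.
Proof.
move=> mD hfin f0 mf; rewrite [LHS]integral_mkcond integral_mdens//.
- rewrite [RHS]integral_mkcond; apply: eq_integral => x _.
  by rewrite !patchE; case: ifP => // _; rewrite mul0e.
- by move=> x; rewrite patchE; case: ifP.
- by apply/(measurable_restrictT _ mD); exact: measurable_funTS.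
Qed.

Lemma mdens_null (D : set T) : measurable D -> m D = 0%E -> mdens h0 mh D = 0%E.
Proof.
by move=> mD D0; apply: null_set_integral => //; exact: measurable_funTS.
Qed.

Lemma mdens_gt0 (D : set T) : measurable D -> (forall x, 0 < h x)%E ->
  (0 < m D)%E -> (0 < mdens h0 mh D)%E.
Proof.
move=> mD hp D0; rewrite lt_neqAle measure_ge0 andbT eq_sym.
apply/negP => /eqP H; move: D0; apply/negP; rewrite -leNgt le_eqVlt; apply/orP; left.
have mhD : measurable_fun D h by exact: measurable_funTS.
have := ae_eq_integral_abs m mD mhD.
rewrite (eq_integral h); last by move=> x _; rewrite gee0_abs.
move=> [/(_ H) [N [mN N0 DN]] _]; apply/eqP/(subset_measure0 mD mN) => // x Dx.
by apply: DN => /= /(_ Dx) hx; have := hp x; rewrite hx ltxx.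
Qed.

End density_measure.

(** * Nested countable partitions *)

(* [idx k x] is a label of the cell containing [x] in the [k]-th partition;
   [atom k x] is that cell. *)
Section filtration.
Context d (T : measurableType d) (R : realType) (I : countType) (idx : nat -> T -> I).

Definition atom k x : set T := [set y | idx k y = idx k x].

Hypothesis midx : forall k x, measurable (atom k x).
Hypothesis nidx : forall k x y, idx k.+1 x = idx k.+1 y -> idx k x = idx k y.

Lemma atom_refl k x : atom k x x. Proof. by []. Qed.

Lemma atom_eq k x y : atom k x y -> atom k y = atom k x.
Proof. by move=> xy; apply/seteqP; split => z; rewrite /atom/= xy. Qed.

Lemma atom_sub j k x : (j <= k)%N -> atom k x `<=` atom j x.
Proof.
move=> /subnK <-; elim: (k - j)%N => // i IH y /nidx xy; exact: IH.
Qed.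

Lemma fiber_measurable (A : set T) k :
  (forall x y, A x -> atom k x y -> A y) -> measurable A.
Proof.
move=> Ak.
rewrite (_ : A = \bigcup_(i in idx k @` A) (idx k @^-1` [set i])).
  apply: bigcup_count_measurable => _ [x _ <-].
  by rewrite (_ : _ @^-1` _ = atom k x).
apply/seteqP; split=> [x Ax|x [_ [y Ay <-]] /= xy]; first by exists (idx k x) => //; exists x.
exact: Ak xy.
Qed.

Lemma bigcup_measure_le (m1 m2 : {measure set T -> \bar R}) (c : R)
    (F : nat -> set T) (E1 E2 : set T) : 0 <= c ->
  measurable E1 -> measurable E2 -> (forall n, measurable (F n)) -> trivIset setT F ->
  (forall n, m1 (F n `&` E1) <= c%:E * m2 (F n `&` E2))%E ->
  (m1 ((\bigcup_n F n) `&` E1) <= c%:E * m2 ((\bigcup_n F n) `&` E2))%E.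
Proof.
move=> c0 mE1 mE2 mF tF H; rewrite !setI_bigcupl !measure_bigcup//.
- rewrite -nneseriesZl//; apply: lee_nneseries => // n _; exact: H.
- by move=> n _; exact: measurableI.
- by apply: trivIset_setIr.
- by move=> n _; exact: measurableI.
- by apply: trivIset_setIr.
Qed.

Lemma fiber_measure_le (m1 m2 : {measure set T -> \bar R}) (c : R) k
    (A E1 E2 : set T) : 0 <= c -> measurable E1 -> measurable E2 ->
  (forall x y, A x -> atom k x y -> A y) ->
  (forall x, A x -> m1 (atom k x `&` E1) <= c%:E * m2 (atom k x `&` E2))%E ->
  (m1 (A `&` E1) <= c%:E * m2 (A `&` E2))%E.
Proof.
move=> c0 mE1 mE2 Ak H.
(* [pickle_inv] decodes each label from exactly one integer, so the sets [F n] are disjoint as well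
   as exhaustive. *)
pose F n := if pickle_inv n is Some i then A `&` (idx k @^-1` [set i]) else set0.
have FE n : F n = set0 \/ exists2 x, A x & F n = atom k x.
  rewrite /F; case: pickle_inv => [i|]; last by left.
  have [[x [Ax xi]]|/set0P/negP/negPn/eqP] := pselect ((A `&` idx k @^-1` [set i]) !=set0).
    right; exists x => //; apply/seteqP; split => [y [Ay yi]|y xy].
      by rewrite /atom/= yi xi.
    by split; [exact: Ak xy|rewrite /= xy].
  by left.
rewrite (_ : A = \bigcup_n F n).
  apply: bigcup_measure_le => //.
  - by move=> n; have [->//|[x _ ->]//] := FE n.
  - apply/trivIsetP => i j _ _; apply: contraNeq => /set0P[x []].
    have invK n (a : I) : pickle_inv n = Some a -> n = pickle a.
      by have := @pickle_invK I n; case: pickle_inv => //= b <- [->].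
    rewrite /F; case Ei: (pickle_inv i) => [a|//]; case Ej: (pickle_inv j) => [b|//].
    by move=> [_ /= xa] [_ /= xb]; rewrite (invK _ _ Ei) (invK _ _ Ej) -xa -xb.
  - move=> n; have [->|[x Ax ->]] := FE n; last exact: H.
    by rewrite set0I measure0 mule_ge0.
apply/seteqP; split => [x Ax|x [n _]].
  by exists (pickle (idx k x)) => //; rewrite /F pickleK_inv.
by rewrite /F; case: pickle_inv => // i [].
Qed.

Section stopping.
Variable (G : nat -> set T).
Hypothesis GP : forall k x y, G k x -> atom k x y -> G k y.

(** When [G k] is a union of cells of generation k, these are the points whose largest cell in the
    family has generation k: the stopping cells of a Calderon-Zygmund selection. *)
Definition first_hit k : set T := [set x | G k x /\ forall j, (j < k)%N -> ~ G j x].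

Lemma first_hit_atom k x y : first_hit k x -> atom k x y -> first_hit k y.
Proof.
move=> [Gx Gj] xy; split; first exact: GP xy.
move=> j jk Gy; apply: (Gj j jk); apply: GP Gy _.
by apply/esym; exact: (atom_sub (ltnW jk) xy).
Qed.

Lemma bigcup_first_hit : \bigcup_k first_hit k = \bigcup_k G k.
Proof.
apply/seteqP; split => [x [k _ [Gk _]]|x [k _ Gk]]; first by exists k.
have exG : exists k, `[< G k x >] by exists k; exact/asboolP.
exists (ex_minn exG) => //; case: ex_minnP => l /asboolP Gl lmin; split => // j jl Gj.
by have := lmin j; rewrite leqNgt jl => /(_ (asboolT Gj)).
Qed.

Lemma measurable_first_hit k : measurable (first_hit k).
Proof. by apply: fiber_measurable => x y; exact: first_hit_atom. Qed.

Lemma measurable_hit : measurable (\bigcup_k G k).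
Proof.
by rewrite -bigcup_first_hit; apply: bigcupT_measurable => k; exact: measurable_first_hit.
Qed.

(** Maximal cells are pairwise disjoint and countably many, so an inequality between two measures
    checked on each of them sums over their union. The covering arguments below pass through this
    form. *)
Lemma stopping_measure_le (m1 m2 : {measure set T -> \bar R}) (c : R) (E1 E2 : set T) :
  0 <= c -> measurable E1 -> measurable E2 ->
  (forall k x, first_hit k x -> m1 (atom k x `&` E1) <= c%:E * m2 (atom k x `&` E2))%E ->
  (m1 ((\bigcup_k G k) `&` E1) <= c%:E * m2 ((\bigcup_k G k) `&` E2))%E.
Proof.
move=> c0 mE1 mE2 H; rewrite -bigcup_first_hit; apply: bigcup_measure_le => //.
- exact: measurable_first_hit.
- apply/trivIsetP => i j _ _; apply: contraNeq => /set0P[x [[Gi Hi] [Gj Hj]]].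
  by case: (ltngtP i j) => // [/Hj|/Hi].
- move=> k; apply: (@fiber_measure_le _ _ _ k) => //; last by move=> x; exact: H.
  by move=> x y; exact: first_hit_atom.
Qed.

End stopping.

Section differentiation.
Hypothesis gidx : (@measurable _ T) `<=` <<s [set A | exists k x, A = atom k x] >>.

(* The topology generated by the cells; outer regularity for it replaces the
   Lebesgue differentiation theorem. *)
Definition atom_open (U : set T) := forall x, U x -> exists k, atom k x `<=` U.

Lemma measurable_atom_open U : atom_open U -> measurable U.
Proof.
move=> oU; rewrite (_ : U = \bigcup_k [set x | atom k x `<=` U]).
  apply: measurable_hit => k x y /= xU xy; by rewrite (atom_eq xy).
apply/seteqP; split => [x /oU[k kU]|x [k _ /=]]; first by exists k.
by apply; exact: atom_refl.
Qed.

(** Sets that are outer regular together with their complements form a sigma-algebra containing the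
    cells, and the cells generate all measurable sets. *)
Lemma atom_open_regular (nu : {measure set T -> \bar R}) (A : set T) (e : R) :
  (nu setT < +oo)%E -> measurable A -> 0 < e ->
  exists U, [/\ atom_open U, A `<=` U & (nu (U `\` A) <= e%:E)%E].
Proof.
move=> nufin mA.
pose outer A := forall e : R, 0 < e ->
  exists U, [/\ atom_open U, A `<=` U & (nu (U `\` A) <= e%:E)%E].
suff: [set A | [/\ measurable A, outer A & outer (~` A)]] A by case=> _ + _; exact.
apply: (smallest_sub _ _ (gidx mA)); last first.
  move=> _ [k [x ->]]; split => // {}e e0.
    exists (atom k x); split => //; last by rewrite setDv measure0 lee_fin ltW.
    by move=> y xy; exists k; rewrite (atom_eq xy).
  exists (~` atom k x); split => //; last by rewrite setDv measure0 lee_fin ltW.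
  move=> y xy; exists k => z yz xz; apply: xy; by rewrite /atom/= -yz.
split.
- split=> // {}e e0.
    exists set0; split => //; by rewrite set0D measure0 lee_fin ltW.
  exists setT; split => //; last by rewrite setC0 setDv measure0 lee_fin ltW.
  by move=> x _; exists 0%N.
- by move=> B [mB oB oB']; rewrite setTD; split; rewrite ?setCK//; exact: measurableC.
move=> B HB.
have mB : measurable (\bigcup_i B i) by apply: bigcupT_measurable => i; have [] := HB i.
split => // {A mA}e e0.
  have /choice[U UP] i : exists U, [/\ atom_open U, B i `<=` U &
      (nu (U `\` B i) <= (e / (2 ^ i.+1)%:R)%:E)%E].
    by have [_ + _] := HB i; apply; rewrite divr_gt0// ltr0n expn_gt0.
  have oU : atom_open (\bigcup_i U i).
    move=> x [i _ Ux]; have [oUi _ _] := UP i; have [k kU] := oUi x Ux.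
    by exists k => y /kU Uy; exists i.
  exists (\bigcup_i U i); split => //.
    by move=> x [i _ Bx]; exists i => //; have [_ + _] := UP i; apply.
  apply: le_trans (epsilon_trick0 xpredT (ltW e0)).
  apply: (@le_trans _ _ (\sum_(i <oo) nu (U i `\` B i))%E).
    apply: measure_sigma_subadditive.
    - move=> i; apply: measurableD; last by have [] := HB i.
      by apply: measurable_atom_open; have [] := UP i.
    - by apply: measurableD => //; exact: measurable_atom_open.
    - move=> x [[i _ Ux] nB]; exists i => //; split => // Bx; apply: nB; by exists i.
  by apply: lee_nneseries => // i _; have [_ _] := UP i.
(* For the complement of the union, open neighbourhoods of the complements are intersected. Finite
   intersections stay open, so half of [e] pays for truncating at some [m], by continuity from
   above, and half for the neighbourhoods. *)
have e20 : 0 < e / 2 by rewrite divr_gt0.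
have /choice[U UP] i : exists U, [/\ atom_open U, ~` B i `<=` U &
    (nu (U `\` ~` B i) <= ((e / 2) / (2 ^ i.+1)%:R)%:E)%E].
  by have [_ _] := HB i; apply; rewrite divr_gt0// ltr0n expn_gt0.
pose W m := \bigcap_(i in `I_m) U i.
have oW m : atom_open (W m).
  elim: m => [|m IH].
    by move=> x _; exists 0%N => y _ i.
  move=> x Wx.
  have [k kW] := IH x (fun i im => Wx i (ltnW im)).
  have [oUm _ _] := UP m; have [l lU] := oUm x (Wx m (ltnSn m)).
  exists (maxn k l) => y xy i /=; rewrite ltnS leq_eqVlt => /predU1P[->|im].
    by apply: lU; exact: atom_sub (leq_maxr k l) _ xy.
  by apply: kW im; exact: atom_sub (leq_maxl k l) _ xy.
have mU i : measurable (U i) by apply: measurable_atom_open; have [] := UP i.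
have mW m : measurable (W m) by exact: measurable_atom_open.
have WE : \bigcap_m W m = \bigcap_i U i.
  apply/seteqP; split => x Ux i _; first by apply: (Ux i.+1) => //=.
  by move=> j _; exact: Ux.
have mWI : measurable (\bigcap_m W m) by rewrite WE; exact: bigcapT_measurable.
have cW : nu \o W @ \oo --> nu (\bigcap_m W m).
  apply: nonincreasing_cvg_mu => //.
  - by apply: le_lt_trans nufin; apply: le_measure; rewrite ?inE.
  - move=> i j ij; apply/subsetPset => x Wx l /= li; apply: Wx => /=.
    exact: leq_trans ij.
have fin A : measurable A -> nu A \is a fin_num.
  move=> mA; rewrite ge0_fin_numE//; apply: le_lt_trans nufin.
  by apply: le_measure; rewrite ?inE.
have [m Wm] : exists m, (nu (W m) <= nu (\bigcap_m W m) + (e / 2)%:E)%E.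
  apply: contrapT => /forallNP nW.
  have : (nu (\bigcap_m W m) + (e / 2)%:E <= nu (\bigcap_m W m))%E.
    rewrite -{2}(cvg_lim _ cW)//; apply: lime_ge; first by apply/cvg_ex; eexists; exact: cW.
    by apply: nearW => m; apply/ltW; rewrite ltNge; apply/negP; exact: nW.
  by rewrite leNgt lteDl ?fin// lte_fin e20.
set A' := ~` \bigcup_i B i.
have mA' : measurable A' by exact: measurableC.
have A'W : A' `<=` \bigcap_m W m.
  rewrite WE => x nx i _; have [_ + _] := UP i; apply; move=> Bx; apply: nx; by exists i.
have A'Wm : A' `<=` W m by move=> x /A'W; exact.
exists (W m); split => //.
rewrite -(@leeD2lE _ (nu A')) ?fin//.
have addD V : measurable V -> A' `<=` V -> (nu A' + nu (V `\` A') = nu V)%E.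
  move=> mV A'V; rewrite -measureU//; first by rewrite setDUK.
  - exact: measurableD.
  - by rewrite setDIK.
rewrite addD//; apply: le_trans Wm _.
rewrite -(addD _ mWI A'W) -addeA; apply: leeD2l.
rewrite [leRHS](_ : _ = (e / 2)%:E + (e / 2)%:E)%E; last by rewrite -EFinD -splitr.
rewrite leeD2r//; apply: le_trans (epsilon_trick0 xpredT (ltW e20)).
apply: (@le_trans _ _ (\sum_(i <oo) nu (U i `\` ~` B i))%E); last first.
  by apply: lee_nneseries => // i _; have [_ _] := UP i.
apply: measure_sigma_subadditive.
- by move=> i; apply: measurableD => //; apply: measurableC; have [] := HB i.
- exact: measurableD.
- rewrite WE => x [Ux nx]; have [i _ Bx] : (\bigcup_i B i) x by apply: contrapT.
  by exists i => //; split; [exact: Ux|apply].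
Qed.

(** A form of the density theorem. Cover [N] by an open [U] with excess e; summing the hypothesis
    over the maximal cells inside [U] gives nu N <= b (nu N + e), and b < 1 forces nu N = 0 as e
    shrinks. *)
Lemma differentiation_null (nu : {measure set T -> \bar R}) (N : set T) (b : R) :
  (nu setT < +oo)%E -> measurable N -> 0 <= b < 1 ->
  (forall k x, N x -> nu (N `&` atom k x) <= b%:E * nu (atom k x))%E ->
  nu N = 0%E.
Proof.
move=> nufin mN /andP[b0 b1] H.
have fin A : measurable A -> nu A \is a fin_num.
  move=> mA; rewrite ge0_fin_numE//; apply: le_lt_trans nufin.
  by apply: le_measure; rewrite ?inE.
have key e : 0 < e -> (nu N <= b%:E * (nu N + e%:E))%E.
  move=> e0; have [U [oU NU Ue]] := atom_open_regular nufin mN e0.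
  pose G k := [set x | atom k x `<=` U].
  have GP k x y : G k x -> atom k x y -> G k y by move=> /= xU xy; rewrite /G/= (atom_eq xy).
  have UG : \bigcup_k G k = U.
    apply/seteqP; split => [x [k _]|x /oU[k kU]]; last by exists k.
    by apply; exact: atom_refl.
  have mU := measurable_atom_open oU.
  have := @stopping_measure_le G GP nu nu b N setT b0 mN measurableT.
  rewrite UG setIT (setIidr NU) => le; apply: le_trans (le _) _.
    move=> k x _; rewrite setIT.
    have [[y [xy Ny]]|/set0P/negP/negPn/eqP ->] := pselect ((atom k x `&` N) !=set0).
      by rewrite setIC -(atom_eq xy); exact: H.
    by rewrite measure0 mule_ge0.
  apply: lee_wpmul2l => //; rewrite -(setDUK NU) measureU//.
  - by rewrite leeD2l.
  - exact: measurableD.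
  - by rewrite setDIK.
have nuN0 : (0 <= nu N)%E by exact: measure_ge0.
move: (fin _ mN) nuN0 key; case: (nu N) => // r _; rewrite lee_fin => r0 key.
congr EFin; apply/le_anti/andP; split=> //.
rewrite leNgt; apply/negP => r1.
have e0 : 0 < (1 - b) * r / 2 by rewrite divr_gt0// mulr_gt0// subr_gt0.
have := key _ e0; rewrite -EFinD -EFinM lee_fin leNgt => /negP; apply.
rewrite mulrDr.
have : b * ((1 - b) * r / 2) < (1 - b) * r.
  apply: (@le_lt_trans _ _ (1 * ((1 - b) * r / 2))); first by rewrite ler_pM2r ?ltW.
  by rewrite mul1r ltr_pdivrMr// ltr_pMr// ?ltr1n// mulr_gt0// subr_gt0.
by rewrite -(ltrD2l (b * r)) => /lt_le_trans; apply; rewrite mulrBl mul1r addrCA subrr addr0.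
Qed.

End differentiation.
End filtration.

(** * Decay of relative measure *)

Section decay.
Context d (T : measurableType d) (R : realType) (I : countType) (idx : nat -> T -> I).
Hypothesis midx : forall k x, measurable (atom idx k x).
Hypothesis nidx : forall k x y, idx k.+1 x = idx k.+1 y -> idx k x = idx k y.
Hypothesis gidx : (@measurable _ T) `<=` <<s [set A | exists k x, A = atom idx k x] >>.
Local Notation atom := (atom idx).

(* A Calderon-Zygmund iteration: in the maximal cells where E has relative u-mass
   more than al/D, it has relative u-mass at most al by doubling; their union has
   u-mass at most (al/D)^(j-1), and contains E up to a v-null set. *)
Lemma measure_decay (u v : {measure set T -> \bar R}) (x0 : T) (D al b : R) :
  1 <= D -> 0 < al < 1 -> 0 <= b < 1 ->
  (u (atom 0 x0) < +oo)%E -> (v (atom 0 x0) < +oo)%E ->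
  (forall k x, atom 0 x0 x -> u (atom k x) <= D%:E * u (atom k.+1 x))%E ->
  (forall k x F, atom 0 x0 x -> measurable F -> F `<=` atom k x ->
     u F <= al%:E * u (atom k x) -> v F <= b%:E * v (atom k x))%E ->
  forall j E, measurable E -> E `<=` atom 0 x0 ->
    (u E <= ((al / D) ^+ j)%:E * u (atom 0 x0))%E ->
    (v E <= (b ^+ j)%:E * v (atom 0 x0))%E.
Proof.
move=> D1 /andP[al0 al1] /andP[b0 b1] ufin vfin dbl H j.
have D0 : 0 < D by exact: lt_le_trans D1.
set lam := al / D; have lam0 : 0 < lam by rewrite divr_gt0.
have lamal : lam <= al by rewrite ler_pdivrMr// ler_pMr.
have lam1 : lam <= 1 by apply: le_trans lamal _; exact: ltW.
elim: j => [|j IH] E mE EP uE.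
  by rewrite expr0 mul1e; apply: le_measure; rewrite ?inE.
pose G k := [set x | (lam%:E * u (atom k x) < u (atom k x `&` E))%E].
have GP k x y : G k x -> atom k x y -> G k y by rewrite /G/= => Gx xy; rewrite (atom_eq xy).
set W := \bigcup_k G k.
have mW : measurable W by exact: (measurable_hit midx nidx GP).
have WP : W `<=` atom 0 x0.
  move=> x [k _]; rewrite /G/= => Gx.
  have [[y [xy Ey]]|/set0P/negP/negPn/eqP E0] := pselect ((atom k x `&` E) !=set0).
    have yx0 : idx 0 y = idx 0 x0 by exact: EP.
    exact: etrans (esym (atom_sub nidx (leq0n k) xy)) yx0.
  move: Gx; rewrite E0 measure0 => /(le_lt_trans _) => /(_ 0%E).
  by rewrite ltxx mule_ge0// ?lee_fin ?ltW// => /(_ isT).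
have uW : (u W <= ((al / D) ^+ j)%:E * u (atom 0 x0))%E.
  apply: (@le_trans _ _ (lam^-1%:E * u E)%E).
    rewrite -[W in leLHS]setIT; apply: (@le_trans _ _ (lam^-1%:E * u (W `&` E))%E).
      apply: (@stopping_measure_le _ _ R _ _ midx nidx G GP) => //; first by rewrite invr_ge0 ltW.
      move=> k x [Gx _]; rewrite setIT lee_pdivlMl//; exact: ltW.
    apply: lee_wpmul2l; first by rewrite lee_fin invr_ge0 ltW.
    by apply: le_measure; rewrite ?inE//; exact: measurableI.
  rewrite lee_pdivrMl//; apply: le_trans uE _.
  by rewrite muleA -EFinM -exprS.
have vW := IH W mW WP uW.
have vEW : v (E `\` W) = 0%E.
  have mP0 := midx 0 x0.
  have vE : v (E `\` W) = mrestr v mP0 (E `\` W).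
    by rewrite /mrestr setIidl// => x [/EP].
  rewrite vE; apply: (differentiation_null midx nidx gidx (b := b)) => //.
  - by rewrite -[ltLHS]/(v (setT `&` atom 0 x0)) setTI.
  - exact: measurableD.
  - by rewrite b0.
  - move=> k x [Ex Wx].
    have Px : atom 0 x0 x := EP _ Ex.
    have Px' : atom k x `<=` atom 0 x0.
      rewrite -(atom_eq Px); exact: (atom_sub nidx (leq0n k)).
    change (v ((E `\` W) `&` atom k x `&` atom 0 x0) <= b%:E * v (atom k x `&` atom 0 x0))%E.
    rewrite (setIidl Px') setIidl; last by move=> y [_ /Px'].
    apply: (@le_trans _ _ (v (atom k x `&` E))).
      apply: le_measure; rewrite ?inE.
      - by apply: measurableI => //; exact: measurableD.
      - exact: measurableI.
      - by move=> y [[]].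
    apply: H => //; first exact: measurableI.
    have : ~ G k x by move=> Gx; apply: Wx; exists k.
    rewrite /G/= => /negP; rewrite -leNgt => /le_trans; apply.
    by apply: lee_wpmul2r => //; rewrite lee_fin.
have -> : v E = v (W `&` E).
  rewrite -{1}(setDUK (@subIsetl _ E W)) measureU//.
  - rewrite (_ : E `\` (E `&` W) = E `\` W); last by rewrite setDIr setDv set0U.
    by rewrite [X in (_ + X)%E](_ : _ = 0%E) ?adde0 1?setIC.
  - exact: measurableI.
  - by apply: measurableD => //; exact: measurableI.
  - by rewrite setDIK.
apply: (@le_trans _ _ (b%:E * v (W `&` setT))%E).
  apply: (@stopping_measure_le _ _ R _ _ midx nidx G GP) => //.
  move=> k x [Gx Gj]; rewrite setIT.
  have Px : atom 0 x0 x by apply: WP; exists k.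
  apply: H => //; first exact: measurableI.
  case: k => [|k] in Gx Gj *.
    (* The top cell is never selected, its density being at most lam^(j+1) <= lam. So a selected
       cell has a rejected parent, and doubling converts density [lam] in the parent into al = D lam
       in the cell. *)
    exfalso; move: Gx; rewrite /G/= ltNge => /negP; apply.
    rewrite (atom_eq Px) setIidr//; apply: le_trans uE _.
    apply: lee_wpmul2r => //; rewrite lee_fin exprS.
    by rewrite ler_piMr ?(ltW lam0)// exprn_ile1// (ltW lam0).
  have := Gj k (ltnSn k); rewrite /G/= => /negP; rewrite -leNgt => Gk.
  apply: (@le_trans _ _ (u (atom k x `&` E))).
    apply: le_measure; rewrite ?inE; [exact: measurableI|exact: measurableI|].
    by apply: setSI; exact: (atom_sub nidx (leqnSn k)).
  apply: le_trans Gk _; apply: (@le_trans _ _ (lam%:E * (D%:E * u (atom k.+1 x)))%E).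
    by apply: lee_wpmul2l; [rewrite lee_fin ltW|exact: dbl].
  by rewrite muleA -EFinM divfK ?gt_eqF.
rewrite setIT exprS EFinM -muleA; apply: lee_wpmul2l; [by rewrite lee_fin|exact: vW].
Qed.

End decay.

(** * Doob's maximal inequality for nested partitions *)

Lemma powR2_gt1 (R : realType) (q : R) : 0 < q -> 1 < 2 `^ q.
Proof.
move=> q0; have := @gt0_ltr_powR R q q0 1 2; rewrite powR1; apply.
- by rewrite nnegrE.
- by rewrite nnegrE.
- by rewrite ltr1n.
Qed.

Lemma indic_gtE (T : Type) (R : realType) (f : T -> \bar R) (a : \bar R) x :
  \1_[set x | (a < f x)%E] x = (a < f x)%E%:R :> R.
Proof.
rewrite indicE; have [ax|ax] := boolP (a < f x)%E; first by rewrite mem_set.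
by rewrite memNset//; exact/negP.
Qed.

Lemma gt0_inv_natE (R : realType) (y : \bar R) : (0 < y)%E ->
  exists k, ((k.+1%:R^-1)%:E < y)%E.
Proof.
case: y => [r| |]//; last by exists 0%N; rewrite ltry.
by rewrite lte_fin => /ltr_add_invr[k]; rewrite add0r => kr; exists k; rewrite lte_fin.
Qed.

Section doob.
Context d (T : measurableType d) (R : realType) (I : countType) (idx : nat -> T -> I).
Hypothesis midx : forall k x, measurable (atom idx k x).
Hypothesis nidx : forall k x y, idx k.+1 x = idx k.+1 y -> idx k x = idx k y.
Local Notation atom := (atom idx).

Definition atom_avg (nu : set T -> \bar R) (h : T -> \bar R) k x : \bar R :=
  ((fine (nu (atom k x)))^-1%:E * (\int[nu]_(y in atom k x) h y))%E.

Definition dmax (nu : set T -> \bar R) (h : T -> \bar R) x : \bar R :=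
  ereal_sup (range (fun k => atom_avg nu h k x)).

Lemma atom_avg_atom nu h k x y : atom k x y -> atom_avg nu h k y = atom_avg nu h k x.
Proof. by move=> xy; rewrite /atom_avg (atom_eq xy). Qed.

Lemma atom_avg_ge0 (nu : {measure set T -> \bar R}) h k x :
  (forall x, 0 <= h x)%E -> (0 <= atom_avg nu h k x)%E.
Proof.
move=> h0; rewrite /atom_avg mule_ge0//; last exact: integral_ge0.
Qed.

Lemma le_atom_avg_dmax nu h k x : (atom_avg nu h k x <= dmax nu h x)%E.
Proof. by apply: ereal_sup_ubound; exists k. Qed.

Lemma dmax_ge0 (nu : {measure set T -> \bar R}) h x :
  (forall x, 0 <= h x)%E -> (0 <= dmax nu h x)%E.
Proof. by move=> h0; apply: le_trans (le_atom_avg_dmax _ _ 0 _); exact: atom_avg_ge0. Qed.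

Lemma dmax_gtE nu h (a : \bar R) :
  [set x | (a < dmax nu h x)%E] = \bigcup_k [set x | (a < atom_avg nu h k x)%E].
Proof.
apply/seteqP; split => x /=.
  by move=> /ereal_sup_gt[_ [k _ <-] ak]; exists k.
by move=> [k _ /= ak]; apply: lt_le_trans ak _; exact: le_atom_avg_dmax.
Qed.

Lemma measurable_dmax nu h : measurable_fun setT (dmax nu h).
Proof.
apply: (measurability _ (ErealGenOInfty.measurableE R)) => //.
move=> _ [_ [y ->] <-]; rewrite setTI.
rewrite (_ : _ @^-1` _ = [set x | (y%:E < dmax nu h x)%E]); last first.
  by apply/seteqP; split => x /=; rewrite in_itv/= andbT.
rewrite dmax_gtE; apply: (measurable_hit midx nidx) => k x z /= xa xz.
by rewrite (atom_avg_atom _ _ xz).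
Qed.

Lemma measurable_gt (h : T -> \bar R) (a : \bar R) : measurable_fun setT h ->
  measurable [set x | (a < h x)%E].
Proof.
move=> mh; rewrite (_ : mkset _ = setT `&` h @^-1` `]a, +oo[%classic).
  by apply: mh => //; exact: emeasurable_itv.
by rewrite setTI; apply/seteqP; split => x /=; rewrite in_itv/= andbT.
Qed.

(** On a maximal cell of average above 2a, the values of [h] up to a account for at most a nu(cell),
    so those above a carry at least as much. Keeping only the region h > a on the right is what
    allows interpolation. *)
Lemma dmax_weak (nu : {measure set T -> \bar R}) h (a : R) :
  (forall k x, 0 < nu (atom k x) < +oo)%E ->
  (forall x, 0 <= h x)%E -> measurable_fun setT h -> 0 < a ->
  (nu [set x | ((2 * a)%:E < dmax nu h x)%E] <=
     a^-1%:E * \int[nu]_(x in [set x | (a%:E < h x)%E]) h x)%E.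
Proof.
move=> nuP h0 mh a0; set H := [set x | (a%:E < h x)%E].
have mH : measurable H by exact: measurable_gt.
rewrite dmax_gtE; set G := fun k => _.
have GP k x y : G k x -> atom k x y -> G k y.
  by rewrite /G/= => Gx xy; rewrite (atom_avg_atom _ _ xy).
have mG := measurable_hit midx nidx GP.
rewrite -[X in nu X]setIT; apply: (@le_trans _ _ (a^-1%:E * mdens nu h0 mh ((\bigcup_k G k) `&` H))%E).
  apply: (@stopping_measure_le _ _ R _ _ midx nidx G GP) => //; first by rewrite invr_ge0 ltW.
  move=> k x [Gx _]; rewrite setIT lee_pdivlMl//; move: Gx; rewrite /G/= /atom_avg.
  have /andP[] := nuP k x; have mA := midx k x; case E: (nu (atom k x)) => [r| |]//=.
  rewrite lte_fin => r0 _; rewrite lte_pdivlMl// -EFinM => Gx.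
  rewrite -(leeD2lE (x := (a * r)%:E))// -EFinM -EFinD.
  rewrite (_ : a * r + a * r = r * (2 * a)); last by ring.
  apply: le_trans (ltW Gx) _.
  rewrite -[X in integral _ X _](setDUK (@subIsetl _ (atom k x) H)) setDIr setDv set0U setUC.
  rewrite ge0_integral_setU//; last 4 first.
  - exact: measurableD.
  - exact: measurableI.
  - by apply: measurable_funTS.
  - by rewrite disj_set2E; apply/eqP/seteqP; split => // z [[_ nz] [_]].
  apply: leeD2r; apply: (@le_trans _ _ (\int[nu]_(y in atom k x `\` H) (cst a%:E y))%E).
    apply: ge0_le_integral => //; first exact: measurableD.
    - exact: measurable_funTS.
    - by move=> z [_ /negP]; rewrite -leNgt.
  rewrite integral_cst; last exact: measurableD.
  rewrite EFinM -E; apply: lee_wpmul2l; first by rewrite lee_fin ltW.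
  by apply: le_measure; rewrite ?inE//; exact: measurableD.
apply: lee_wpmul2l; first by rewrite lee_fin invr_ge0 ltW.
rewrite /mdens; apply: ge0_subset_integral => //; first exact: measurableI.
exact: measurable_funTS.
Qed.

(** The sum is geometric up to the last level below [y], and that level dominates it. *)
Lemma geometric_powR_sum (q s y : R) m : 1 < q -> 0 < s -> 0 <= y ->
  \sum_(i < m) (s * 2 ^+ i) `^ (q - 1) * (s * 2 ^+ i < y)%R%:R <=
  2 `^ (q - 1) / (2 `^ (q - 1) - 1) * y `^ (q - 1).
Proof.
move=> q1 s0 y0; have q10 : 0 < q - 1 by rewrite subr_gt0.
set r := 2 `^ (q - 1).
have r1 : 1 < r by exact: powR2_gt1.
have r10 : 0 < r - 1 by rewrite subr_gt0.
have stp i : (s * 2 ^+ i.+1) `^ (q - 1) = r * (s * 2 ^+ i) `^ (q - 1).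
  by rewrite -powRM ?mulr_ge0 ?exprn_ge0 ?ltW// exprS mulrCA.
have geo k : \sum_(i < k) (s * 2 ^+ i) `^ (q - 1) <= (s * 2 ^+ k) `^ (q - 1) / (r - 1).
  elim: k => [|k IH]; first by rewrite big_ord0 divr_ge0 ?powR_ge0// ltW.
  rewrite big_ord_recr/= stp; apply: (le_trans (lerD IH (lexx _))).
  rewrite [leRHS](_ : _ = (s * 2 ^+ k) `^ (q - 1) / (r - 1) + (s * 2 ^+ k) `^ (q - 1))//.
  by field; rewrite gt_eqF.
elim: m => [|m IH]; first by rewrite big_ord0 !mulr_ge0 ?powR_ge0// invr_ge0 ltW.
have [sy|sy] := boolP (s * 2 ^+ m < y); last by rewrite big_ord_recr/= (negbTE sy) mulr0 addr0.
apply: (@le_trans _ _ (\sum_(i < m.+1) (s * 2 ^+ i) `^ (q - 1))).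
  by apply: ler_sum => i _; rewrite ler_piMr ?powR_ge0// lern1 leq_b1.
apply: (le_trans (geo _)); rewrite stp mulrAC ler_pM2l ?divr_gt0//; last first.
  by rewrite (lt_trans _ r1).
have := @ge0_ler_powR R (q - 1) (ltW q10) (s * 2 ^+ m) y; rewrite !nnegrE.
by apply => //; [rewrite mulr_ge0 ?exprn_ge0// ltW|exact: ltW].
Qed.

Lemma pow2_unbounded (s t : R) : 0 < s -> exists i, t <= s * 2 ^+ i.
Proof.
move=> s0; exists (Num.bound `|t / s|).
rewrite mulrC -ler_pdivrMr//; apply: (le_trans (ler_norm _)).
apply: (le_trans (ltW (archi_boundP (normr_ge0 (t / s))))).
by rewrite -natrX ler_nat; apply/ltnW/ltn_expl.
Qed.

(** A discrete layer-cake: if y lies between s 2^i and s 2^(i+1), the single term of index i is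
    enough; if y is infinite, all terms are present and diverge. *)
Lemma poweR_le_dyadic_sum (q s : R) (y : \bar R) : 1 < q -> 0 < s -> (s%:E < y)%E ->
  (y `^ q <= \sum_(i <oo) (((2 * (s * 2 ^+ i)) `^ q)%:E * (((s * 2 ^+ i)%:E < y)%E%:R)%:E))%E.
Proof.
move=> q1 s0 sy; 
set f := fun i : nat => (((2 * (s * 2 ^+ i)) `^ q)%:E * (((s * 2 ^+ i)%:E < y)%E%:R)%:E)%E.
have q0 : 0 < q by exact: lt_trans q1.
have s2 i : 0 < s * 2 ^+ i by rewrite mulr_gt0// exprn_gt0.
have f0 i : (0 <= f i)%E by rewrite mule_ge0// lee_fin ?powR_ge0.
have f1 i : (f i <= \sum_(i <oo) f i)%E.
  apply: le_trans; last by apply: (nneseries_lim_ge i.+1) => k _ _; exact: f0.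
  by rewrite big_mkord big_ord_recr/= leeDr// sume_ge0.
case: y => [r| |]// in sy f f0 f1 *; last first.
  rewrite poweRyr ?gt_eqF//.
  suff -> : (\sum_(i <oo) f i = +oo)%E by [].
  apply: eq_infty => t; have [i ti] := pow2_unbounded (Num.max 1 t) s0.
  apply: le_trans (f1 i); rewrite /f ltry mule1 lee_fin.
  have [t1 tt] : 1 <= s * 2 ^+ i /\ t <= s * 2 ^+ i.
    by move: ti; rewrite ge_max => /andP[].
  have t2 : s * 2 ^+ i <= 2 * (s * 2 ^+ i) by rewrite ler_pMl// ler1n.
  apply: (le_trans tt); apply: (le_trans t2).
  have := ler_powR (le_trans t1 t2) (ltW q1); rewrite powRr1//.
  by rewrite mulr_ge0 ?(ltW (s2 i)).
have exi : exists i, r <= s * 2 ^+ i by exact: pow2_unbounded.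
case: (ex_minnP exi) => -[|i] ri imin.
  by move: sy; rewrite lte_fin ltNge; rewrite expr0 mulr1 in ri; rewrite ri.
apply: le_trans (f1 i); rewrite /f lte_fin.
have -> /= : s * 2 ^+ i < r by rewrite ltNge; apply/negP => /imin; rewrite ltnn.
rewrite mule1 lee_fin ge0_ler_powR ?nnegrE ?(ltW q0)//.
- by move: sy; rewrite lte_fin => /(lt_trans s0)/ltW.
- by rewrite mulr_ge0 ?ltW.
- by apply: le_trans ri _; rewrite exprS mulrCA.
Qed.

Definition doob_const (q : R) :=
  2 `^ (q + 1) * (2 `^ (q - 1) / (2 `^ (q - 1) - 1) * 2 `^ (q - 1)).

Lemma doob_const_gt0 q : 1 < q -> 0 < doob_const q.
Proof.
move=> q1; have q10 : 0 < q - 1 by rewrite subr_gt0.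
have r1 : 1 < 2 `^ (q - 1) by exact: powR2_gt1.
by rewrite /doob_const !mulr_gt0 ?powR_gt0// invr_gt0 subr_gt0.
Qed.

(** The summand is what the weak-type bound at level s 2^i / 2 yields. One power of the level
    cancels, and a geometric sum of exponent q - 1 remains. *)
Lemma dyadic_sum_le_poweR (q s : R) (y : \bar R) : 1 < q -> 0 < s -> (0 <= y)%E ->
  (\sum_(i <oo) (((2 * (s * 2 ^+ i)) `^ q * (s * 2 ^+ i / 2)^-1)%:E *
     (y * (((s * 2 ^+ i / 2)%:E < y)%E%:R)%:E)) <= (doob_const q)%:E * y `^ q)%E.
Proof.
move=> q1 s0 y0; have q0 : 0 < q by exact: lt_trans q1.
have s2 i : 0 < s * 2 ^+ i by rewrite mulr_gt0// exprn_gt0.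
have c0 := doob_const_gt0 q1.
case: y y0 => [r| |]// y0; last first.
  by rewrite poweRyr ?gt_eqF// gt0_muley ?leey// lte_fin.
apply: lime_le.
  apply: is_cvg_nneseries => i _ _; rewrite !mule_ge0// lee_fin.
  by rewrite mulr_ge0 ?powR_ge0// invr_ge0 divr_ge0// ltW.
apply: nearW => m; rewrite big_mkord /= -EFinM.
under eq_bigr do rewrite -!EFinM lte_fin ltr_pdivrMr//.
rewrite sumEFin lee_fin.
rewrite lee_fin in y0.
apply: (@le_trans _ _ (2 `^ (q + 1) * r * \sum_(i < m) (s * 2 ^+ i) `^ (q - 1) * (s * 2 ^+ i < r * 2)%R%:R)).
  rewrite mulr_sumr; apply: ler_sum => i _.
  set t := s * 2 ^+ i; have t0 : 0 < t := s2 i.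
  rewrite le_eqVlt; apply/orP; left; apply/eqP.
  rewrite powRM ?ltW// powRD ?powRr1 ?pnatr_eq0 ?implybT//.
  rewrite powRB ?(gt_eqF t0) ?implybT// powRr1 ?ltW//.
  by field; rewrite gt_eqF.
apply: (le_trans (ler_wpM2l _ (geometric_powR_sum _ _ _ _))) => //.
- by rewrite mulr_ge0 ?powR_ge0.
- by rewrite mulr_ge0.
rewrite le_eqVlt; apply/orP; left; apply/eqP.
rewrite /doob_const powRM//.
have -> : r `^ q = r * r `^ (q - 1).
  have [->|r0] := eqVneq r 0; first by rewrite powR0 ?gt_eqF// mul0r.
  rewrite powRB ?r0 ?implybT// powRr1// mulrCA divff ?mulr1//.
by ring.
Qed.

(** Interpolation from the weak-type bound, over dyadic levels starting at [s]. The constant is free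
    of [s], so the starting level can be sent to 0. *)
Lemma dmax_strong (nu : {measure set T -> \bar R}) h (q : R) : 1 < q ->
  (forall k x, 0 < nu (atom k x) < +oo)%E ->
  (forall x, 0 <= h x)%E -> measurable_fun setT h ->
  (\int[nu]_x (dmax nu h x `^ q) <= (doob_const q)%:E * \int[nu]_x (h x `^ q))%E.
Proof.
move=> q1 nuP h0 mh; have q0 : 0 < q by exact: lt_trans q1.
have mD : measurable_fun setT (dmax nu h) by exact: measurable_dmax.
have D0 x : (0 <= dmax nu h x)%E by exact: dmax_ge0.
have mDq : measurable_fun setT (fun x => dmax nu h x `^ q)%E.
  by apply: (measurableT_comp (measurable_poweR q)).
have mhq : measurable_fun setT (fun x => h x `^ q)%E.
  by apply: (measurableT_comp (measurable_poweR q)).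
have mind (f : T -> \bar R) (a : \bar R) : measurable_fun setT f ->
    measurable_fun setT (fun x => ((a < f x)%E%:R)%:E : \bar R).
  move=> mf; rewrite (_ : (fun x => _) = EFin \o \1_[set x | (a < f x)%E]).
    by apply/measurable_EFinP; apply: measurable_indic; exact: measurable_gt.
  by apply/funext => x /=; rewrite indic_gtE.
have key s : 0 < s -> (\int[nu]_(x in [set x | (s%:E < dmax nu h x)%E]) (dmax nu h x `^ q)
    <= (doob_const q)%:E * \int[nu]_x (h x `^ q))%E.
  move=> s0.
  have s2 i : 0 < s * 2 ^+ i by rewrite mulr_gt0// exprn_gt0.
  apply: (@le_trans _ _ (\int[nu]_x (\sum_(i <oo) (((2 * (s * 2 ^+ i)) `^ q)%:E *
      (((s * 2 ^+ i)%:E < dmax nu h x)%E%:R)%:E)))%E).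
    rewrite integral_mkcond; apply: ge0_le_integral => //.
    - by move=> x _; rewrite patchE; case: ifP => // _; exact: poweR_ge0.
    - apply/(measurable_restrictT _ (measurable_gt _ mD)); exact: measurable_funTS.
    - apply: ge0_emeasurable_sum => [i x _ _|i _].
        by rewrite mule_ge0// lee_fin powR_ge0.
      by apply: measurable_funeM; exact: mind.
    - move=> x _; rewrite patchE; case: ifPn => [/set_mem/= sx|_]; last first.
        by apply: nneseries_ge0 => i _ _; rewrite mule_ge0// lee_fin powR_ge0.
      exact: poweR_le_dyadic_sum.
  rewrite integral_nneseries//; last 2 first.
  - by move=> i; apply: measurable_funeM; exact: mind.
  - by move=> i x _; rewrite mule_ge0// lee_fin powR_ge0.
  apply: (@le_trans _ _ (\sum_(i <oo) \int[nu]_x (((2 * (s * 2 ^+ i)) `^ q * (s * 2 ^+ i / 2)^-1)%:E *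
     (h x * (((s * 2 ^+ i / 2)%:E < h x)%E%:R)%:E)))%E).
    apply: lee_nneseries => [i _ _|i _].
      by apply: integral_ge0 => x _; rewrite mule_ge0// lee_fin powR_ge0.
    rewrite ge0_integralZl//; last 2 first.
    - exact: mind.
    - by rewrite lee_fin powR_ge0.
    rewrite ge0_integralZl//; last 3 first.
    - by apply: emeasurable_funM => //; exact: mind.
    - by move=> x _; rewrite mule_ge0.
    - by rewrite lee_fin mulr_ge0 ?powR_ge0// invr_ge0 divr_ge0// ltW.
    rewrite (EFinM _ (s * 2 ^+ i / 2)^-1) -muleA.
    apply: lee_wpmul2l; first by rewrite lee_fin powR_ge0.
    have a0 : 0 < s * 2 ^+ i / 2 by rewrite divr_gt0.
    rewrite [X in (X <= _)%E](eq_integral (fun x => (\1_[set x | ((s * 2 ^+ i)%:E < dmax nu h x)%E] x)%:E)); last first.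
      by move=> x _; rewrite indic_gtE.
    rewrite integral_indic//; last exact: measurable_gt.
    have := dmax_weak nuP h0 mh a0; rewrite [2 * _]mulrC divfK// ?setIT.
    move=> /le_trans; apply; rewrite [X in (_ * X <= _)%E]integral_mkcond.
    rewrite le_eqVlt; apply/orP; left; apply/eqP; congr (_ * _)%E.
    apply: eq_integral => x _; rewrite patchE; case: ifPn => [/set_mem/= ->|]; first by rewrite mule1.
    by rewrite notin_setE/= => /negP/negbTE ->; rewrite mule0.
  rewrite -integral_nneseries//; last 2 first.
  - by move=> i; apply: measurable_funeM; apply: emeasurable_funM => //; exact: mind.
  - move=> i x _; rewrite !mule_ge0// lee_fin mulr_ge0 ?powR_ge0// invr_ge0 divr_ge0//.
    exact: ltW.
  rewrite -ge0_integralZl//; last 2 first.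
  - by move=> x _; exact: poweR_ge0.
  - by rewrite lee_fin ltW// doob_const_gt0.
  apply: ge0_le_integral => //.
  - move=> x _; apply: nneseries_ge0 => i _ _.
    rewrite !mule_ge0// lee_fin mulr_ge0 ?powR_ge0// invr_ge0 divr_ge0//.
    exact: ltW.
  - apply: ge0_emeasurable_sum => [i x _ _|i _].
      rewrite !mule_ge0// lee_fin mulr_ge0 ?powR_ge0// invr_ge0 divr_ge0//.
      exact: ltW.
    by apply: measurable_funeM; apply: emeasurable_funM => //; exact: mind.
  - exact: measurable_funeM.
  - move=> x _; exact: dyadic_sum_le_poweR.
(* These sets exhaust the region where the maximal function is positive; elsewhere the integrand is
   0. *)
pose F k := [set x | ((k.+1%:R^-1)%:E < dmax nu h x)%E].
have mF k : measurable (F k) by exact: measurable_gt.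
have -> : (\int[nu]_x (dmax nu h x `^ q) = \int[nu]_(x in \bigcup_k F k) (dmax nu h x `^ q))%E.
  rewrite [RHS]integral_mkcond; apply: eq_integral => x _; rewrite patchE.
  case: ifPn => // /negP nx.
  suff -> : dmax nu h x = 0%E by rewrite poweR0r ?gt_eqF.
  apply/eqP; rewrite eq_le D0 andbT leNgt; apply/negP => x0; apply: nx; apply/mem_set.
  by have [k kx] := gt0_inv_natE x0; exists k.
have cF : (\int[nu]_(x in F k) (dmax nu h x `^ q))%E @[k --> \oo] -->
    (\int[nu]_(x in \bigcup_k F k) (dmax nu h x `^ q))%E.
  apply: ge0_nondecreasing_set_cvg_integral => //.
  - move=> i j ij; apply/subsetPset => x /=; apply: le_lt_trans.
    by rewrite lee_fin lef_pV2 ?posrE ?ltr0n// ler_nat.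
  - by move=> i; exact: measurable_funTS.
  - by move=> i x _; exact: poweR_ge0.
rewrite -(cvg_lim _ cF)//; apply: lime_le; first by apply/cvg_ex; eexists; exact: cF.
by apply: nearW => k; apply: key; rewrite invr_gt0.
Qed.

End doob.

(** * Dyadic grids and the maximal operator *)

Section cubes.
Context {R : realType} {n : nat}.
Implicit Types (c o : 'rV[R]_n) (x y : borelT R n) (l L : R) (f g : borelT R n -> \bar R).
Local Notation mu := (@mu R n).
Local Notation T := (borelT R n).

(** Half-open cubes tile space exactly and so can be grid cells; closed cubes differ from them by
    null faces. *)
Definition hcube c l : set 'rV[R]_n := [set x | forall i, c 0 i <= x 0 i < c 0 i + l].

Lemma sub_hcube_cube c l : hcube c l `<=` cube c l.
Proof. by move=> x xc i; have /andP[-> /ltW] := xc i. Qed.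

Lemma measurable_hcube c l : measurable (hcube c l : set T).
Proof.
rewrite (_ : hcube c l = [set x : T | forall i, `[c 0 i, c 0 i + l[%classic (x 0 i)]).
  by apply: (@measurable_forall_coord R n (fun i => `[c 0 i, c 0 i + l[%classic)) => i; exact: measurable_itv.
by apply/seteqP; split => x /= xc i; have := xc i; rewrite in_itv.
Qed.

Lemma measurable_cube c l : measurable (cube c l : set T).
Proof.
rewrite (_ : cube c l = [set x : T | forall i, `[c 0 i, c 0 i + l]%classic (x 0 i)]).
  by apply: (@measurable_forall_coord R n (fun i => `[c 0 i, c 0 i + l]%classic)) => i; exact: measurable_itv.
by apply/seteqP; split => x /= xc i; have := xc i; rewrite in_itv.
Qed.

Lemma mu_hcube c l : 0 < l -> mu (hcube c l) = (l ^+ n)%:E.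
Proof.
move=> l0.
rewrite (_ : hcube c l = [set x : T | forall i, `[c 0 i, c 0 i + l[%classic (x 0 i)]).
  rewrite (mu_box (J := fun i => `[c 0 i, c 0 i + l[%classic) (a := fun=> l)); first by rewrite prodr_const card_ord.
    by move=> i; exact: measurable_itv.
  by move=> i; rewrite lebesgue_measure_itv/= lte_fin ltrDl l0 -EFinB addrAC subrr add0r.
by apply/seteqP; split => x /= xc i; have := xc i; rewrite in_itv.
Qed.

Lemma mu_cube c l : 0 < l -> mu (cube c l) = (l ^+ n)%:E.
Proof.
move=> l0.
rewrite (_ : cube c l = [set x : T | forall i, `[c 0 i, c 0 i + l]%classic (x 0 i)]).
  rewrite (mu_box (J := fun i => `[c 0 i, c 0 i + l]%classic) (a := fun=> l)); first by rewrite prodr_const card_ord.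
    by move=> i; exact: measurable_itv.
  by move=> i; rewrite lebesgue_measure_itv/= lte_fin ltrDl l0 -EFinB addrAC subrr add0r.
by apply/seteqP; split => x /= xc i; have := xc i; rewrite in_itv.
Qed.

Lemma integral_cube_hcube c l f : 0 < l -> (forall x, 0 <= f x)%E ->
  measurable_fun setT f ->
  (\int[mu]_(x in cube c l) f x = \int[mu]_(x in hcube c l) f x)%E.
Proof.
move=> l0 f0 mf; have mc := measurable_cube c l; have mh := measurable_hcube c l.
have mcf : measurable_fun (cube c l : set T) f by exact: measurable_funTS.
rewrite (@ge0_negligible_integral _ _ _ mu (cube c l) (cube c l `\` hcube c l))//.
- by rewrite setDD setIidr//; exact: sub_hcube_cube.
- exact: measurableD.
- rewrite [LHS]measureD//; last by rewrite [ltLHS]mu_cube ?ltry.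
  rewrite setIidr; last exact: sub_hcube_cube.
  rewrite [X in (X - _)%E](_ : _ = (l ^+ n)%:E); last exact: mu_cube.
  by rewrite [X in (_ - X)%E](_ : _ = (l ^+ n)%:E) ?subee//; exact: mu_hcube.
Qed.

Lemma cavgE c l f : (forall x, 0 <= f x)%E -> measurable_fun setT f ->
  cavg c l f = ((l ^+ n)^-1%:E * \int[mu]_(x in cube c l) f x)%E.
Proof. by move=> f0 mf; rewrite /cavg integE//; exact: measurable_cube. Qed.

(** Origin and top scale are free. With o = c and L = l the cube itself is a top cell, for
    decompositions inside it; shifted origins and large L give the grids that capture arbitrary
    cubes. Integer labels keep the cells countable. *)
Definition gidx o L k (x : T) : 'rV[int]_n :=
  \row_i Num.floor ((x 0 i - o 0 i) * 2 ^+ k / L).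

Definition gcorner o L k (x : T) : 'rV[R]_n :=
  \row_i (o 0 i + L / 2 ^+ k * (gidx o L k x 0 i)%:~R).

Lemma gidx_atomE o L k x : 0 < L ->
  atom (gidx o L) k x = hcube (gcorner o L k x) (L / 2 ^+ k).
Proof.
move=> L0; set h := L / 2 ^+ k; have h0 : 0 < h by rewrite divr_gt0// exprn_gt0.
have hE (z : R) : z * 2 ^+ k / L = z / h.
  by rewrite /h invf_div mulrA.
have E y i : (gidx o L k y 0 i == gidx o L k x 0 i) =
    (gcorner o L k x 0 i <= y 0 i < gcorner o L k x 0 i + h).
  rewrite !mxE -/h !hE; set m := Num.floor ((x 0 i - _) / h); rewrite floor_eq.
  rewrite ler_pdivlMr// ltr_pdivrMr// intrD mulrDl mul1r.
  by rewrite lerBrDl ltrBlDl [h * _]mulrC addrA.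
apply/seteqP; split => y.
  by move=> yx i; rewrite -E; apply/eqP; congr ((_ : 'rV[int]_n) 0 i).
by move=> yx; apply/rowP => i; apply/eqP; rewrite E; exact: yx.
Qed.

Lemma measurable_gidx_atom o L k x : 0 < L -> measurable (atom (gidx o L) k x).
Proof. by move=> L0; rewrite gidx_atomE//; exact: measurable_hcube. Qed.

Lemma gidx_nested o L k x y : 0 < L ->
  gidx o L k.+1 x = gidx o L k.+1 y -> gidx o L k x = gidx o L k y.
Proof.
move=> L0 /rowP xy; apply/rowP => i; have := xy i; rewrite !mxE.
have E (z : R) : z * 2 ^+ k.+1 / L = 2 * (z * 2 ^+ k / L).
  by rewrite exprS mulrCA !mulrA.
rewrite !E; move: (_ / L) => a; move: (_ / L) => b ab.
apply: floor_def.
have := floor_itv (2 * a); rewrite ab => /andP[a1 a2].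
have := floor_itv (2 * b); move=> /andP[b1 b2].
have /andP[c1 c2] := floor_itv b.
set m := Num.floor b in c1 c2 *; set k2 := Num.floor (2 * b) in a1 a2 b1 b2.
have mk : (2 * m <= k2).
  have : ((2 * m)%:~R < (k2 + 1)%:~R :> R).
    by apply: le_lt_trans b2; rewrite intrM ler_pM2l.
  by rewrite ltr_int; lia.
have km : (k2 <= 2 * m + 1).
  have : (k2%:~R < (2 * (m + 1))%:~R :> R).
    by apply: le_lt_trans b1 _; rewrite intrM ltr_pM2l.
  by rewrite ltr_int; lia.
apply/andP; split.
  have : ((2 * m)%:~R <= k2%:~R :> R) by rewrite ler_int.
  by move=> /le_trans/(_ a1); rewrite intrM ler_pM2l.
have : ((k2 + 1)%:~R <= (2 * (m + 1))%:~R :> R) by rewrite ler_int; lia.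
by move=> /(lt_le_trans a2); rewrite intrM ltr_pM2l.
Qed.

Lemma mu_gidx_atom o L k x : 0 < L ->
  mu (atom (gidx o L) k x) = ((L / 2 ^+ k) ^+ n)%:E.
Proof. by move=> L0; rewrite gidx_atomE// mu_hcube// divr_gt0// exprn_gt0. Qed.

Lemma gidx_generates o L : 0 < L ->
  (@measurable _ T) `<=` <<s [set A | exists k x, A = atom (gidx o L) k x] >>.
Proof.
move=> L0; set G := [set A | _].
apply: smallest_sub; first exact: smallest_sigma_algebra.
move=> U oU.
have UE : U = \bigcup_(km in [set km : nat * 'rV[int]_n |
    gidx o L km.1 @^-1` [set km.2] `<=` U]) (gidx o L km.1 @^-1` [set km.2]).
  apply/seteqP; split => [x Ux|x [km /= kmU xm]]; last exact: kmU.
  have /nbhs_ballP[e /= e0 eU] : nbhs x U by move: oU; rewrite openE => /(_ x Ux).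
  have [k ke] := pow2_unbounded (L / e) (@ltr01 R).
  exists (k.+1, gidx o L k.+1 x) => //= y.
  move=> yx; have : atom (gidx o L) k.+1 x y by [].
  have : atom (gidx o L) k.+1 x x by exact: atom_refl.
  rewrite gidx_atomE// => xP yP; apply: eU; split => // i j; rewrite ord1.
  have he : L / 2 ^+ k.+1 < e.
    rewrite ltr_pdivrMr ?exprn_gt0//; rewrite mul1r ler_pdivrMr// in ke.
    apply: (le_lt_trans ke); rewrite exprS mulrC ltr_pM2l// ltr_pMl ?exprn_gt0//.
    by rewrite ltr1n.
  have /andP[x1 x2] := xP j; have /andP[y1 y2] := yP j.
  by rewrite /ball/= ltr_norml; apply/andP; split; lra.
rewrite UE.
apply: (@bigcup_count_measurable _ (g_sigma_algebraType G)) => -[k m] _ /=.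
have [[x xm]|/set0P/negP/negPn/eqP ->] := pselect ((gidx o L k @^-1` [set m]) !=set0).
  apply: sub_sigma_algebra; exists k, x; apply/seteqP; split => y.
    by rewrite /atom/= xm.
  by rewrite /atom/= xm.
exact: measurable0.
Qed.

(* Shifting a dyadic grid by L/3 in some of the coordinates, s ranging over
   {0,1}^n, gives 2^n grids such that each small cube lies in a cell of
   comparable size of one of them. *)
Definition gorigin L (s : {ffun 'I_n -> bool}) : 'rV[R]_n :=
  \row_i (if s i then L / 3 else 0).

(** The one-third trick. If both floors jump, there are integers p and q with |3(p - q) - 2^k| < 1,
    so 3 would divide a power of 2. *)
Lemma floor_eq_or (a d : R) k : 0 <= d -> 3 * d < 1 ->
  Num.floor a = Num.floor (a + d) \/
  Num.floor (a - 2 ^+ k / 3) = Num.floor (a + d - 2 ^+ k / 3).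
Proof.
move=> d0 d1.
have jump (b : R) : Num.floor b <> Num.floor (b + d) -> exists p : int, b < p%:~R <= b + d.
  move=> nb; exists (Num.floor (b + d)); rewrite floor_le andbT ltNge; apply/negP => bp.
  apply: nb; apply: floor_def; rewrite bp /=.
  by apply: le_lt_trans (floorD1_gt (b + d)); rewrite lerDl.
have [|/jump[p /andP[p1 p2]]] := pselect (Num.floor a = Num.floor (a + d)); first by left.
right; apply: contrapT; rewrite addrAC => /jump[q /andP[q1 q2]].
have pq : (3 * (p - q) = 2 ^+ k)%R.
  have h1 : ((3 * (p - q) - 2 ^+ k)%:~R < (1 : int)%:~R :> R).
    by rewrite !(rmorphB, rmorphM, rmorphXn)/=; lra.
  have h2 : ((- 1 : int)%:~R < (3 * (p - q) - 2 ^+ k)%:~R :> R).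
    by rewrite !(rmorphB, rmorphM, rmorphXn)/=; lra.
  by move: h1 h2; rewrite !ltr_int; lia.
have : (3 %| 2 ^ k)%N.
  have : (3%:Z %| (2 ^ k)%N%:Z)%Z by apply/dvdzP; exists (p - q); rewrite mulrC pq -natrX natz.
  by [].
by rewrite Euclid_dvdX.
Qed.

Lemma cube_in_grid c l L : 0 < l -> 6 * l <= L ->
  exists s k, L / 2 ^+ k <= 6 * l /\
    forall x, cube c l x -> cube c l `<=` atom (gidx (gorigin L s) L) k x.
Proof.
move=> l0 lL.
have L0 : 0 < L by apply: lt_le_trans lL; rewrite mulr_gt0.
have exk : exists k, L / 2 ^+ k <= 6 * l.
  have [k kP] := pow2_unbounded (L / (6 * l)) (@ltr01 R).
  exists k; rewrite ler_pdivrMr ?exprn_gt0//.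
  by rewrite mul1r ler_pdivrMr ?mulr_gt0// in kP; rewrite mulrC.
(* Minimality puts the cell side h = L/2^k above 3 l while it is at most 6 l. In units of h the cube
   has side below 1/3 and the shift L/3 becomes 2^k/3, as [floor_eq_or] asks. *)
case: (ex_minnP exk) => k kP kmin.
have h3 : 3 * l < L / 2 ^+ k.
  case: k => [|k] in kP kmin *; first by rewrite expr0 divr1; lra.
  have : ~~ (L / 2 ^+ k <= 6 * l) by apply/negP => /kmin; rewrite ltnn.
  rewrite -ltNge => h; rewrite exprS invfM mulrA [L / 2]mulrC -mulrA.
  lra.
set h := L / 2 ^+ k in kP h3; have h0 : 0 < h by rewrite divr_gt0// exprn_gt0.
have hE (z : R) : z * 2 ^+ k / L = z / h by rewrite /h invf_div mulrA.
have /choice[s sP] : forall i, exists b : bool,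
    Num.floor ((c 0 i - (if b then L / 3 else 0)) / h) =
    Num.floor ((c 0 i + l - (if b then L / 3 else 0)) / h).
  move=> i; have := @floor_eq_or (c 0 i / h) (l / h) k.
  have e3 : L / 3 / h = 2 ^+ k / 3.
    by rewrite /h; field; rewrite gt_eqF// gt_eqF// exprn_gt0.
  case; first by rewrite divr_ge0// ltW.
  - by rewrite mulrA ltr_pdivrMr// mul1r.
  - by move=> fE; exists false; rewrite !subr0 mulrDl.
  - by move=> fE; exists true; rewrite !mulrBl mulrDl e3.
exists [ffun i => s i], k; split => //.
suff H x : cube c l x -> forall i, gidx (gorigin L [ffun i => s i]) L k x 0 i =
    Num.floor ((c 0 i - (if s i then L / 3 else 0)) / h).
  by move=> x xc y yc; apply/rowP => i; rewrite !H.
move=> xc i; rewrite !mxE ffunE hE; have /andP[x1 x2] := xc i.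
apply/eqP; rewrite eq_le; apply/andP; split; last first.
  by apply: le_floor; rewrite ler_pM2r ?invr_gt0// lerB.
by rewrite sP; apply: le_floor; rewrite ler_pM2r ?invr_gt0// lerB.
Qed.

End cubes.

(** * The maximal operator and its lower semicontinuity *)

Section maxop.
Context {R : realType} {n : nat}.
Implicit Types (c x y : 'rV[R]_n) (l : R).
Local Notation mu := (@mu R n).
Local Notation T := (borelT R n).

Lemma integ_ge0 (E : set 'rV[R]_n) (f : 'rV[R]_n -> \bar R) :
  (forall x, 0 <= f x)%E -> (0 <= integ E f)%E.
Proof.
move=> f0; rewrite /integ; set g := fun x => _.
have g0 x : (0 <= g x)%E by rewrite /g; case: ifP.
by have /andP[] := le_lint g0 (fun x => lexx (g x)).
Qed.

Lemma le_integ (E F : set 'rV[R]_n) (f g : 'rV[R]_n -> \bar R) :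
  E `<=` F -> (forall x, 0 <= f x)%E -> (forall x, f x <= g x)%E ->
  (integ E f <= integ F g)%E.
Proof.
move=> EF f0 fg.
suff : (0 <= integ E f <= integ F g)%E by case/andP.
apply: le_lint => x; case: ifPn => // xE.
  by rewrite mem_set ?fg//; apply: EF; exact: set_mem.
by case: ifP => // _; apply: le_trans (f0 x) (fg x).
Qed.

Lemma cavg_ge0 c l (f : 'rV[R]_n -> \bar R) : 0 < l -> (forall x, 0 <= f x)%E ->
  (0 <= cavg c l f)%E.
Proof.
by move=> l0 f0; rewrite /cavg mule_ge0 ?integ_ge0// lee_fin invr_ge0 exprn_ge0// ltW.
Qed.

Lemma cavg_le_maxop c l (f : 'rV[R]_n -> \bar R) x : 0 < l -> cube c l x ->
  (cavg c l (fun y => `|f y|) <= maxop f x)%E.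
Proof. by move=> l0 xc; apply: ereal_sup_ubound; exists c, l. Qed.

Lemma maxop_ge0 (f : 'rV[R]_n -> \bar R) x : (0 <= maxop f x)%E.
Proof.
apply: le_trans (cavg_le_maxop f (@ltr01 R) (_ : cube x 1 x)); first exact: cavg_ge0.
by move=> i; rewrite lexx lerDl ler01.
Qed.

Lemma maxop_gtP (f : 'rV[R]_n -> \bar R) (a : \bar R) x : (a < maxop f x)%E ->
  exists c l, [/\ 0 < l, cube c l x & (a < cavg c l (fun y => `|f y|))%E].
Proof. by move=> /ereal_sup_gt[_ [c [l [l0 xc ->]]] ax]; exists c, l. Qed.

(** A cube whose average exceeds [a] can be enlarged slightly on every side without the average
    falling to [a], and the enlarged cube contains all points near x. This applies to arbitrary [f],
    since [integ] is monotone on all nonnegative functions. *)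
Lemma open_maxop_gt (f : 'rV[R]_n -> \bar R) (a : R) :
  open [set x | (a%:E < maxop f x)%E].
Proof.
have [a0|a0] := ltP a 0.
  rewrite (_ : mkset _ = setT); first exact: openT.
  by apply/seteqP; split => // x _ /=; apply: lt_le_trans (maxop_ge0 f x).
rewrite openE => x /= /maxop_gtP[c [l [l0 xc]]].
rewrite /cavg; set I := integ _ _; rewrite lte_pdivlMl ?exprn_gt0// -EFinM => aI.
have [e e0 eP] : exists2 e, 0 < e & (((l + 2 * e) ^+ n * a)%:E < I)%E.
  have : (0 <= I)%E by exact: integ_ge0.
  case: I aI => [r| |]// ; last by exists 1 => //; rewrite ltry.
  rewrite lte_fin => aI _.
  have : (fun t : R => t ^+ n * a) @ l --> l ^+ n * a.
    by apply: cvgMl; exact: exprn_continuous.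
  move=> /cvgr_lt/(_ _ aI)/nbhs_ballP[e /= e0 eP].
  exists (e / 4); first by rewrite divr_gt0.
  rewrite lte_fin; apply: eP; rewrite /ball/=.
  by rewrite ltr_norml; apply/andP; split; lra.
pose c' : 'rV[R]_n := \row_i (c 0 i - e).
apply/nbhs_ballP; exists e => //= y [_ yx]; rewrite /=.
have l'0 : 0 < l + 2 * e by lra.
have yc' : cube c' (l + 2 * e) y.
  move=> i; rewrite mxE; have := yx 0 i; rewrite /ball/= ltr_norml.
  by have /andP[] := xc i; move=> ? ? /andP[? ?]; apply/andP; split; lra.
apply: lt_le_trans (cavg_le_maxop f l'0 yc').
rewrite /cavg lte_pdivlMl ?exprn_gt0// -EFinM; apply: lt_le_trans eP _.
apply: le_integ => // z zc i; rewrite mxE; have /andP[? ?] := zc i.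
by apply/andP; split; lra.
Qed.

Lemma measurable_maxop (f : 'rV[R]_n -> \bar R) :
  measurable_fun setT (maxop f : T -> \bar R).
Proof. by apply: open_measurable_funE => a; exact: open_maxop_gt. Qed.

End maxop.

(** * Extended powers, lower limits, and exponential against power decay *)

Lemma le_poweR2r (R : realType) (r : R) (x y : \bar R) : 0 <= r ->
  (0 <= x)%E -> (x <= y)%E -> (x `^ r <= y `^ r)%E.
Proof.
move=> r0 x0 xy; have y0 := le_trans x0 xy.
by apply: gt0_ler_poweR => //; rewrite in_itv/= leey andbT.
Qed.

Lemma poweRK (R : realType) (r : R) (x : \bar R) : r != 0 -> (0 <= x)%E ->
  ((x `^ r) `^ (r^-1) = x)%E.
Proof. by move=> r0 x0; rewrite -poweRrM mulfV// poweRe1. Qed.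

Lemma le_poweR_root (R : realType) (r : R) (x y : \bar R) : 0 < r ->
  (0 <= x)%E -> (x `^ r <= y)%E -> (x <= y `^ (r^-1))%E.
Proof.
move=> r0 x0 xy; rewrite -[leLHS](@poweRK _ r)// ?gt_eqF//.
by apply: le_poweR2r => //; [rewrite invr_ge0 ltW|exact: poweR_ge0].
Qed.

Lemma poweR_le_root (R : realType) (r : R) (x y : \bar R) : 0 < r ->
  (0 <= x)%E -> (0 <= y)%E -> (x <= y `^ (r^-1))%E -> (x `^ r <= y)%E.
Proof.
move=> r0 x0 y0 xy; rewrite -[leRHS](@poweRK _ (r^-1))// ?invr_eq0 ?gt_eqF//.
by rewrite invrK; apply: le_poweR2r => //; exact: ltW.
Qed.

Lemma limn_einf_ge (R : realType) (u : (\bar R)^nat) (a : \bar R) N0 :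
  (forall N, (N0 <= N)%N -> (a <= u N)%E) -> (a <= limn_einf u)%E.
Proof.
move=> au; apply: (@le_trans _ _ (einfs u N0)).
  by apply: le_ereal_inf_tmp => _ [N /= N0N <-]; exact: au.
rewrite limn_einf_lim (cvg_lim _ (@cvg_einfs_sup _ u))//.
by apply: ereal_sup_ubound; exists N0.
Qed.

Lemma limn_einf_le (R : realType) (u : (\bar R)^nat) (b : \bar R) :
  (forall N, (u N <= b)%E) -> (limn_einf u <= b)%E.
Proof.
move=> ub; rewrite limn_einf_lim; apply: lime_le; first exact: is_cvg_einfs.
by apply: nearW => N; apply: le_trans (ub N); apply: ereal_inf_lbound; exists N => /=.
Qed.

(** Choose delta with lam^delta = b and j with lam^(j+1) < r <= lam^j. Then b^(j+1) =
    (lam^(j+1))^delta <= r^delta, and the factor 1/b restores the missing step. *)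
Lemma powR_decay (R : realType) (lam b : R) : 0 < lam < 1 -> 0 < b < 1 ->
  exists2 delta, 0 < delta & forall r, 0 < r <= 1 ->
    exists j, r <= lam ^+ j /\ b ^+ j <= b^-1 * r `^ delta.
Proof.
move=> /andP[l0 l1] /andP[b0 b1]; exists (ln b / ln lam).
  by rewrite -mulrNN -invrN divr_gt0// oppr_gt0 ln_lt0 ?l0 ?b0.
move=> r /andP[r0 r1].
have exi : exists i, lam ^+ i < r.
  have : (fun i => lam ^+ i) @ \oo --> (0 : R) by apply: cvg_expr; rewrite gtr0_norm.
  by move=> /cvgr_lt/(_ _ r0)[N _ NP]; exists N; exact: (NP N (leqnn N)).
case: (ex_minnP exi) => -[|j] jr jmin; first by move: jr; rewrite expr0 ltNge r1.
exists j; split; first by rewrite leNgt; apply/negP => /jmin; rewrite ltnn.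
rewrite ler_pdivlMl// -exprS.
have -> : b ^+ j.+1 = (lam ^+ j.+1) `^ (ln b / ln lam).
  rewrite -[in RHS]powR_mulrn ?ltW// -powRrM mulrC powRrM powR_mulrn ?powR_ge0//.
  congr (_ ^+ _); rewrite /powR gt_eqF// divfK ?lnK ?posrE//.
  by rewrite lt_eqF// ln_lt0// l0.
apply: ge0_ler_powR; rewrite ?nnegrE ?ltW ?exprn_gt0//.
by rewrite -mulrNN -invrN divr_gt0// oppr_gt0 ln_lt0 ?l0 ?b0.
Qed.

(** * Consequences of the A_p condition *)

Section muckenhoupt.
Context {R : realType} {n : nat}.
Variables (p K : R) (w : borelT R n -> R).
Hypotheses (p1 : 1 < p) (K0 : 0 < K).
Hypothesis mw : measurable_fun setT w.
Hypothesis w0 : forall x, 0 < w x.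
Local Notation mu := (@mu R n).
Local Notation T := (borelT R n).

Let q1 : 0 < p - 1. Proof. by rewrite subr_gt0. Qed.
Let p0 : 0 < p. Proof. exact: lt_trans p1. Qed.

Definition sigmaw (x : T) : R := w x `^ (- (p - 1)^-1).

Let sw0 x : 0 < sigmaw x. Proof. by rewrite /sigmaw powR_gt0. Qed.

Let msw : measurable_fun setT sigmaw.
Proof. exact: measurableT_comp (measurable_powR _) mw. Qed.

Let we0 x : (0 <= (w x)%:E)%E. Proof. by rewrite lee_fin ltW. Qed.
Let se0 x : (0 <= (sigmaw x)%:E)%E. Proof. by rewrite lee_fin ltW. Qed.
Let mwe : measurable_fun setT (fun x => (w x)%:E). Proof. exact/measurable_EFinP. Qed.
Let mse : measurable_fun setT (fun x => (sigmaw x)%:E). Proof. exact/measurable_EFinP. Qed.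

Local Notation wm := (mdens mu we0 mwe).
Local Notation sm := (mdens mu se0 mse).

Hypothesis wfin : forall c l, 0 < l -> (wm (cube c l) < +oo)%E.
Hypothesis sfin : forall c l, 0 < l -> (sm (cube c l) < +oo)%E.
Hypothesis Apw : forall c l, 0 < l ->
  ((l ^+ n)^-1 * fine (wm (cube c l))) * ((l ^+ n)^-1 * fine (sm (cube c l))) `^ (p - 1) <= K.

Section grid.
Variables (o : 'rV[R]_n) (L : R).
Hypothesis L0 : 0 < L.
Local Notation idx := (gidx o L).
Local Notation atom := (atom idx).

Let midx k x : measurable (atom k x). Proof. exact: measurable_gidx_atom. Qed.
Let nidx k x y : idx k.+1 x = idx k.+1 y -> idx k x = idx k y.
Proof. exact: gidx_nested. Qed.

Let L2 k : 0 < L / 2 ^+ k. Proof. by rewrite divr_gt0// exprn_gt0. Qed.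

Let sub_atom_cube k x : atom k x `<=` cube (gcorner o L k x) (L / 2 ^+ k).
Proof. by rewrite gidx_atomE//; exact: sub_hcube_cube. Qed.

Let mu_atom k x : (0 < mu (atom k x) < +oo)%E.
Proof. by rewrite mu_gidx_atom// ltry lte_fin exprn_gt0. Qed.

Lemma wm_atom k x : (0 < wm (atom k x) < +oo)%E.
Proof.
apply/andP; split.
  by apply: mdens_gt0 => //; have /andP[] := mu_atom k x.
apply: le_lt_trans (wfin (gcorner o L k x) (L2 k)).
by apply: le_measure; rewrite ?inE//; exact: measurable_cube.
Qed.

Lemma sm_atom k x : (0 < sm (atom k x) < +oo)%E.
Proof.
apply/andP; split.
  by apply: mdens_gt0 => //; have /andP[] := mu_atom k x.
apply: le_lt_trans (sfin (gcorner o L k x) (L2 k)).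
by apply: le_measure; rewrite ?inE//; exact: measurable_cube.
Qed.

(** The masses of a half-open cell are at most those of its closed cube, where A_p holds; the
    inequality is solved for the sigma-average, the form used by the pointwise bound. *)
Lemma Ap_atom k x :
  ((fine (mu (atom k x)))^-1 * fine (sm (atom k x))) `^ (p - 1) <=
  K * (fine (mu (atom k x)) * (fine (wm (atom k x)))^-1).
Proof.
have /andP[wP wf] := wm_atom k x; have /andP[sP sf] := sm_atom k x.
have wP' : 0 < fine (wm (atom k x)) by rewrite fine_gt0// wP.
have sP' : 0 < fine (sm (atom k x)) by rewrite fine_gt0// sP.
rewrite mu_gidx_atom//= mulrA ler_pdivlMr//.
rewrite -ler_pdivrMr ?exprn_gt0//; apply: le_trans (Apw (gcorner o L k x) (L2 k)).
rewrite -mulrA mulrC -mulrA [_^-1 * _]mulrC.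
set v := (L / 2 ^+ k) ^+ n; have v0 : 0 < v by rewrite exprn_gt0.
have mc := measurable_cube (gcorner o L k x) (L / 2 ^+ k).
rewrite [leRHS](_ : _ = fine (wm (cube (gcorner o L k x) (L / 2 ^+ k))) / v *
   (fine (sm (cube (gcorner o L k x) (L / 2 ^+ k))) / v) `^ (p - 1)); last first.
  by rewrite mulrA; congr (_ * _ `^ _); rewrite mulrC.
apply: ler_pM.
- by rewrite divr_ge0// ltW.
- exact: powR_ge0.
- rewrite ler_pM2r ?invr_gt0// fine_le ?ge0_fin_numE//; first exact: wfin.
  by apply: le_measure; rewrite ?inE.
- apply: ge0_ler_powR; rewrite ?nnegrE ?(ltW q1)//.
  + by rewrite mulr_ge0 ?invr_ge0 ?ltW.
  + by rewrite mulr_ge0 ?invr_ge0 ?fine_ge0// ltW.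
  + rewrite ler_pM2r ?invr_gt0// fine_le ?ge0_fin_numE//; first exact: sfin.
    by apply: le_measure; rewrite ?inE.
Qed.

Variable g : T -> \bar R.
Hypotheses (g0 : forall x, (0 <= g x)%E) (mg : measurable_fun setT g).

Let gs x : \bar R := (g x * ((sigmaw x)^-1)%:E)%E.
Let gs0 x : (0 <= gs x)%E.
Proof. by rewrite mule_ge0// lee_fin invr_ge0 ltW. Qed.
Let minv (f : T -> R) : measurable_fun setT f -> (forall x, 0 < f x) ->
  measurable_fun setT (fun x => ((f x)^-1)%:E).
Proof.
move=> mf f0; apply/measurable_EFinP.
rewrite (_ : (fun x => _) = (fun x => f x `^ (-1))).
  exact: measurableT_comp (measurable_powR _) mf.
by apply/funext => x; rewrite powRN powRr1// ltW.
Qed.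
Let mgs : measurable_fun setT gs.
Proof. by apply: emeasurable_funM => //; exact: minv. Qed.

Let Ms := dmax idx sm gs.
Let mMs : measurable_fun setT Ms. Proof. exact: (measurable_dmax midx nidx). Qed.
Let mMsq r : measurable_fun setT (fun x => Ms x `^ r)%E.
Proof. exact: measurableT_comp (measurable_poweR _) mMs. Qed.
Let h x : \bar R := (Ms x `^ (p - 1) * ((w x)^-1)%:E)%E.
Let h0 x : (0 <= h x)%E.
Proof. by rewrite mule_ge0 ?poweR_ge0// lee_fin invr_ge0 ltW. Qed.
Let mh : measurable_fun setT h.
Proof. by apply: emeasurable_funM; [exact: mMsq|exact: minv]. Qed.

(* Here h = (M_sm (g / sigmaw))^(p-1) / w, with M_sm the dyadic maximal operator
   of the measure sm: two Doob inequalities then bound the dyadic maximal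
   function of g. *)
Lemma atom_avg_Lerner k x :
  (atom_avg idx mu g k x `^ (p - 1) <= K%:E * atom_avg idx wm h k x)%E.
Proof.
have /andP[wP wf] := wm_atom k x; have /andP[sP sf] := sm_atom k x.
have := Ap_atom k x; rewrite /atom_avg.
have IE : (\int[sm]_(y in atom k x) gs y = \int[mu]_(y in atom k x) g y)%E.
  rewrite integral_mdens_set//; last by move=> y; rewrite ltry.
  apply: eq_integral => y _; rewrite /gs -muleA -EFinM mulVf ?mule1// gt_eqF//.
have HE : (\int[wm]_(y in atom k x) h y = \int[mu]_(y in atom k x) (Ms y `^ (p - 1)))%E.
  rewrite integral_mdens_set//; last by move=> y; rewrite ltry.
  apply: eq_integral => y _; rewrite /h -muleA -EFinM mulVf ?mule1// gt_eqF//.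
rewrite HE; set I := (\int[mu]_(y in atom k x) g y)%E.
have I0 : (0 <= I)%E by exact: integral_ge0.
set S := fine (sm _); set A := fine (wm _); set v := fine (mu _).
have A0 : 0 < A by rewrite fine_gt0// wP.
have S0 : 0 < S by rewrite fine_gt0// sP.
have v0 : 0 < v by rewrite /v mu_gidx_atom//= exprn_gt0.
move=> SA.
(* Throughout the cell [Ms] is at least I/S, the sm-average of g/sigma. Writing I/v = (S/v)(I/S),
   the A_p bound replaces (S/v)^(p-1) by K v/A. *)
have lowM : (v%:E * (S^-1%:E * I) `^ (p - 1) <= \int[mu]_(y in atom k x) (Ms y `^ (p - 1)))%E.
  apply: (@le_trans _ _ (\int[mu]_(y in atom k x) cst ((S^-1%:E * I) `^ (p - 1)) y)%E).
    by rewrite integral_cst// muleC; apply: lee_wpmul2l; rewrite ?poweR_ge0// fineK// ge0_fin_numE//; have /andP[] := mu_atom k x.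
  apply: ge0_le_integral => //.
  - by move=> y _; exact: poweR_ge0.
  - by apply: measurable_funTS; exact: mMsq.
  - move=> y xy; apply: le_poweR2r; first exact: ltW.
      by rewrite mule_ge0// lee_fin invr_ge0 ltW.
    by apply: le_trans (le_atom_avg_dmax _ _ _ k _); rewrite /atom_avg (atom_eq xy) IE.
have -> : (v^-1%:E * I = (v^-1 * S)%:E * (S^-1%:E * I))%E.
  by rewrite muleA -EFinM -mulrA mulfV ?gt_eqF// mulr1.
rewrite poweRM; last 2 first.
- by rewrite lee_fin mulr_ge0 ?invr_ge0 ?ltW.
- by rewrite mule_ge0// lee_fin invr_ge0 ltW.
rewrite poweR_EFin; apply: (@le_trans _ _ ((K * (v * A^-1))%:E * (S^-1%:E * I) `^ (p - 1))%E).
  by apply: lee_wpmul2r; [exact: poweR_ge0|rewrite lee_fin].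
rewrite EFinM -muleA; apply: lee_wpmul2l; first by rewrite lee_fin ltW.
rewrite mulrC EFinM -muleA; apply: lee_wpmul2l; last exact: lowM.
by rewrite lee_fin invr_ge0 ltW.
Qed.

(** Raise the pointwise bound to the power q = p/(p-1) and apply Doob for [wm] at exponent q. Then
    h^q w = Ms^p sigma, because 1 - q = -1/(p-1); Doob for [sm] at exponent p finishes, since
    (g/sigma)^p sigma = g^p w. *)
Lemma dyadic_muckenhoupt :
  (\int[mu]_x (dmax idx mu g x `^ p * (w x)%:E) <=
   (K `^ (p / (p - 1)) * doob_const (p / (p - 1)) * doob_const p)%:E *
   \int[mu]_x (g x `^ p * (w x)%:E))%E.
Proof.
set q := p / (p - 1).
have q1' : 1 < q by rewrite ltr_pdivlMr// mul1r ltrBlDr ltrDl.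
have q0 : 0 < q by exact: lt_trans q1'.
have MK x : (dmax idx mu g x `^ p <= (K `^ q)%:E * (dmax idx wm h x `^ q))%E.
  have Mw0 : (0 <= dmax idx wm h x)%E by exact: dmax_ge0.
  have K0' : (0 <= K%:E)%E by rewrite lee_fin ltW.
  rewrite -poweR_EFin -poweRM// [q]mulrC poweRrM.
  apply: le_poweR2r; [exact: ltW|exact: dmax_ge0|].
  apply: ge_ereal_sup => _ [k _ <-]; apply: le_poweR_root => //.
    exact: atom_avg_ge0.
  apply: le_trans (atom_avg_Lerner k x) _; apply: lee_wpmul2l => //.
  exact: le_atom_avg_dmax.
have mMg : measurable_fun setT (fun x => dmax idx mu g x `^ p)%E.
  exact: measurableT_comp (measurable_poweR _) (measurable_dmax midx nidx _ _).
have mMw : measurable_fun setT (fun x => dmax idx wm h x `^ q)%E.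
  exact: measurableT_comp (measurable_poweR _) (measurable_dmax midx nidx _ _).
have fin (f : T -> R) x : ((f x)%:E < +oo)%E by rewrite ltry.
apply: (@le_trans _ _ ((K `^ q)%:E * \int[wm]_x (dmax idx wm h x `^ q))%E).
  rewrite integral_mdens//; last by move=> x; exact: poweR_ge0.
  rewrite -ge0_integralZl//; last 3 first.
  - exact: emeasurable_funM.
  - by move=> x _; rewrite mule_ge0// poweR_ge0.
  - by rewrite lee_fin powR_ge0.
  apply: ge0_le_integral => //.
  - by move=> x _; rewrite mule_ge0// poweR_ge0.
  - exact: emeasurable_funM.
  - by apply: measurable_funeM; exact: emeasurable_funM.
  - by move=> x _; rewrite muleA; apply: lee_wpmul2r.
rewrite 2!EFinM -2!muleA; apply: lee_wpmul2l; first by rewrite lee_fin powR_ge0.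
apply: le_trans (dmax_strong midx nidx q1' wm_atom h0 mh) _.
apply: lee_wpmul2l; first by rewrite lee_fin ltW// doob_const_gt0.
have mhq : measurable_fun setT (fun x => h x `^ q)%E.
  exact: measurableT_comp (measurable_poweR _) mh.
have -> : (\int[wm]_x (h x `^ q) = \int[sm]_x (Ms x `^ p))%E.
  rewrite !integral_mdens//; last 2 first.
  - by move=> x; exact: poweR_ge0.
  - by move=> x; exact: poweR_ge0.
  apply: eq_integral => x _; rewrite /h poweRM ?poweR_ge0//; last first.
    by rewrite lee_fin invr_ge0 ltW.
  rewrite -poweRrM /q mulrCA mulfV ?gt_eqF// mulr1 -muleA; congr (_ * _)%E.
  rewrite poweR_EFin -EFinM; congr EFin.
  rewrite /sigmaw -powR_inv1 ?ltW// -powRrM -[X in _ * X]powRr1 ?ltW// -powRD; last first.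
    by rewrite (gt_eqF (w0 x)) implybT.
  by congr (_ `^ _); field; rewrite gt_eqF.
apply: le_trans (dmax_strong midx nidx p1 sm_atom gs0 mgs) _.
apply: lee_wpmul2l; first by rewrite lee_fin ltW// doob_const_gt0.
rewrite integral_mdens//; last 2 first.
- by move=> x; exact: poweR_ge0.
- exact: measurableT_comp (measurable_poweR _) mgs.
rewrite le_eqVlt; apply/orP; left; apply/eqP; apply: eq_integral => x _.
rewrite /gs poweRM//; last by rewrite lee_fin invr_ge0 ltW.
rewrite -muleA; congr (_ * _)%E; rewrite poweR_EFin -EFinM; congr EFin.
rewrite -powR_inv1 ?ltW// -powRrM -[X in _ * X]powRr1 ?ltW// -powRD; last first.
  by rewrite (gt_eqF (sw0 x)) implybT.
rewrite /sigmaw -powRrM -[RHS]powRr1 ?ltW//; congr (_ `^ _).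
by field; rewrite gt_eqF.
Qed.

End grid.

Definition grid_const : R := (6 ^+ n) `^ p *
  (K `^ (p / (p - 1)) * doob_const (p / (p - 1)) * doob_const p).

Lemma grid_const_gt0 : 0 < grid_const.
Proof.
have q1' : 1 < p / (p - 1) by rewrite ltr_pdivlMr// mul1r ltrBlDr ltrDl.
apply: mulr_gt0; first by rewrite powR_gt0// exprn_gt0.
by do 2!(apply: mulr_gt0; last exact: doob_const_gt0); exact: powR_gt0.
Qed.

Definition muckenhoupt_const : R := grid_const * #|{ffun 'I_n -> bool}|%:R.

Lemma muckenhoupt_const_gt0 : 0 < muckenhoupt_const.
Proof.
apply: mulr_gt0; first exact: grid_const_gt0.
by rewrite ltr0n; apply/card_gt0P; exists [ffun=> false].
Qed.

Lemma cavg_le_grid c l L s k (g : T -> \bar R) x : 0 < l -> 0 < L ->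
  (forall x, 0 <= g x)%E -> measurable_fun setT g ->
  L / 2 ^+ k <= 6 * l -> cube c l `<=` atom (gidx (gorigin L s) L) k x ->
  (cavg c l g <= (6 ^+ n)%:E * atom_avg (gidx (gorigin L s) L) mu g k x)%E.
Proof.
move=> l0 L0 g0 mg hl sub; rewrite cavgE// /atom_avg mu_gidx_atom//=.
have mA := measurable_gidx_atom (gorigin L s) k x L0.
apply: (@le_trans _ _ ((l ^+ n)^-1%:E * \int[mu]_(y in atom (gidx (gorigin L s) L) k x) g y)%E).
  apply: lee_wpmul2l; first by rewrite lee_fin invr_ge0 exprn_ge0// ltW.
  apply: ge0_subset_integral => //; first exact: measurable_cube.
  exact: measurable_funTS.
rewrite muleA -EFinM; apply: lee_wpmul2r; first exact: integral_ge0.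
have h0 : 0 < L / 2 ^+ k by rewrite divr_gt0// exprn_gt0.
rewrite lee_fin ler_pdivlMr ?exprn_gt0// -ler_pdivlMl ?invr_gt0 ?exprn_gt0// invrK mulrC.
rewrite [_ * L]mulrC [l ^+ n * _]mulrC -exprMn.
by apply: lerXn2r => //; rewrite nnegrE ?mulr_ge0 ?ltW.
Qed.

(** The grids of top scale N+1 control only cubes of side at most (N+1)/6, so a limit inferior in N
    is taken, with Fatou. The good shift may vary with N and with the cube; summing over all shifts
    absorbs this. *)
Theorem muckenhoupt (g : T -> \bar R) :
  (forall x, 0 <= g x)%E -> measurable_fun setT g ->
  (\int[mu]_x (maxop g x `^ p * (w x)%:E) <=
   muckenhoupt_const%:E * \int[mu]_x (g x `^ p * (w x)%:E))%E.
Proof.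
move=> g0 mg; pose LN N : R := N.+1%:R.
have LN0 N : 0 < LN N by rewrite ltr0n.
pose D N s := dmax (gidx (gorigin (LN N) s) (LN N)) mu g.
have D0 N s x : (0 <= D N s x)%E by exact: dmax_ge0.
have mD N s : measurable_fun setT (D N s).
  apply: measurable_dmax => [k x|k x y]; first exact: measurable_gidx_atom.
  exact: gidx_nested.
pose f N s x := (((6 ^+ n) `^ p)%:E * (D N s x `^ p * (w x)%:E))%E.
have f0 N s x : (0 <= f N s x)%E.
  by rewrite mule_ge0 ?lee_fin ?powR_ge0// mule_ge0 ?poweR_ge0.
have mDp N s : measurable_fun setT (fun x => D N s x `^ p * (w x)%:E)%E.
  by apply: emeasurable_funM => //; exact: measurableT_comp (measurable_poweR _) (mD N s).
have mf N s : measurable_fun setT (f N s) by apply: measurable_funeM.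
pose F N x : \bar R := (\sum_(s : {ffun 'I_n -> bool}) f N s x)%R.
have F0 N x : (0 <= F N x)%E by apply: sume_ge0.
have mF N : measurable_fun setT (F N) by apply: emeasurable_sum.
(* Dividing by w x > 0 isolates the maximal function, so the bound can be proved for one cube at a
   time, for all N beyond the size of that cube. *)
have pt x : (maxop g x `^ p * (w x)%:E <= limn_einf (F ^~ x))%E.
  set B := limn_einf _.
  have B0 : (0 <= B)%E by apply: (@limn_einf_ge _ _ _ 0%N) => N _.
  have w'0 : (0 <= ((w x)^-1)%:E)%E by rewrite lee_fin invr_ge0 ltW.
  suff : (maxop g x `^ p <= B * ((w x)^-1)%:E)%E.
    move=> /(lee_wpmul2r (we0 x))/le_trans; apply.
    by rewrite -muleA -EFinM mulVf ?gt_eqF// mule1.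
  apply: poweR_le_root => //; [exact: maxop_ge0|by rewrite mule_ge0|].
  apply: ge_ereal_sup => _ [c [l [l0 xc ->]]].
  rewrite (_ : (fun y => `|g y|)%E = g); last by apply/funext => y; rewrite gee0_abs.
  apply: le_poweR_root => //; first exact: cavg_ge0.
  suff : (cavg c l g `^ p * (w x)%:E <= B)%E.
    move=> /(lee_wpmul2r w'0); apply: le_trans.
    by rewrite -muleA -EFinM mulfV ?gt_eqF// mule1.
  apply: (@limn_einf_ge _ _ _ (Num.bound (6 * l))) => N NP.
  have l6 : 0 <= 6 * l by rewrite mulr_ge0// ltW.
  have lL : 6 * l <= LN N.
    apply: (le_trans (ltW (archi_boundP l6))); rewrite ler_nat.
    by rewrite (leq_trans NP).
  have [s [k [hl sub]]] := cube_in_grid c l0 lL.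
  apply: (@le_trans _ _ (f N s x)); last first.
    by rewrite /F (bigD1 s)//= leeDl// sume_ge0.
  rewrite /f muleA; apply: lee_wpmul2r => //.
  rewrite -poweR_EFin -poweRM// ?lee_fin ?exprn_ge0//.
  apply: le_poweR2r; [exact: ltW|exact: cavg_ge0|].
  apply: (le_trans (cavg_le_grid l0 (LN0 N) g0 mg hl (sub x xc))).
  by apply: lee_wpmul2l; [rewrite lee_fin exprn_ge0|exact: le_atom_avg_dmax].
have mM : measurable_fun setT (fun x : T => maxop g x `^ p * (w x)%:E)%E.
  apply: emeasurable_funM => //.
  exact: measurableT_comp (measurable_poweR _) (measurable_maxop g).
apply: (@le_trans _ _ (\int[mu]_x limn_einf (F ^~ x))%E).
  apply: ge0_le_integral => //.
  - by move=> x _; rewrite mule_ge0 ?poweR_ge0.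
  - apply: (emeasurable_fun_cvg (fun N x => einfs (F ^~ x) N)).
      by move=> N; exact: measurable_fun_einfs.
    by move=> x _; rewrite limn_einf_lim; exact: is_cvg_einfs.
apply: (le_trans (fatou mu measurableT mF _)); first by move=> N x _.
apply: limn_einf_le => N; rewrite ge0_integral_sum//.
apply: (@le_trans _ _ (\sum_(s : {ffun 'I_n -> bool}) grid_const%:E *
   \int[mu]_x (g x `^ p * (w x)%:E))%E).
  apply: lee_sum => s _; rewrite /f ge0_integralZl//; last first.
    by move=> x _; rewrite mule_ge0 ?poweR_ge0.
  rewrite /grid_const [((6 ^+ n) `^ p * _)%:E]EFinM -muleA.
  apply: lee_wpmul2l; first by rewrite lee_fin powR_ge0.
  exact: dyadic_muckenhoupt.
rewrite -ge0_sume_distrl; last by move=> s _; rewrite lee_fin ltW// grid_const_gt0.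
by rewrite sumEFin sumr_const -mulr_natr.
Qed.

Lemma maxop_indic_ge c l (E : set 'rV[R]_n) x : 0 < l -> measurable (E : set T) ->
  cube c l x -> E `<=` cube c l ->
  ((l ^+ n)^-1%:E * mu E <= maxop (fun y => (\1_E y)%:E) x)%E.
Proof.
move=> l0 mE xc Ec.
apply: le_trans (cavg_le_maxop _ l0 xc).
rewrite [X in cavg _ _ X](_ : _ = (fun y : T => (\1_E y)%:E)); last first.
  by apply/funext => y; rewrite gee0_abs// lee_fin.
rewrite cavgE//; last by apply/measurable_EFinP; exact: measurable_indic.
have mc := measurable_cube c l.
rewrite integral_indic//; apply: lee_wpmul2l; last by rewrite setIidl.
by rewrite lee_fin invr_ge0 exprn_ge0// ltW.
Qed.

Lemma measurable_indice (E : set 'rV[R]_n) : measurable (E : set T) ->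
  measurable_fun setT (fun x : T => (\1_E x)%:E : \bar R).
Proof. by move=> mE; apply/measurable_EFinP; exact: measurable_indic. Qed.

Lemma muckenhoupt_indic (E : set 'rV[R]_n) : measurable (E : set T) ->
  (\int[mu]_x (maxop (fun y => (\1_E y)%:E) x `^ p * (w x)%:E) <=
     muckenhoupt_const%:E * wm E)%E.
Proof.
move=> mE; apply: (le_trans (muckenhoupt _ (measurable_indice mE))).
  by move=> x; rewrite lee_fin.
apply: lee_wpmul2l; first by rewrite lee_fin ltW// muckenhoupt_const_gt0.
rewrite -[leRHS]/(\int[mu]_(x in E) (w x)%:E)%E [leRHS]integral_mkcond.
rewrite le_eqVlt; apply/orP; left; apply/eqP; apply: eq_integral => x _.
rewrite patchE indicE; case: ifPn => _; first by rewrite poweR1r mul1e.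
by rewrite poweR0r ?gt_eqF// mul0e.
Qed.

Lemma enorm_ge (x : 'rV[R]_n) i : `|x 0 i| <= enorm x.
Proof.
rewrite /enorm -sqrtr_sqr ler_wsqrtr// (bigD1 i)//= lerDl sumr_ge0// => j _.
exact: sqr_ge0.
Qed.

Lemma measurable_enorm : measurable_fun setT (@enorm R n : T -> R).
Proof.
rewrite (_ : enorm = (fun x : T => (\sum_(i < n) x 0 i ^+ 2) `^ 2^-1)); last first.
  by apply/funext => x; rewrite powR12_sqrt// sumr_ge0// => i _; exact: sqr_ge0.
apply: measurableT_comp (measurable_powR _) _.
apply: measurable_sum => i; apply: measurable_funX; exact: measurable_coord.
Qed.

Lemma Ap_Np : Np p w.
Proof.
rewrite /Np; pose d x := (w x / (1 + enorm x) `^ (n%:R * p)).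
have e0 (x : T) : 0 < 1 + enorm x by rewrite ltr_pwDl// sqrtr_ge0.
have d0 x : (0 <= (d x)%:E)%E by rewrite lee_fin divr_ge0 ?powR_ge0// ltW.
have md : measurable_fun setT (fun x : T => (d x)%:E).
  apply/measurable_EFinP; rewrite (_ : d = (fun x : T => w x * (1 + enorm x) `^ (- (n%:R * p)))).
    apply: measurable_funM => //; apply: measurableT_comp (measurable_powR _) _.
    by apply: measurable_funD => //; exact: measurable_enorm.
  by apply/funext => x; rewrite powRN.
rewrite integE//; pose Q : set 'rV[R]_n := cube 0 1.
have mQ : measurable (Q : set T) by exact: measurable_cube.
apply: (@le_lt_trans _ _ (\int[mu]_x (maxop (fun y => (\1_Q y)%:E) x `^ p * (w x)%:E))%E); last first.
  apply: (le_lt_trans (muckenhoupt_indic mQ)); apply: lte_mul_pinfty => //.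
  - by rewrite lee_fin ltW// muckenhoupt_const_gt0.
  - exact: wfin.
apply: ge0_le_integral => //; first by move=> x _; exact: d0.
  apply: emeasurable_funM => //.
  exact: measurableT_comp (measurable_poweR _) (measurable_maxop _).
move=> x _; rewrite /d mulrC EFinM; apply: lee_wpmul2r => //.
(* Corner of a cube of side 1 + |x| holding both the unit cube and x, whence M chi_Q (x) >= (1 +
   |x|)^(-n). *)
pose c : 'rV[R]_n := \row_i Num.min 0 (x 0 i).
have xi i : - enorm x <= x 0 i <= enorm x by rewrite -ler_norml enorm_ge.
have xc : cube c (1 + enorm x) x.
  move=> i; rewrite mxE ge_min lexx orbT/=.
  have /andP[x1 x2] := xi i; have [x0|x0] := leP 0 (x 0 i); first lra.
  by rewrite lerDl; apply/ltW/e0.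
have Qc : Q `<=` cube c (1 + enorm x).
  move=> y yQ i; have := yQ i; rewrite !mxE => /andP[y1 y2].
  have /andP[x1 x2] := xi i; have [x0|x0] := leP 0 (x 0 i); lra.
apply: (@le_trans _ _ ((((1 + enorm x) ^+ n)^-1%:E * mu Q) `^ p)%E); last first.
  apply: le_poweR2r; first exact: ltW.
    by rewrite mule_ge0// lee_fin invr_ge0 exprn_ge0// ltW.
  exact: maxop_indic_ge.
rewrite [X in (_ * X)%E](_ : _ = 1%E); last by rewrite mu_cube// expr1n.
rewrite mule1 poweR_EFin lee_fin.
rewrite [X in _ <= X](_ : _ = ((1 + enorm x) `^ (n%:R * p))^-1)//.
by rewrite -(powR_mulrn n (ltW (e0 x))) -powRN -powRrM mulNr powRN.
Qed.

Lemma Ap_Wp : Wp p w.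
Proof.
split; first exact: Ap_Np.
exists muckenhoupt_const; split; first exact: muckenhoupt_const_gt0.
move=> f _ Mf _.
have mMp (h : 'rV[R]_n -> \bar R) : measurable_fun setT (fun x : T => (maxop h x `^ p * (w x)%:E)%E).
  apply: emeasurable_funM => //.
  exact: measurableT_comp (measurable_poweR _) (measurable_maxop _).
have Mp0 (h : 'rV[R]_n -> \bar R) x : (0 <= maxop h x `^ p * (w x)%:E)%E.
  by rewrite mule_ge0 ?poweR_ge0.
rewrite !integE//.
- exact: (@muckenhoupt Mf (fun x => maxop_ge0 _ x) (measurable_maxop _)).
- by move=> x; exact: (Mp0 _ x).
- exact: mMp.
Qed.

(** Test the strong bound on the complement G of F in the cube: M chi_G >= 1/2 on the cube, so w(G)
    is a fixed part of w(Q) at least. The 1 added to the constant keeps the resulting ratio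
    positive. *)
Lemma Ap_half c l (F : set T) : 0 < l -> measurable F -> F `<=` cube c l ->
  (mu F <= (2^-1 * l ^+ n)%:E)%E ->
  (wm F <= (1 - (2^-1) `^ p / (1 + muckenhoupt_const))%:E * wm (cube c l))%E.
Proof.
move=> l0 mF Fc Fh; have mc := measurable_cube c l.
have l0n : 0 < l ^+ n by rewrite exprn_gt0.
pose G := cube c l `\` F; have mG : measurable (G : set T) by exact: measurableD.
have GE : (wm (cube c l) = wm F + wm G)%E.
  rewrite -measureU//; first by rewrite setDUK.
  by rewrite setDIK.
have wf := wfin c l0.
have wFf : wm F \is a fin_num.
  by rewrite ge0_fin_numE//; apply: le_lt_trans wf; rewrite GE leeDl.
have wGf : wm G \is a fin_num.
  by rewrite ge0_fin_numE//; apply: le_lt_trans wf; rewrite GE leeDr.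
have GP : ((2^-1 * l ^+ n)%:E <= mu G)%E.
  rewrite measureD//; last by rewrite [ltLHS]mu_cube ?ltry.
  rewrite setIidr// [X in (_ <= X - _)%E](_ : _ = (l ^+ n)%:E); last exact: mu_cube.
  have Ff : mu F \is a fin_num by rewrite ge0_fin_numE// (le_lt_trans Fh)// ltry.
  rewrite [X in (_ <= _ - X)%E](_ : _ = (fine (mu F))%:E); last exact/esym/fineK.
  by move: Fh; rewrite -(fineK Ff) -EFinB !lee_fin; lra.
have key : (((2^-1) `^ p)%:E * wm (cube c l) <= muckenhoupt_const%:E * wm G)%E.
  apply: le_trans (muckenhoupt_indic mG).
  rewrite -[X in (_ * X <= _)%E]/(\int[mu]_(x in cube c l) (w x)%:E)%E.
  rewrite -ge0_integralZl//; last exact: measurable_funTS.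
  rewrite [leLHS]integral_mkcond; apply: ge0_le_integral => //.
  - by move=> x _; rewrite patchE; case: ifP => // _; rewrite mule_ge0// lee_fin powR_ge0.
  - apply/(measurable_restrictT _ mc); apply: measurable_funeM; exact: measurable_funTS.
  - apply: emeasurable_funM => //.
    exact: measurableT_comp (measurable_poweR _) (measurable_maxop _).
  - move=> x _; rewrite patchE; case: ifPn => [/set_mem xc|_]; last first.
      by rewrite mule_ge0 ?poweR_ge0.
    apply: lee_wpmul2r => //; rewrite -poweR_EFin.
    apply: le_poweR2r; [exact: ltW|by rewrite lee_fin invr_ge0|].
    apply: le_trans (maxop_indic_ge l0 mG xc (@subDsetl _ _ _)).
    rewrite lee_pdivlMl// -EFinM mulrC; exact: GP.
have M0 := muckenhoupt_const_gt0.
move: key; rewrite GE -(fineK wFf) -(fineK wGf) -EFinD -!EFinM !lee_fin.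
have a0 : 0 <= fine (wm F) by rewrite fine_ge0.
have b0 : 0 <= fine (wm G) by rewrite fine_ge0.
move: a0 b0; set a := fine _; set b := fine _ => a0 b0 key.
set t := (2^-1) `^ p in key *; set M := muckenhoupt_const in M0 key *.
have M1 : 0 < 1 + M by lra.
have : t / (1 + M) * (a + b) <= b.
  rewrite mulrAC ler_pdivrMr//; apply: (le_trans key).
  by rewrite mulrC ler_wpM2l//; lra.
lra.
Qed.

(** [measure_decay] inside the cube, with Lebesgue measure as reference, D = 2^n and [Ap_half] as
    the one-step gain. The right-hand side carries w(Q), which is at most the integral in C_p. *)
Lemma Ap_Cp_borel : exists C delta : R, [/\ 0 < C, 0 < delta &
  forall c l (E : set T), 0 < l -> measurable E -> E `<=` cube c l ->
  (wm E <= C%:E * ((fine (mu E) / l ^+ n) `^ delta)%:E * wm (cube c l))%E].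
Proof.
have M0 := muckenhoupt_const_gt0.
set b := 1 - (2^-1) `^ p / (1 + muckenhoupt_const).
have t1 : 0 < (2^-1 : R) `^ p < 1.
  rewrite powR_gt0//= [ltRHS](_ : 1 = 1 `^ p); last by rewrite powR1.
  by apply: gt0_ltr_powR; rewrite ?nnegrE// invf_lt1// ltr1n.
have b01 : 0 < b < 1.
  have /andP[t0 t1'] := t1; rewrite /b subr_gt0 gtrBl divr_gt0 ?ltr_pwDl ?ltW// andbT.
  by rewrite ltr_pdivrMr ?ltr_pwDl// ?mul1r ?ltW//; lra.
have /andP[b0 b1] := b01.
pose D : R := 2 ^+ n; have D1 : 1 <= D by rewrite exprn_ege1// ler1n.
have D0 : 0 < D by exact: lt_le_trans D1.
pose lam : R := 2^-1 / D.
have lam01 : 0 < lam < 1.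
  by rewrite divr_gt0 ?invr_gt0//= ltr_pdivrMr// mul1r; apply: lt_le_trans D1; rewrite invf_lt1// ltr1n.
have [delta delta0 dP] := powR_decay lam01 b01.
exists b^-1, delta; split => //; first by rewrite invr_gt0.
move=> c l E l0 mE Ec.
pose idx := gidx c l.
have midx k x : measurable (atom idx k x) by exact: measurable_gidx_atom.
have nidx k x y : idx k.+1 x = idx k.+1 y -> idx k x = idx k y by exact: gidx_nested.
have hgen := gidx_generates (o := c) l0.
have l0n : 0 < l ^+ n by rewrite exprn_gt0.
have P0E : atom idx 0 (c : T) = hcube c l.
  rewrite gidx_atomE// expr0 divr1; congr (hcube _ _).
  by apply/rowP => i; rewrite !mxE subrr mul0r mul0r floor0 mulr0 addr0.
pose E' := E `&` hcube c l.
have mh := measurable_hcube c l; have mc := measurable_cube c l.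
have mE' : measurable (E' : set T) by exact: measurableI.
have nullc : mu (cube c l `\` hcube c l) = 0%E.
  rewrite measureD//; last by rewrite [ltLHS]mu_cube ?ltry.
  rewrite setIidr; last exact: sub_hcube_cube.
  rewrite [X in (X - _)%E](_ : _ = (l ^+ n)%:E); last exact: mu_cube.
  by rewrite [X in (_ - X)%E](_ : _ = (l ^+ n)%:E) ?subee//; exact: mu_hcube.
have null : mu (E `\` E') = 0%E.
  apply: (subset_measure0 _ _ _ nullc).
  - exact: measurableD.
  - exact: measurableD.
  - by move=> x [Ex nx]; split; [exact: Ec|move=> hx; apply: nx].
have wE : wm E = wm E'.
  rewrite -{1}(setDUK (@subIsetl _ E (hcube c l))) measureU//.
  - by rewrite [X in (_ + X)%E](_ : _ = 0%E) ?adde0//; apply: mdens_null => //; exact: measurableD.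
  - exact: measurableD.
  - by rewrite setDIK.
have mufin : (mu E < +oo)%E.
  apply: (@le_lt_trans _ _ (mu (cube c l))); last by rewrite mu_cube ?ltry.
  by apply: le_measure; rewrite ?inE.
have muE : (mu E' <= (fine (mu E))%:E)%E.
  rewrite fineK ?ge0_fin_numE//; apply: le_measure; rewrite ?inE//; exact: subIsetl.
have muEl : fine (mu E) <= l ^+ n.
  rewrite -lee_fin fineK ?ge0_fin_numE// -(mu_cube c l0).
  by apply: le_measure; rewrite ?inE.
have r1 : fine (mu E) / l ^+ n <= 1 by rewrite ler_pdivrMr// mul1r.
have [r0|r0] := leP (fine (mu E)) 0.
  rewrite (_ : wm E = 0%E).
    by rewrite mule_ge0// mule_ge0// lee_fin ?powR_ge0// invr_ge0 ltW.
  apply: mdens_null => //; apply/eqP; rewrite eq_le measure_ge0 andbT.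
  by rewrite -(fineK (x := mu E)) ?ge0_fin_numE.
have [|j [rj bj]] := dP (fine (mu E) / l ^+ n); first by rewrite divr_gt0.
apply: (@le_trans _ _ ((b ^+ j)%:E * wm (atom idx 0 (c : T)))%E); last first.
  apply: (@le_trans _ _ ((b ^+ j)%:E * wm (cube c l))%E).
    rewrite P0E; apply: lee_wpmul2l; first by rewrite lee_fin exprn_ge0// ltW.
    by apply: le_measure; rewrite ?inE//; exact: sub_hcube_cube.
  by rewrite -EFinM; apply: lee_wpmul2r; rewrite ?lee_fin.
rewrite wE; apply: (measure_decay midx nidx hgen (u := mu) (D := D) (al := 2^-1)) => //.
- by rewrite invr_gt0 ltr0n/= invf_lt1// ltr1n.
- by rewrite ltW.
- by rewrite P0E mu_hcube// ltry.
- rewrite P0E; apply: le_lt_trans (wfin c l0).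
  by apply: le_measure; rewrite ?inE//; exact: sub_hcube_cube.
- move=> k x _; rewrite !mu_gidx_atom// -EFinM lee_fin /D -exprMn exprS.
  rewrite (_ : 2 * (l / (2 * 2 ^+ k)) = l / 2 ^+ k)//.
  by field; rewrite expf_neq0// pnatr_eq0.
- move=> k x F _ mF Fa; rewrite mu_gidx_atom// -EFinM => Fh.
  have h0 : 0 < l / 2 ^+ k by rewrite divr_gt0// exprn_gt0.
  have aE : atom idx k x = hcube (gcorner c l k x) (l / 2 ^+ k) by rewrite gidx_atomE.
  have sub : atom idx k x `<=` cube (gcorner c l k x) (l / 2 ^+ k).
    by rewrite aE; exact: sub_hcube_cube.
  have wE2 : wm (atom idx k x) = wm (cube (gcorner c l k x) (l / 2 ^+ k)).
    rewrite aE -[LHS]/(\int[mu]_(x in _) (w x)%:E)%E -[RHS]/(\int[mu]_(x in _) (w x)%:E)%E.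
    by rewrite -integral_cube_hcube.
  rewrite [X in (_ <= _ * X)%E](_ : _ = wm (cube (gcorner c l k x) (l / 2 ^+ k)))//.
  by apply: Ap_half => //; exact: subset_trans sub.
- by rewrite P0E; exact: subIsetr.
- rewrite P0E mu_hcube// -EFinM; apply: le_trans muE _; rewrite lee_fin.
  by rewrite -ler_pdivrMr.
Qed.

End muckenhoupt.

(** * Iterated maximal functions of indicators *)

Section level_sets.
Context {R : realType} {n : nat}.
Local Notation mu := (@mu R n).
Local Notation T := (borelT R n).

Lemma mu_setI_hcube (E : set T) c l : 0 < l -> measurable E ->
  mu (E `&` cube c l) = mu (E `&` hcube c l).
Proof.
move=> l0 mE; have mc := measurable_cube c l; have mh := measurable_hcube c l.
have E0 (D : set T) : measurable D -> mu (E `&` D) = (\int[mu]_(x in D) (\1_E x)%:E)%E.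
  by move=> mD; rewrite integral_indic.
by rewrite !E0// integral_cube_hcube//; exact: measurable_indice.
Qed.

Lemma cavg_indic (E : set T) c l : measurable E ->
  cavg c l (fun y => `|(\1_E y)%:E|)%E = ((l ^+ n)^-1%:E * mu (E `&` cube c l))%E.
Proof.
move=> mE; rewrite [X in cavg _ _ X](_ : _ = (fun y : T => (\1_E y)%:E)); last first.
  by apply/funext => y; rewrite gee0_abs// lee_fin.
rewrite cavgE//; last exact: measurable_indice.
by rewrite integral_indic//; exact: measurable_cube.
Qed.

Lemma maxop_indic_geI (E : set T) c l (x : T) : 0 < l -> measurable E -> cube c l x ->
  ((l ^+ n)^-1%:E * mu (E `&` cube c l) <= maxop (fun y => (\1_E y)%:E) x)%E.
Proof. by move=> l0 mE xc; rewrite -cavg_indic//; exact: cavg_le_maxop. Qed.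

Lemma mu_setI_cube_le (E : set T) c l : 0 < l -> measurable E ->
  (mu (E `&` cube c l) <= (l ^+ n)%:E)%E.
Proof.
move=> l0 mE; rewrite -(mu_cube c l0); apply: le_measure; rewrite ?inE//.
- by apply: measurableI => //; exact: measurable_cube.
- exact: measurable_cube.
Qed.

Lemma maxop_indic_le1 (E : set T) (x : T) : measurable E ->
  (maxop (fun y => (\1_E y)%:E) x <= 1)%E.
Proof.
move=> mE; apply: ge_ereal_sup => _ [c [l [l0 xc ->]]]; rewrite cavg_indic//.
by rewrite lee_pdivrMl ?exprn_gt0// mule1; exact: mu_setI_cube_le.
Qed.

(* The factor between two consecutive levels of the dyadic maximal function: 2^n
   is lost in the stopping-time argument and a further 2 keeps the measures of
   the successive level sets growing geometrically. *)
Definition lbase : R := 2 ^+ n.+1.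

Lemma lbase_gt0 : 0 < lbase. Proof. by rewrite exprn_gt0. Qed.

Lemma lbase_ge2 : 2 <= lbase.
Proof. by rewrite /lbase exprS ler_pMr// exprn_ege1// ler1n. Qed.

Lemma lbase_gt1 : 1 < lbase.
Proof. by apply: lt_le_trans lbase_ge2; rewrite ltr1n. Qed.

(* The level sets of the dyadic maximal function of the indicator of E within the
   cube contribute one term of the sum each. *)
Lemma level_growth (E : set T) (g : T -> \bar R) (b : nat -> R) : measurable E ->
  (forall x, 0 <= g x)%E -> measurable_fun setT g -> (forall i, 0 <= b i) ->
  (forall i c l x, 0 < l -> cube c l x ->
     ((lbase ^- i.+1 * l ^+ n)%:E < mu (E `&` cube c l))%E ->
     (mu (E `&` cube c l) <= (lbase ^- i * l ^+ n)%:E)%E ->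
     ((b i * lbase ^- i.+1)%:E <= g x)%E) ->
  forall j c l, 0 < l -> (mu (E `&` cube c l) <= (lbase ^- j * l ^+ n)%:E)%E ->
  ((lbase^-1 * \sum_(i < j) b i)%:E * ((l ^+ n)^-1%:E * mu (E `&` cube c l))
     <= cavg c l g)%E.
Proof.
move=> mE g0 mg b0 Hg j c l l0 Ej.
have a0 := lbase_gt0; have a1 := lbase_gt1.
have ai0 i : 0 < lbase ^- i by rewrite invr_gt0 exprn_gt0.
have bai i k : 0 <= b i * lbase ^- k by rewrite mulr_ge0// ltW.
have l0n : 0 < l ^+ n by rewrite exprn_gt0.
pose idx := gidx c l.
have midx k x : measurable (atom idx k x) by exact: measurable_gidx_atom.
have nidx k x y : idx k.+1 x = idx k.+1 y -> idx k x = idx k y by exact: gidx_nested.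
have hgen := gidx_generates (o := c) l0.
have P0E : atom idx 0 (c : T) = hcube c l.
  rewrite gidx_atomE// expr0 divr1; congr (hcube _ _).
  by apply/rowP => i; rewrite !mxE subrr mul0r mul0r floor0 mulr0 addr0.
have mh := measurable_hcube c l; have mc := measurable_cube c l.
pose E' := E `&` hcube c l.
have mE' : measurable (E' : set T) by exact: measurableI.
have E'E : mu (E `&` cube c l) = mu E' by exact: mu_setI_hcube.
rewrite E'E in Ej *.
have E'fin : mu E' \is a fin_num by rewrite ge0_fin_numE// (le_lt_trans Ej)// ltry.
pose v k : R := (l / 2 ^+ k) ^+ n.
have v0 k : 0 < v k by rewrite exprn_gt0// divr_gt0// exprn_gt0.
have muA k x : mu (atom idx k x) = (v k)%:E by exact: mu_gidx_atom.
have vS k : v k = 2 ^+ n * v k.+1.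
  by rewrite /v -exprMn; congr (_ ^+ _); rewrite exprS; field; rewrite expf_neq0// pnatr_eq0.
pose G i k := [set x | ((lbase ^- i * v k)%:E < mu (atom idx k x `&` E'))%E].
have GP i k x y : G i k x -> atom idx k x y -> G i k y.
  by rewrite /G/= => Gx xy; rewrite (atom_eq xy).
pose W i := \bigcup_k G i k.
have mW i : measurable (W i) by exact: (measurable_hit midx nidx (GP i)).
have WP i : W i `<=` hcube c l.
  move=> x [k _]; rewrite /G/= => Gx.
  have [[y [xy Ey]]|/set0P/negP/negPn/eqP E0] := pselect ((atom idx k x `&` E') !=set0).
    have : atom idx 0 (c : T) y by rewrite P0E; case: Ey.
    by rewrite -P0E /atom/= => <-; apply/esym; exact: (atom_sub nidx (leq0n k) xy).
  by move: Gx; rewrite E0 measure0 lte_fin ltNge mulr_ge0 ?ltW.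
have W0 : W 0%N = set0.
  apply/seteqP; split => // x [k _]; rewrite /G/= expr0 invr1 mul1r -(muA k x) ltNge => /negP; apply.
  apply: le_measure; rewrite ?inE//; first exact: measurableI.
have WS i : W i `<=` W i.+1.
  move=> x [k _ Gx]; exists k => //; rewrite /G/=; apply: le_lt_trans Gx.
  rewrite lee_fin ler_pM2r// lef_pV2 ?posrE ?exprn_gt0// exprS ler_peMl ?ltW ?exprn_gt0//.
have Wle i : (mu (W i) <= (lbase ^+ i)%:E * mu E')%E.
  rewrite -[W i in leLHS]setIT; apply: (@le_trans _ _ ((lbase ^+ i)%:E * mu (W i `&` E'))%E).
    apply: (@stopping_measure_le _ _ R _ _ midx nidx (G i) (GP i)) => //; first by rewrite exprn_ge0 ?ltW.
    move=> k x [Gx _]; rewrite setIT muA -lee_pdivrMl ?exprn_gt0// -EFinM; exact: ltW.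
  apply: lee_wpmul2l; first by rewrite lee_fin exprn_ge0 ?ltW.
  by apply: le_measure; rewrite ?inE//; exact: measurableI.
(* The parent of a stopping cell was rejected, so the density in the cell exceeds the threshold by a
   factor 2^n at most; the top cell is rejected because i <= j. *)
have stop i k x : (i <= j)%N -> first_hit (G i) k x ->
    (mu (atom idx k x `&` E') <= (2 ^+ n * lbase ^- i * v k)%:E)%E.
  move=> ij [Gx Gj]; case: k => [|k] in Gx Gj *.
    exfalso; move: Gx; rewrite /G/= ltNge => /negP; apply.
    apply: (@le_trans _ _ (mu E')).
      by apply: le_measure; rewrite ?inE//; exact: measurableI.
    apply: (le_trans Ej); rewrite lee_fin /v expr0 divr1 ler_pM2r//.
    by rewrite lef_pV2 ?posrE ?exprn_gt0// ler_eXn2l.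
  have := Gj k (ltnSn k); rewrite /G/= => /negP; rewrite -leNgt => Gk.
  rewrite (_ : 2 ^+ n * lbase ^- i * v k.+1 = lbase ^- i * v k); last by rewrite (vS k) [in RHS]mulrCA mulrA.
  apply: le_trans Gk.
  apply: le_measure; rewrite ?inE; [exact: measurableI|exact: measurableI|].
  by apply: setSI; exact: (atom_sub nidx (leqnSn k)).
(* A converse to [Wle]: up to a null set E' lies in [W i], by differentiation, and its density in
   each stopping cell is bounded above by [stop]. *)
have Wge i : (0 < i <= j)%N -> (mu E' <= (2 ^+ n * lbase ^- i)%:E * mu (W i))%E.
  move=> /andP[i0 ij].
  have null : mu (E' `\` W i) = 0%E.
    have E'W : mu (E' `\` W i) = mrestr mu mh (E' `\` W i).
      by rewrite /mrestr setIidl// => x [[]].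
    rewrite E'W; apply: (differentiation_null midx nidx hgen (b := lbase ^- i)) => //.
    - by rewrite -[ltLHS]/(mu (setT `&` hcube c l)) setTI mu_hcube// ltry.
    - exact: measurableD.
    - by rewrite ltW//= invf_lt1 ?exprn_gt0// exprn_egt1// -lt0n.
    - move=> k x [Ex Wx].
      have Px' : atom idx k x `<=` hcube c l.
        have Px : atom idx 0 (c : T) x by rewrite P0E; case: Ex.
        by rewrite -P0E -(atom_eq Px); exact: (atom_sub nidx (leq0n k)).
      change (mu ((E' `\` W i) `&` atom idx k x `&` hcube c l) <= (lbase ^- i)%:E * mu (atom idx k x `&` hcube c l))%E.
      rewrite (setIidl Px') setIidl; last by move=> y [_ /Px'].
      apply: (@le_trans _ _ (mu (atom idx k x `&` E'))).
        apply: le_measure; rewrite ?inE.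
        - by apply: measurableI => //; exact: measurableD.
        - exact: measurableI.
        - by move=> y [[]].
      have : ~ G i k x by move=> Gx; apply: Wx; exists k.
      by rewrite /G/= => /negP; rewrite -leNgt muA -EFinM.
  have -> : mu E' = mu (W i `&` E').
    rewrite -{1}(setDUK (@subIsetl _ E' (W i))) measureU//.
    - rewrite (_ : E' `\` (E' `&` W i) = E' `\` W i); last by rewrite setDIr setDv set0U.
      by rewrite [X in (_ + X)%E](_ : _ = 0%E) ?adde0 1?setIC.
    - exact: measurableI.
    - by apply: measurableD => //; exact: measurableI.
    - by rewrite setDIK.
  rewrite -[W i in leRHS]setIT.
  apply: (@stopping_measure_le _ _ R _ _ midx nidx (G i) (GP i)) => //.
    by rewrite mulr_ge0 ?ltW.
  by move=> k x xs; rewrite setIT muA -EFinM; exact: stop.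
have gW i x : (i < j)%N -> W i.+1 x -> ((b i * lbase ^- i.+1)%:E <= g x)%E.
  move=> ij Wx; have := Wx; rewrite /W -bigcup_first_hit => -[k _ xk].
  have h0 : 0 < l / 2 ^+ k by rewrite divr_gt0// exprn_gt0.
  have aE : atom idx k x = hcube (gcorner c l k x) (l / 2 ^+ k) by rewrite gidx_atomE.
  have sub : atom idx k x `<=` hcube c l.
    have Px : atom idx 0 (c : T) x by rewrite P0E; exact: WP Wx.
    by rewrite -P0E -(atom_eq Px); exact: (atom_sub nidx (leq0n k)).
  have mm : mu (E `&` cube (gcorner c l k x) (l / 2 ^+ k)) = mu (atom idx k x `&` E').
    rewrite mu_setI_hcube// -aE /E' setICA [atom _ _ _ `&` _]setIC setIA.
    by congr (mu _); rewrite -setIA (setIidr sub).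
  apply: (Hg i (gcorner c l k x) (l / 2 ^+ k)) => //.
  - by apply: sub_hcube_cube; rewrite -aE; exact: atom_refl.
  - by rewrite mm; case: xk.
  - rewrite mm; apply: (le_trans (stop _ _ _ _ xk)) => //.
    rewrite lee_fin -/(v k) ler_pM2r//.
    rewrite exprS invfM mulrA ger_pMl// ler_pdivrMr// mul1r /lbase exprS.
    by rewrite ler_peMl// ler1n.
have key j' : (j' <= j)%N ->
    ((lbase^-1 * \sum_(i < j') b i)%:E * mu E' <= \int[mu]_(x in W j') g x)%E.
  elim: j' => [|j' IH] jj; first by rewrite big_ord0 mulr0 mul0e integral_ge0.
  have mD : measurable (W j'.+1 `\` W j') by exact: measurableD.
  have -> : (\int[mu]_(x in W j'.+1) g x = \int[mu]_(x in W j') g x +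
      \int[mu]_(x in W j'.+1 `\` W j') g x)%E.
    rewrite -ge0_integral_setU//; first by rewrite setDUK//; exact: WS.
    - exact: measurable_funTS.
    - by rewrite disj_set2E setDIK.
  rewrite big_ord_recr/= mulrDr EFinD ge0_muleDl; last 2 first.
  - by rewrite lee_fin mulr_ge0 ?sumr_ge0// invr_ge0 ltW.
  - by rewrite lee_fin mulr_ge0// invr_ge0 ltW.
  apply: leeD; first exact/IH/ltnW.
  apply: (@le_trans _ _ (\int[mu]_(x in W j'.+1 `\` W j') cst (b j' * lbase ^- j'.+1)%:E x)%E); last first.
    apply: ge0_le_integral => //.
    - by move=> x _; rewrite /cst lee_fin.
    - exact: measurable_funTS.
    - by move=> x [Wx _]; exact: gW.
  rewrite integral_cst//.
  have Wfin i : mu (W i) \is a fin_num.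
    rewrite ge0_fin_numE//; apply: (le_lt_trans (Wle i)).
    by apply: lte_mul_pinfty; rewrite ?lee_fin ?exprn_ge0 ?ltW// -ge0_fin_numE.
  have WD : mu (W j'.+1 `\` W j') = (fine (mu (W j'.+1)) - fine (mu (W j')))%:E.
    have DU : (mu (W j') + mu (W j'.+1 `\` W j') = mu (W j'.+1))%E.
      rewrite -measureU//; first by rewrite setDUK//; exact: WS.
      by rewrite setDIK.
    by rewrite EFinB !fineK// -DU addeAC subee ?add0e.
  rewrite [X in (_ <= _ * X)%E]WD -(fineK E'fin) -!EFinM lee_fin.
  (* As lbase is 2 times 2^n, the lower bound for [W j'.+1] is twice the upper bound for [W j']. The
     difference has measure at least lbase^j' |E'|, and there g is at least b_j' lbase^-(j'+1). *)
  have w1 : 2 * lbase ^+ j' * fine (mu E') <= fine (mu (W j'.+1)).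
    have jj1 : (0 < j'.+1 <= j)%N by rewrite jj.
    have := Wge j'.+1 jj1; rewrite -(fineK E'fin) -(fineK (Wfin _)) -EFinM lee_fin.
    move=> /(ler_wpM2l (ltac:(by rewrite mulr_ge0 ?exprn_ge0 ?ltW) : 0 <= 2 * lbase ^+ j')).
    rewrite [X in _ <= X](_ : _ = fine (mu (W j'.+1)))//.
    rewrite mulrA [X in X * _](_ : _ = 1) ?mul1r//.
    rewrite [lbase ^+ j'.+1]exprS {2}/lbase exprS; field.
    by rewrite !expf_neq0 ?pnatr_eq0// gt_eqF.
  have w2 : fine (mu (W j')) <= lbase ^+ j' * fine (mu E').
    by rewrite -lee_fin EFinM !fineK.
  have : lbase ^+ j' * fine (mu E') <= fine (mu (W j'.+1)) - fine (mu (W j')) by lra.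
  move=> /(ler_wpM2l (bai j' j'.+1)).
  apply: le_trans; rewrite le_eqVlt; apply/orP; left; apply/eqP.
  rewrite exprS; field; rewrite expf_neq0 ?gt_eqF//.
rewrite muleCA cavgE//; apply: lee_wpmul2l; first by rewrite lee_fin invr_ge0 ltW.
apply: (le_trans (key j (leqnn j))); apply: ge0_subset_integral => //.
- exact: measurable_funTS.
- by apply: subset_trans (WP j) _; exact: sub_hcube_cube.
Qed.

End level_sets.

(** * Maximal functions of indicators under N_p and W_p *)

Section weighted_maximal.
Context {R : realType} {n : nat}.
Local Notation mu := (@mu R n).
Local Notation T := (borelT R n).
Local Notation lbase := (@lbase R n).
Variables (p : R) (w : T -> R).
Hypotheses (p1 : 1 < p) (mw : measurable_fun setT w) (w0 : forall x, 0 <= w x).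

Let p0 : 0 < p. Proof. exact: lt_trans p1. Qed.
Let we0 x : (0 <= (w x)%:E)%E. Proof. by rewrite lee_fin. Qed.
Let mwe : measurable_fun setT (fun x => (w x)%:E). Proof. exact/measurable_EFinP. Qed.
Local Notation wm := (mdens mu we0 mwe).

Definition indic_max (E : set T) : T -> \bar R := maxop (fun y => (\1_E y)%:E).
(* The integral on the right-hand side of the C_p condition when E is a cube. *)
Definition tail_mass (E : set T) : \bar R :=
  (\int[mu]_x (indic_max E x `^ p * (w x)%:E))%E.

Let X0 E x : (0 <= indic_max E x)%E. Proof. exact: maxop_ge0. Qed.
Let mX E : measurable_fun setT (indic_max E). Proof. exact: measurable_maxop. Qed.

Lemma measurable_poweR_weight (f : T -> \bar R) : measurable_fun setT f ->
  measurable_fun setT (fun x => f x `^ p * (w x)%:E)%E.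
Proof.
move=> mf; apply: emeasurable_funM => //.
exact: measurableT_comp (measurable_poweR _) mf.
Qed.

Let pw0 (f : T -> \bar R) x : (0 <= f x `^ p * (w x)%:E)%E.
Proof. by rewrite mule_ge0 ?poweR_ge0. Qed.

Lemma le_integral_weight (f g : T -> \bar R) : (forall x, 0 <= f x)%E ->
  (forall x, f x <= g x)%E -> measurable_fun setT f -> measurable_fun setT g ->
  (\int[mu]_x (f x `^ p * (w x)%:E) <= \int[mu]_x (g x `^ p * (w x)%:E))%E.
Proof.
move=> f0 fg mf mg; apply: ge0_le_integral => //; try exact: measurable_poweR_weight.
by move=> x _; apply: lee_wpmul2r => //; apply: le_poweR2r => //; exact: ltW.
Qed.

Lemma integral_weightZl (f : T -> \bar R) (k : R) : 0 <= k -> (forall x, 0 <= f x)%E ->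
  measurable_fun setT f ->
  (\int[mu]_x ((k%:E * f x) `^ p * (w x)%:E) =
    (k `^ p)%:E * \int[mu]_x (f x `^ p * (w x)%:E))%E.
Proof.
move=> k0 f0 mf; rewrite -ge0_integralZl//; last 2 first.
- exact: measurable_poweR_weight.
- by rewrite lee_fin powR_ge0.
by apply: eq_integral => x _; rewrite poweRM// poweR_EFin muleA.
Qed.

Lemma weight_le_integral (f : T -> \bar R) (k : R) (E : set T) : 0 <= k -> measurable E ->
  measurable_fun setT f -> (forall x, E x -> k%:E <= f x)%E ->
  ((k `^ p)%:E * wm E <= \int[mu]_x (f x `^ p * (w x)%:E))%E.
Proof.
move=> k0 mE mf kf; rewrite -[X in (_ * X <= _)%E]/(\int[mu]_(x in E) (w x)%:E)%E.
rewrite -ge0_integralZl//; last 2 first.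
- exact: measurable_funTS.
- by rewrite lee_fin powR_ge0.
rewrite [leLHS]integral_mkcond; apply: ge0_le_integral => //.
- by move=> x _; rewrite patchE; case: ifP => // _; rewrite mule_ge0// lee_fin powR_ge0.
- apply/(measurable_restrictT _ mE); apply: measurable_funeM; exact: measurable_funTS.
- exact: measurable_poweR_weight.
- move=> x _; rewrite patchE; case: ifPn => [/set_mem xE|_]; last exact: pw0.
  apply: lee_wpmul2r => //; rewrite -poweR_EFin.
  by apply: le_poweR2r; [exact: ltW|rewrite lee_fin|exact: kf].
Qed.

Lemma enorm_le (x : T) (b : R) : 0 <= b -> (forall i, `|x 0 i| <= b) -> enorm x <= n%:R * b.
Proof.
move=> b0 xb; rewrite /enorm -[leRHS]ger0_norm ?mulr_ge0// -sqrtr_sqr ler_wsqrtr//.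
apply: (@le_trans _ _ (\sum_(i < n) b ^+ 2)).
  by apply: ler_sum => i _; rewrite -real_normK ?num_real// lerXn2r ?nnegrE.
rewrite sumr_const card_ord -[_ *+ _]mulr_natl exprMn; apply: ler_wpM2r; first exact: sqr_ge0.
by rewrite -natrX ler_nat; case: (n) => // m; rewrite leq_pmulr.
Qed.

(** A cube of side l' through x that meets E has 1 + |x| <= B0 max(1, l') and average at most min(1,
    l/l')^n; the product max(1, l') min(1, l/l') is at most 1 + l. *)
Lemma indic_max_decay c l (E : set T) : 0 < l -> measurable E -> E `<=` cube c l ->
  exists2 B, 0 < B & forall x : T, (indic_max E x <= ((B / (1 + enorm x)) ^+ n)%:E)%E.
Proof.
move=> l0 mE Ec; pose rho := enorm c + l.
have rho0 : 0 <= rho by rewrite addr_ge0 ?sqrtr_ge0// ltW.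
pose B0 := 1 + n%:R * rho + n%:R; have B01 : 1 <= B0.
  by rewrite /B0 -addrA lerDl addr_ge0// mulr_ge0.
have B00 : 0 < B0 by exact: lt_le_trans B01.
exists (B0 * (1 + l)); first by rewrite mulr_gt0// addr_gt0.
move=> x; have e0 : 0 < 1 + enorm x by rewrite ltr_pwDl// sqrtr_ge0.
apply: ge_ereal_sup => _ [c' [l' [l'0 xc' ->]]]; rewrite cavg_indic//.
have [[y [Ey yc']]|/set0P/negP/negPn/eqP ->] := pselect ((E `&` cube c' l') !=set0); last first.
  rewrite measure0 mule0 lee_fin exprn_ge0// divr_ge0 ?mulr_ge0 ?ltW//.
  by rewrite addr_gt0.
have xe : enorm x <= n%:R * (rho + l').
  apply: enorm_le; first by rewrite addr_ge0// ltW.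
  move=> i; have /andP[x1 x2] := xc' i; have /andP[y1 y2] := yc' i.
  have /andP[z1 z2] := Ec y Ey i.
  have := enorm_ge c i; rewrite ler_norml => /andP[c1 c2].
  by rewrite ler_norml /rho; apply/andP; split; lra.
have l'B : 1 + enorm x <= B0 * Num.max 1 l'.
  have [h|h] := leP 1 l'.
    apply: (@le_trans _ _ (1 + n%:R * rho + n%:R * l')); first by rewrite -addrA lerD2l -mulrDr.
    rewrite /B0 [leRHS]mulrDl lerD2r ler_peMr// addr_ge0// mulr_ge0//.
  rewrite mulr1; apply: (@le_trans _ _ (1 + n%:R * rho + n%:R * l')).
    by rewrite -addrA lerD2l -mulrDr.
  by rewrite lerD2l ler_piMr// ltW.
apply: (@le_trans _ _ (((Num.min 1 (l / l')) ^+ n)%:E)).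
  rewrite lee_pdivrMl ?exprn_gt0// -EFinM -exprMn.
  have [h|h] := leP 1 (l / l'); first by rewrite mulr1; exact: mu_setI_cube_le.
  rewrite mulrC divfK ?gt_eqF//; apply: (@le_trans _ _ (mu (cube c l))); last by rewrite mu_cube.
  apply: le_measure; rewrite ?inE//.
  - by apply: measurableI => //; exact: measurable_cube.
  - exact: measurable_cube.
  - by move=> z [/Ec].
rewrite lee_fin; apply: lerXn2r; rewrite ?nnegrE.
- by rewrite le_min ler01 divr_ge0// ltW.
- by rewrite divr_ge0 ?mulr_ge0 ?ltW// addr_gt0.
rewrite ler_pdivlMr// mulrC.
have m0 : 0 <= Num.min 1 (l / l') by rewrite le_min ler01 divr_ge0// ltW.
apply: (le_trans (ler_wpM2r m0 l'B)); rewrite -mulrA ler_wpM2l ?(ltW B00)//.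
have [h|h] := leP 1 l'.
  apply: (@le_trans _ _ (l' * (l / l'))).
    by rewrite ler_wpM2l ?(ltW l'0)// ge_min lexx orbT.
  by rewrite mulrC divfK ?gt_eqF// lerDr.
by rewrite mul1r ge_min lerDl (ltW l0).
Qed.

(** The decay of M chi_E, raised to the power p, is exactly the kernel in N_p. This finiteness is
    the entry condition of W_p. *)
Lemma tail_mass_fin c l (E : set T) : Np p w -> 0 < l -> measurable E -> E `<=` cube c l ->
  (tail_mass E < +oo)%E.
Proof.
move=> HN l0 mE Ec; have [B B0 XB] := indic_max_decay l0 mE Ec.
have e0 (x : T) : 0 < 1 + enorm x by rewrite ltr_pwDl// sqrtr_ge0.
pose d (x : T) := w x / (1 + enorm x) `^ (n%:R * p).
have d0 x : (0 <= (d x)%:E)%E by rewrite lee_fin divr_ge0 ?powR_ge0.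
have md : measurable_fun setT (fun x : T => (d x)%:E).
  apply/measurable_EFinP; rewrite (_ : d = (fun x : T => w x * (1 + enorm x) `^ (- (n%:R * p)))).
    apply: measurable_funM => //; apply: measurableT_comp (measurable_powR _) _.
    by apply: measurable_funD => //; exact: measurable_enorm.
  by apply/funext => x; rewrite powRN.
move: HN; rewrite /Np integE// => HN.
apply: (@le_lt_trans _ _ ((B `^ (n%:R * p))%:E * \int[mu]_x (d x)%:E)%E); last first.
  by apply: lte_mul_pinfty => //; rewrite lee_fin powR_ge0.
rewrite -ge0_integralZl//; last by rewrite lee_fin powR_ge0.
apply: ge0_le_integral => //.
- exact: measurable_poweR_weight.
- exact: measurable_funeM.
move=> x _; have -> : (d x)%:E = (((1 + enorm x) `^ (n%:R * p))^-1%:E * (w x)%:E)%E.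
  by rewrite -EFinM mulrC.
rewrite muleA; apply: lee_wpmul2r => //.
apply: (le_trans (le_poweR2r (ltW p0) (X0 E x) (XB x))).
rewrite poweR_EFin -EFinM lee_fin -powR_mulrn ?divr_ge0 ?(ltW B0) ?(ltW (e0 x))//.
rewrite -powRrM powRM ?(ltW B0) ?invr_ge0 ?(ltW (e0 x))//.
by rewrite -powR_inv1 ?(ltW (e0 x))// -powRrM mulN1r powRN.
Qed.

Variable C1 : R.
Hypothesis C10 : 0 < C1.
Hypothesis HN : Np p w.
Hypothesis HW : forall f : T -> R, measurable_fun setT f ->
  let Mf := maxop (fun x => (f x)%:E) in
  (\int[mu]_x (Mf x `^ p * (w x)%:E) < +oo)%E ->
  (\int[mu]_x (maxop Mf x `^ p * (w x)%:E) <=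
   C1%:E * \int[mu]_x (Mf x `^ p * (w x)%:E))%E.

Definition indic_max3 (E : set T) : T -> \bar R := maxop (maxop (indic_max E)).

(** W_p tests real functions, so its second use goes through [fine] of M chi_E, legitimate as M
    chi_E <= 1; the finiteness premise there follows from the first use. *)
Lemma indic_max3_bound c l (E : set T) : 0 < l -> measurable E -> E `<=` cube c l ->
  (\int[mu]_x (indic_max3 E x `^ p * (w x)%:E) <= (C1 ^+ 2)%:E * tail_mass E)%E.
Proof.
move=> l0 mE Ec; have Afin := tail_mass_fin HN l0 mE Ec.
have H1 := HW (measurable_indic mE : measurable_fun setT (\1_E : T -> R)) Afin.
have XE : indic_max E = (fun x => (fine (indic_max E x))%:E).
  apply/funext => x; rewrite fineK// ge0_fin_numE//.
  by apply: le_lt_trans (maxop_indic_le1 x mE) _; rewrite ltry.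
have mf : measurable_fun setT (fun x => fine (indic_max E x)).
  exact: measurableT_comp (fine_measurable measurableT) (mX E).
have := HW mf; rewrite /= -XE => H2; apply: le_trans (H2 _) _.
  by apply: le_lt_trans H1 _; apply: lte_mul_pinfty => //; rewrite lee_fin ltW.
rewrite expr2 EFinM -muleA; apply: lee_wpmul2l; [by rewrite lee_fin ltW|exact: H1].
Qed.

(** The gain in the average of M M chi_E over a cube where E has density at most lbase^-j; the
    summand is itself the gain in the average of M chi_E at level i. *)
Definition growth j : R := lbase^-1 * \sum_(i < j) (lbase^-1 * i%:R).

Lemma growthE j : growth j = lbase ^- 2 / 2 * (j%:R * (j%:R - 1)).
Proof.
rewrite /growth; have -> : \sum_(i < j) (lbase^-1 * (i%:R : R)) = lbase^-1 / 2 * (j%:R * (j%:R - 1)).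
  elim: j => [|j IH]; first by rewrite big_ord0 !mul0r mulr0.
  by rewrite big_ord_recr/= IH -[j.+1]addn1 natrD; field; rewrite gt_eqF ?lbase_gt0.
by field; rewrite gt_eqF ?lbase_gt0.
Qed.

Lemma growth_ge0 j : 0 <= growth j.
Proof.
rewrite /growth mulr_ge0 ?invr_ge0 ?(ltW (@lbase_gt0 R n))//.
by apply: sumr_ge0 => i _; rewrite mulr_ge0 ?invr_ge0 ?(ltW (@lbase_gt0 R n)).
Qed.

(** [level_growth] is used twice. With all coefficients 1 it bounds averages of M chi_E from below
    on cubes of density between lbase^-(i+1) and lbase^-i; this supplies the coefficients for M M
    chi_E. *)
Lemma indic_max3_ge (E : set T) j c l x : measurable E -> 0 < l -> cube c l x ->
  (mu (E `&` cube c l) <= (lbase ^- j * l ^+ n)%:E)%E ->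
  ((growth j)%:E * ((l ^+ n)^-1%:E * mu (E `&` cube c l)) <= indic_max3 E x)%E.
Proof.
move=> mE l0 xc Ej; have a0 := @lbase_gt0 R n.
have mM2 : measurable_fun setT (maxop (indic_max E) : T -> \bar R) by exact: measurable_maxop.
have M20 (x' : T) : (0 <= maxop (indic_max E) x')%E by exact: maxop_ge0.
have absE (f : T -> \bar R) : (forall x, 0 <= f x)%E -> (fun y => `|f y|)%E = f.
  by move=> f0; apply/funext => y; rewrite gee0_abs.
apply: (@le_trans _ _ (cavg c l (maxop (indic_max E)))); last first.
  by have := cavg_le_maxop (maxop (indic_max E)) l0 xc; rewrite absE.
apply: (level_growth mE M20 mM2 (b := fun i => lbase^-1 * i%:R)) => //.
  by move=> i; rewrite mulr_ge0 ?invr_ge0 ?(ltW a0).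
move=> i c' l' y l'0 yc' d1 d2.
have d1' : ((lbase ^- i.+1)%:E <= (l' ^+ n)^-1%:E * mu (E `&` cube c' l'))%E.
  by rewrite lee_pdivlMl ?exprn_gt0// -EFinM mulrC ltW.
apply: (@le_trans _ _ (cavg c' l' (indic_max E))); last first.
  by have := cavg_le_maxop (indic_max E) l'0 yc'; rewrite absE.
have := level_growth mE (X0 E) (mX E) (b := fun _ => 1) _ _ l'0 d2.
rewrite sumr_const card_ord -[X in _ * X]mulr_natr mul1r => H.
apply: le_trans (H _ _) => //.
  by rewrite EFinM; apply: lee_wpmul2l => //; rewrite lee_fin mulr_ge0 ?invr_ge0 ?(ltW a0).
move=> i' c2 l2 z l20 zc2 e1 e2; rewrite mul1r.
apply: le_trans (maxop_indic_geI l20 mE zc2).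
by rewrite lee_pdivlMl ?exprn_gt0// -EFinM mulrC ltW.
Qed.

Lemma growth_unbounded B : exists j, B <= growth j.
Proof.
have a0 : 0 < lbase ^+ 2 by rewrite exprn_gt0// lbase_gt0.
pose t := `|2 * lbase ^+ 2 * B|.
exists (Num.bound t).+2; rewrite growthE.
have tb : t < (Num.bound t)%:R by apply/archi_boundP/normr_ge0.
have H : t <= (Num.bound t).+2%:R * ((Num.bound t).+2%:R - 1).
  have : 0 <= t by exact: normr_ge0.
  move: tb; set m := Num.bound t => tb t0.
  rewrite -addn2 natrD; nra.
have -> : B = lbase ^- 2 / 2 * (2 * lbase ^+ 2 * B).
  by field; rewrite gt_eqF ?lbase_gt0.
apply: ler_wpM2l; first by rewrite divr_ge0// invr_ge0 ltW.
by apply: le_trans H; exact: ler_norm.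
Qed.

(** The leading 2 pays for a cube that realizes only half of M chi_E at a point; the other factor,
    to the power p, beats C1^2 by 2. *)
Definition level0 : nat := xchoose (growth_unbounded (2 * (2 * C1 ^+ 2) `^ p^-1)).

(* Off the set on the right, the third iterate dominates the indicator's maximal
   function by a factor whose p-th power is 2 C1^2, so W_p makes that part of the
   integral at most half of the whole. *)
Lemma tail_mass_absorb c l (E : set T) : 0 < l -> measurable E -> E `<=` cube c l ->
  (tail_mass E <= 2%:E * wm [set x | ((lbase ^- level0)%:E < indic_max E x)%E])%E.
Proof.
move=> l0 mE Ec; have Afin := tail_mass_fin HN l0 mE Ec.
set F := [set x | _]; have mF : measurable F by exact: measurable_gt.
have BP := xchooseP (growth_unbounded (2 * (2 * C1 ^+ 2) `^ p^-1)).
rewrite -/level0 in BP; set J := level0 in BP F mF *; set gJ := growth J in BP.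
set B := (2 * C1 ^+ 2) `^ p^-1 in BP.
have B0 : 0 < B by rewrite powR_gt0// mulr_gt0// exprn_gt0.
have BpE : B `^ p = 2 * C1 ^+ 2.
  by rewrite /B -powRrM mulVf ?gt_eqF// powRr1// mulr_ge0// exprn_ge0// ltW.
have out x : ~ F x -> (indic_max E x <= (B^-1)%:E * indic_max3 E x)%E.
  move=> /negP; rewrite -leNgt => Xx.
  have [Xx0|Xx0] := leP (indic_max E x) 0.
    by apply: le_trans Xx0 _; rewrite mule_ge0 ?maxop_ge0// lee_fin invr_ge0 ltW.
  have Xf : indic_max E x \is a fin_num.
    by rewrite ge0_fin_numE//; apply: le_lt_trans (maxop_indic_le1 x mE) _; rewrite ltry.
  have Xp : 0 < fine (indic_max E x) by rewrite -lte_fin fineK.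
  have : ((fine (indic_max E x) / 2)%:E < indic_max E x)%E.
    by rewrite -{2}(fineK Xf) lte_fin ltr_pdivrMr// ltr_pMr// ltr1n.
  move=> /maxop_gtP[c' [l' [l'0 xc']]]; rewrite cavg_indic// => half.
  have tX : ((l' ^+ n)^-1%:E * mu (E `&` cube c' l') <= indic_max E x)%E.
    exact: maxop_indic_geI.
  have dens : (mu (E `&` cube c' l') <= (lbase ^- J * l' ^+ n)%:E)%E.
    by have := le_trans tX Xx; rewrite lee_pdivrMl ?exprn_gt0// -EFinM mulrC.
  have := indic_max3_ge mE l'0 xc' dens; rewrite -/gJ => low.
  rewrite lee_pdivlMl//; apply: le_trans low.
  apply: (@le_trans _ _ (gJ%:E * (fine (indic_max E x) / 2)%:E)%E).
    rewrite -{1}(fineK Xf) -!EFinM lee_fin mulrA ler_pdivlMr//.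
    by rewrite mulrAC ler_pM2r// mulrC.
  by apply: lee_wpmul2l; [rewrite lee_fin growth_ge0|exact: ltW].
have m3 : measurable_fun setT (indic_max3 E) by exact: measurable_maxop.
have hB : (\int[mu]_x (((B^-1)%:E * indic_max3 E x) `^ p * (w x)%:E) <= 2^-1%:E * tail_mass E)%E.
  rewrite integral_weightZl ?invr_ge0 ?(ltW B0)//; last by move=> x; exact: maxop_ge0.
  rewrite -powR_inv1 ?(ltW B0)// -powRrM mulN1r powRN BpE lee_pdivrMl ?mulr_gt0 ?exprn_gt0//.
  apply: le_trans (indic_max3_bound l0 mE Ec) _.
  by rewrite muleA -EFinM mulrAC mulfV ?mul1r// pnatr_eq0.
have m3B : measurable_fun setT (fun x => ((B^-1)%:E * indic_max3 E x) `^ p * (w x)%:E)%E.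
  by apply: measurable_poweR_weight; exact: measurable_funeM.
have split : (tail_mass E <= wm F + 2^-1%:E * tail_mass E)%E.
  apply: (@le_trans _ _ (\int[mu]_(x in F) (w x)%:E + \int[mu]_x (((B^-1)%:E * indic_max3 E x) `^ p * (w x)%:E))%E); last first.
    by apply: leeD.
  have wF0 x : (0 <= ((fun x => (w x)%:E) \_ F) x)%E by rewrite patchE; case: ifP.
  have mwF : measurable_fun setT ((fun x => (w x)%:E) \_ F).
    by apply/(measurable_restrictT _ mF); exact: measurable_funTS.
  have g0 x : (0 <= ((B^-1)%:E * indic_max3 E x) `^ p * (w x)%:E)%E by rewrite mule_ge0 ?poweR_ge0.
  rewrite [X in (_ <= X + _)%E]integral_mkcond -ge0_integralD//.
  apply: ge0_le_integral => //.
  - exact: measurable_poweR_weight.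
  - exact: emeasurable_funD.
  - move=> x _; rewrite patchE; case: ifPn => [_|].
      apply: (@le_trans _ _ (w x)%:E); last by rewrite leeDl.
      rewrite -[leRHS]mul1e; apply: lee_wpmul2r => //.
      by rewrite -(poweR1r p); apply: le_poweR2r; [exact: ltW|exact: X0|exact: maxop_indic_le1].
    rewrite notin_setE => nF; rewrite add0e; apply: lee_wpmul2r => //.
    by apply: le_poweR2r; [exact: ltW|exact: X0|exact: out].
(* Finite by N_p, so that half of it can be moved to the left. *)
have Af : tail_mass E \is a fin_num.
  by rewrite ge0_fin_numE// integral_ge0.
move: split; rewrite -(fineK Af); set a := fine _.
case: (wm F) (measure_ge0 wm F) => [r| |]//= _; last by rewrite gt0_muley ?leey// lte_fin.
by rewrite -!EFinM -EFinD !lee_fin; lra.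
Qed.

End weighted_maximal.

(** * From W_p and C_p to A_p *)

Section tail_mass_cubes.
Context {R : realType} {n : nat}.
Local Notation mu := (@mu R n).
Local Notation T := (borelT R n).
Local Notation lbase := (@lbase R n).
Variables (p : R) (w : T -> R).
Hypotheses (p1 : 1 < p) (mw : measurable_fun setT w) (w0 : forall x, 0 <= w x).

Let p0 : 0 < p. Proof. exact: lt_trans p1. Qed.
Let we0 x : (0 <= (w x)%:E)%E. Proof. by rewrite lee_fin. Qed.
Let mwe : measurable_fun setT (fun x => (w x)%:E). Proof. exact/measurable_EFinP. Qed.
Local Notation wm := (mdens mu we0 mwe).
Local Notation tail_mass := (tail_mass p w).

Let X0 (E : set T) x : (0 <= indic_max E x)%E. Proof. exact: maxop_ge0. Qed.
Let mX (E : set T) : measurable_fun setT (indic_max E). Proof. exact: measurable_maxop. Qed.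

Lemma mu_setI_cube_side_le (E : set T) c l d k : 0 < l -> 0 < k -> E `<=` cube d k ->
  measurable E -> (mu (E `&` cube c l) <= (k ^+ n)%:E)%E.
Proof.
move=> l0 k0 Ed mE; rewrite -(mu_cube d k0); apply: le_measure; rewrite ?inE.
- by apply: measurableI => //; exact: measurable_cube.
- exact: measurable_cube.
- by move=> z [/Ed].
Qed.

(** Compare a cube of side l2 through x that meets the large cube with one of side l + l2 containing
    x and the large cube. The large cube has average at most (min(l, l2)/l2)^n over the former, and
    min(l, l2) <= 2 l l2/(l + l2). *)
Lemma indic_max_subcube (c d : 'rV[R]_n) l k x : 0 < l -> 0 < k -> cube d k `<=` cube c l ->
  (indic_max (cube c l) x <= ((2 * (l / k)) ^+ n)%:E * indic_max (cube d k) x)%E.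
Proof.
move=> l0 k0 sub; have mc e m : measurable (cube e m : set T) by exact: measurable_cube.
have A0 : 0 <= (2 * (l / k)) ^+ n by rewrite exprn_ge0// mulr_ge0// divr_ge0// ltW.
apply: ge_ereal_sup => _ [c2 [l2 [l20 xc ->]]]; rewrite cavg_indic//.
have [[y [yc yc2]]|/set0P/negP/negPn/eqP ->] := pselect ((cube c l `&` cube c2 l2) !=set0); last first.
  by rewrite measure0 mule0 mule_ge0 ?X0.
pose c3 : 'rV[R]_n := \row_i Num.min (c 0 i) (c2 0 i).
have c3P i : c 0 i <= c2 0 i + l2 /\ c2 0 i <= c 0 i + l.
  by have /andP[? ?] := yc i; have /andP[? ?] := yc2 i; split; lra.
have ll : 0 < l + l2 by rewrite addr_gt0.
have sub3 : cube c l `<=` cube c3 (l + l2).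
  move=> z zc i; rewrite mxE; have /andP[? ?] := zc i; have [? ?] := c3P i.
  by have [?|?] := leP (c 0 i) (c2 0 i); apply/andP; split; lra.
have x3 : cube c3 (l + l2) x.
  move=> i; rewrite mxE; have /andP[? ?] := xc i; have [? ?] := c3P i.
  by have [?|?] := leP (c 0 i) (c2 0 i); apply/andP; split; lra.
have := maxop_indic_geI ll (mc d k) x3.
rewrite (setIidl (subset_trans sub sub3)) mu_cube// -EFinM => low.
apply: (@le_trans _ _ (((2 * (l / k)) ^+ n)%:E * ((((l + l2) ^+ n)^-1 * k ^+ n)%:E))%E); last first.
  by apply: lee_wpmul2l => //; rewrite lee_fin.
rewrite lee_pdivrMl ?exprn_gt0// -!EFinM.
have -> : l2 ^+ n * ((2 * (l / k)) ^+ n * (((l + l2) ^+ n)^-1 * k ^+ n)) =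
    (2 * l * l2 / (l + l2)) ^+ n.
  by rewrite -exprVn -!exprMn; congr (_ ^+ _); field; rewrite !gt_eqF.
have [h|h] := leP l l2.
  apply: (@le_trans _ _ (l ^+ n)%:E).
    exact: (mu_setI_cube_side_le c2 l20 l0 (@subset_refl _ _) (mc c l)).
  rewrite lee_fin lerXn2r ?nnegrE ?divr_ge0 ?mulr_ge0 ?(ltW l20) ?(ltW l0) ?(ltW ll)// ler_pdivlMr//; nra.
apply: (@le_trans _ _ (l2 ^+ n)%:E); first exact: mu_setI_cube_le.
rewrite lee_fin lerXn2r ?nnegrE ?divr_ge0 ?mulr_ge0 ?(ltW l20) ?(ltW l0) ?(ltW ll)// ler_pdivlMr//; nra.
Qed.

Lemma tail_mass_subcube (c d : 'rV[R]_n) l k : 0 < l -> 0 < k -> cube d k `<=` cube c l ->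
  (tail_mass (cube c l) <= (((2 * (l / k)) ^+ n) `^ p)%:E * tail_mass (cube d k))%E.
Proof.
move=> l0 k0 sub; have A0 : 0 <= (2 * (l / k)) ^+ n by rewrite exprn_ge0// mulr_ge0// divr_ge0// ltW.
rewrite /tail_mass -integral_weightZl//; apply: le_integral_weight => //.
- by move=> x; exact: indic_max_subcube.
- exact: measurable_funeM.
Qed.

Lemma le_wm_tail_mass c l : 0 < l -> (wm (cube c l) <= tail_mass (cube c l))%E.
Proof.
move=> l0; have mc : measurable (cube c l : set T) by exact: measurable_cube.
have := @weight_le_integral _ _ _ _ p1 mw w0 (indic_max (cube c l)) 1 _ ler01 mc (mX _).
rewrite powR1 mul1e; apply => x xc.
have := maxop_indic_geI l0 mc xc; rewrite setIid mu_cube// -EFinM mulVf//.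
by rewrite expf_neq0// gt_eqF.
Qed.

Variables (C1 : R).
Hypotheses (n0 : (0 < n)%N) (C10 : 0 < C1) (HN : Np p w).
Hypothesis HW : forall f : T -> R, measurable_fun setT f ->
  let Mf := maxop (fun x => (f x)%:E) in
  (\int[mu]_x (Mf x `^ p * (w x)%:E) < +oo)%E ->
  (\int[mu]_x (maxop Mf x `^ p * (w x)%:E) <=
   C1%:E * \int[mu]_x (Mf x `^ p * (w x)%:E))%E.

(* Applying the absorption to a concentric subcube whose superlevel set still
   lies in the original cube avoids assuming that the weight is doubling. *)
Lemma tail_mass_cube : exists2 C3, 0 < C3 & forall c l, 0 < l ->
  (tail_mass (cube c l) <= C3%:E * wm (cube c l))%E.
Proof.
set J := @level0 R n p C1; pose aJ := lbase ^+ J.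
have aJ1 : 1 <= aJ by rewrite exprn_ege1// ltW// lbase_gt1.
have aJ0 : 0 < aJ by exact: lt_le_trans aJ1.
(* The concentric subcube of side k = l/K leaves a margin aJ k on every side. *)
pose K := 1 + 2 * aJ; have K0 : 0 < K by rewrite addr_gt0// mulr_gt0.
exists ((((2 * K) ^+ n) `^ p) * 2) => [|c l l0].
  by rewrite mulr_gt0// powR_gt0// exprn_gt0// mulr_gt0.
pose k := l / K; have k0 : 0 < k by rewrite divr_gt0.
have lE : l = (1 + 2 * aJ) * k by rewrite /k -/K mulrC divfK// gt_eqF.
pose d : 'rV[R]_n := \row_i (c 0 i + aJ * k).
have ak0 : 0 < aJ * k by rewrite mulr_gt0.
have sub : cube d k `<=` cube c l.
  by move=> z zd i; have := zd i; rewrite mxE => /andP[? ?]; apply/andP; split; nra.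
apply: (le_trans (tail_mass_subcube l0 k0 sub)).
have -> : l / k = K by rewrite /k invf_div mulrCA mulfV ?mulr1// gt_eqF.
rewrite EFinM -muleA; apply: lee_wpmul2l; first by rewrite lee_fin powR_ge0.
have md : measurable (cube d k : set T) by exact: measurable_cube.
apply: (le_trans (tail_mass_absorb p1 mw w0 C10 HN HW k0 md (@subset_refl _ _))).
apply: lee_wpmul2l => //; apply: le_measure; rewrite ?inE.
- exact: (measurable_gt _ (mX _)).
- exact: measurable_cube.
move=> x /maxop_gtP[c2 [l2 [l20 xc2]]]; rewrite cavg_indic// => Jlt.
have [[y [yd yc2]]|/set0P/negP/negPn/eqP E0] := pselect ((cube d k `&` cube c2 l2) !=set0); last first.
  by move: Jlt; rewrite E0 measure0 mule0 lte_fin ltNge invr_ge0 (ltW aJ0).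
(* In a cube of larger side the subcube has density at most aJ^-n <= 1/aJ, by n > 0. So the
   superlevel set stays within the margin. *)
have l2k : l2 < aJ * k.
  rewrite ltNge; apply/negP => h; move: Jlt; rewrite ltNge => /negP; apply.
  rewrite lee_pdivrMl ?exprn_gt0//; apply: (le_trans (mu_setI_cube_side_le c2 l20 k0 (@subset_refl _ _) md)).
  rewrite -EFinM lee_fin ler_pdivlMr//.
  have : (aJ * k) ^+ n <= l2 ^+ n by apply: lerXn2r; rewrite ?nnegrE ?(ltW ak0) ?(ltW l20).
  move=> H; apply: le_trans H; rewrite [leRHS]exprMn [leRHS]mulrC; apply: ler_wpM2l; first by rewrite exprn_ge0// ltW.
  by rewrite ler_eXnr.
move=> i; have := yd i; rewrite mxE => /andP[? ?]; have /andP[? ?] := yc2 i; have /andP[? ?] := xc2 i.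
by rewrite lE mulrDl -mulrA; apply/andP; split; lra.
Qed.

End tail_mass_cubes.

(** * Doubling and lower density *)

Section lower_density.
Context {R : realType} {n : nat}.
Local Notation mu := (@mu R n).
Local Notation T := (borelT R n).
Variables (p : R) (w : T -> R).
Hypotheses (p1 : 1 < p) (mw : measurable_fun setT w) (w0 : forall x, 0 <= w x).
Let we0 x : (0 <= (w x)%:E)%E. Proof. by rewrite lee_fin. Qed.
Let mwe : measurable_fun setT (fun x => (w x)%:E). Proof. exact/measurable_EFinP. Qed.
Local Notation wm := (mdens mu we0 mwe).
Local Notation tail_mass := (tail_mass p w).
Variables (C2 C3 delta : R).
Hypotheses (C20 : 0 < C2) (C30 : 0 < C3) (delta0 : 0 < delta).
Hypothesis HT : forall c l, 0 < l -> (tail_mass (cube c l) <= C3%:E * wm (cube c l))%E.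
Hypothesis HC : forall c l (E : set T), 0 < l -> measurable E -> E `<=` cube c l ->
  (wm E <= (C2 * (fine (mu E) / l ^+ n) `^ delta)%:E * tail_mass (cube c l))%E.
Hypothesis wpos : forall c l, 0 < l -> (0 < wm (cube c l) < +oo)%E.

Lemma wm_hcube c l : 0 < l -> wm (hcube c l) = wm (cube c l).
Proof. by move=> l0; exact/esym/integral_cube_hcube. Qed.

(** Doubling of w: the integrals in C_p of the two cubes are compared through their maximal
    functions alone, and [HT] returns from that integral to the mass of the small cube. *)
Lemma wm_subcube (c d : 'rV[R]_n) l k : 0 < l -> 0 < k -> cube d k `<=` cube c l ->
  (wm (cube c l) <= (((2 * (l / k)) ^+ n) `^ p * C3)%:E * wm (cube d k))%E.
Proof.
move=> l0 k0 sub; apply: (le_trans (le_wm_tail_mass p1 mw w0 c l0)).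
apply: (le_trans (tail_mass_subcube p1 mw w0 l0 k0 sub)).
by rewrite EFinM -muleA; apply: lee_wpmul2l; [rewrite lee_fin powR_ge0|exact: HT].
Qed.

(** Nested grid cells are half-open while doubling is stated for closed cubes. A point moved in one
    coordinate alone detects a violated side. *)
Lemma hcube_sub_cube (c d : 'rV[R]_n) l k : 0 < k ->
  hcube d k `<=` hcube c l -> cube d k `<=` cube c l.
Proof.
move=> k0 sub z zd i.
pose y : 'rV[R]_n := \row_j (if j == i then Num.max (d 0 i) (c 0 i + l) else d 0 j).
have dd : hcube d k d by move=> j; rewrite lexx ltrDl.
have /andP[cd _] := sub d dd i; have /andP[? ?] := zd i.
apply/andP; split; first by lra.
have [?|h] := leP (d 0 i + k) (c 0 i + l); first by lra.
have : hcube c l y.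
  apply: sub => j; rewrite mxE; case: eqP => [->|_]; last by rewrite lexx ltrDl.
  by rewrite le_max lexx gt_max ltrDl k0.
by move=> /(_ i); rewrite mxE eqxx gt_max ltxx andbF andbF.
Qed.

Lemma expr_lt_eventually (b t : R) : 0 <= b < 1 -> 0 < t -> exists j, b ^+ j < t.
Proof.
move=> /andP[b0 b1] t0.
have : (fun j => b ^+ j) @ \oo --> (0 : R) by apply: cvg_expr; rewrite ger0_norm.
by move=> /cvgr_lt/(_ _ t0)[N _ /(_ N (leqnn N))]; exists N.
Qed.

(** By contradiction: if E had a very small share of the w-mass, [measure_decay] with the weight as
    reference measure would bound its Lebesgue share by b^j < t. *)
Lemma lower_density t : 0 < t -> exists2 C5, 0 < C5 &
  forall c l (E : set T), 0 < l -> measurable E -> E `<=` cube c l ->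
    ((t * l ^+ n)%:E <= mu E)%E -> (wm (cube c l) <= C5%:E * wm E)%E.
Proof.
move=> t0.
pose D := Num.max 1 (((2 * 2) ^+ n) `^ p * C3); have D1 : 1 <= D by rewrite le_max lexx.
have D0 : 0 < D by exact: lt_le_trans D1.
(* Below Lebesgue density [c0], C_p and [HT] leave less than half of the w-mass. So a set with at
   most half of it misses a fraction [c0] of the cube; the maximum with 0 in [b] keeps [b]
   nonnegative. *)
pose c0 := (2 * C2 * C3)^-1 `^ delta^-1.
have c00 : 0 < c0 by rewrite powR_gt0// invr_gt0 !mulr_gt0.
pose b := Num.max 0 (1 - c0).
have b01 : 0 <= b < 1 by rewrite le_max lexx gt_max ltr01 ltrBlDr ltrDl.
have [j bj] := expr_lt_eventually b01 t0.
pose lam := (2^-1 / D) ^+ j; have lam0 : 0 < lam by rewrite exprn_gt0// divr_gt0.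
exists lam^-1; first by rewrite invr_gt0.
move=> c l E l0 mE Ec tE.
have l0n k : 0 < l / 2 ^+ k by rewrite divr_gt0// exprn_gt0.
have mh := measurable_hcube c l.
pose idx := gidx c l.
have nidx k x y : idx k.+1 x = idx k.+1 y -> idx k x = idx k y by exact: gidx_nested.
have P0E : atom idx 0 (c : T) = hcube c l.
  rewrite gidx_atomE// expr0 divr1; congr (hcube _ _).
  by apply/rowP => i; rewrite !mxE subrr mul0r mul0r floor0 mulr0 addr0.
pose E' : set T := E `&` hcube c l; have mE' : measurable E' by exact: measurableI.
have muE' : mu E' = mu E by rewrite /E' -mu_setI_hcube// setIidl.
have /andP[Q0 Qoo] := wpos c l0.
have Qf : wm (cube c l) \is a fin_num by rewrite ge0_fin_numE// ltW.
rewrite lee_pdivlMl//.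
apply: (@le_trans _ _ (wm E')); last first.
  by apply: le_measure; rewrite ?inE//; exact: subIsetl.
rewrite leNgt; apply/negP => Elt; move: tE; rewrite leNgt => /negP; apply.
rewrite -muE'.
apply: (@le_lt_trans _ _ ((b ^+ j)%:E * mu (hcube c l))%E); last first.
  by rewrite mu_hcube// -EFinM lte_fin ltr_pM2r// exprn_gt0.
rewrite -P0E; apply: (@measure_decay _ _ _ _ idx _ _ _ wm mu c D 2^-1 b) => //.
- by move=> k x; exact: measurable_gidx_atom.
- exact: gidx_generates.
- by rewrite invr_gt0 ltr0n/= invf_lt1// ltr1n.
- by rewrite P0E /= wm_hcube.
- by rewrite P0E mu_hcube// ltry.
- move=> k x _; rewrite !gidx_atomE//= !wm_hcube//.
  apply: (@le_trans _ _ ((((2 * 2) ^+ n) `^ p * C3)%:E * wm (cube (gcorner c l k.+1 x) (l / 2 ^+ k.+1)))%E).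
    rewrite [X in (2 * X)](_ : 2 = (l / 2 ^+ k) / (l / 2 ^+ k.+1)); last first.
      by rewrite exprS; field; rewrite expf_neq0// gt_eqF.
    apply: wm_subcube => //.
    by apply: hcube_sub_cube => //; rewrite -!gidx_atomE//; exact: (atom_sub nidx (leqnSn k)).
  by apply: lee_wpmul2r => //; rewrite lee_fin le_max lexx orbT.
- move=> k x F _ mF; rewrite gidx_atomE//; set d := gcorner _ _ _ _; set h := l / _ => Fd Fw.
  have h0 : 0 < h by exact: l0n.
  have /andP[P0 Poo] := wpos d h0.
  have mhd := measurable_hcube d h.
  pose G : set T := hcube d h `\` F; have mG : measurable G by exact: measurableD.
  have Gd : G `<=` cube d h by move=> z [/sub_hcube_cube].
  have addm (m : {measure set T -> \bar R}) : (m (hcube d h) = m F + m G)%E.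
    by rewrite -measureU ?setDUK// setDIK.
  have Pf : wm (cube d h) \is a fin_num by rewrite ge0_fin_numE// ltW.
  have Ff : wm F \is a fin_num.
    rewrite ge0_fin_numE//; apply: le_lt_trans Poo; rewrite -wm_hcube//.
    by apply: le_measure; rewrite ?inE.
  have muFf : mu F \is a fin_num.
    rewrite ge0_fin_numE//; apply: (@le_lt_trans _ _ (mu (hcube d h))).
      by apply: le_measure; rewrite ?inE.
    by rewrite mu_hcube// ltry.
  have muGf : mu G \is a fin_num.
    rewrite ge0_fin_numE//; apply: (@le_lt_trans _ _ (mu (hcube d h))).
      by apply: le_measure; rewrite ?inE//; exact: subDsetl.
    by rewrite mu_hcube// ltry.
  pose W := fine (wm (cube d h)); have W0 : 0 < W by rewrite fine_gt0// P0.
  have half : ((2^-1 * W)%:E <= wm G)%E.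
    have Fw' : (wm F <= 2^-1%:E * wm (cube d h))%E by rewrite -wm_hcube.
    have addw : (wm (hcube d h) = wm F + wm G)%E := addm wm.
    move: Fw' addw; rewrite wm_hcube// -(fineK Pf) -(fineK Ff) -/W -EFinM lee_fin => Fw'.
    case: (wm G) (measure_ge0 wm G) => [r| |]//= _.
    by rewrite -EFinD lee_fin => -[]; lra.
  pose r := fine (mu G) / h ^+ n.
  have hn0 : 0 < h ^+ n by rewrite exprn_gt0.
  have r0 : 0 <= r by rewrite divr_ge0 ?fine_ge0// ltW.
  have rlow : c0 <= r.
    have : ((2^-1 * W)%:E <= (C2 * r `^ delta * C3 * W)%:E)%E.
      apply: (le_trans half); apply: (le_trans (HC h0 mG Gd)); rewrite -/r.
      rewrite -[C2 * _ * C3 * W]mulrA [X in (_ <= X)%E]EFinM; apply: lee_wpmul2l.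
        by rewrite lee_fin mulr_ge0 ?powR_ge0// ltW.
      by rewrite EFinM /W fineK//; exact: HT.
    rewrite lee_fin ler_pM2r// => H.
    have : (2 * C2 * C3)^-1 <= r `^ delta.
      by rewrite -[leLHS]mul1r ler_pdivrMr ?mulr_gt0//; lra.
    move=> /(ge0_ler_powR (ltac:(by rewrite invr_ge0 ltW) : 0 <= delta^-1)).
    rewrite !nnegrE powR_ge0 invr_ge0 !mulr_ge0 ?(ltW C20) ?(ltW C30)// => /(_ isT isT).
    by rewrite -powRrM mulfV ?gt_eqF// powRr1.
  have := addm mu; rewrite mu_hcube// -(fineK muFf) -(fineK muGf) -EFinD => -[hE].
  rewrite -EFinM lee_fin.
  have rE : fine (mu G) = r * h ^+ n by rewrite divfK// gt_eqF.
  apply: (@le_trans _ _ ((1 - c0) * h ^+ n)).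
    have : c0 * h ^+ n <= r * h ^+ n by rewrite ler_pM2r.
    rewrite -rE => H; have {}hE : h ^+ n = fine (mu F) + fine (mu G) := hE.
    by rewrite mulrBl mul1r; lra.
  by rewrite ler_pM2r// le_max lexx orbT.
- by rewrite P0E; exact: subIsetr.
- by rewrite P0E /= wm_hcube// ltW.
Qed.
End lower_density.

(** * The average of the dual weight *)

Section dual_average.
Context {R : realType} {n : nat}.
Local Notation mu := (@mu R n).
Local Notation T := (borelT R n).
Local Notation lbase := (@lbase R n).
Variables (p : R) (w : T -> R).
Hypotheses (p1 : 1 < p) (mw : measurable_fun setT w) (w0 : forall x, 0 <= w x).
Let q1 : 0 < p - 1. Proof. by rewrite subr_gt0. Qed.
Let we0 x : (0 <= (w x)%:E)%E. Proof. by rewrite lee_fin. Qed.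
Let mwe : measurable_fun setT (fun x => (w x)%:E). Proof. exact/measurable_EFinP. Qed.
Local Notation wm := (mdens mu we0 mwe).
Local Notation tail_mass := (tail_mass p w).

Variables (C1 C2 delta : R).
Hypotheses (n0 : (0 < n)%N) (C10 : 0 < C1) (HN : Np p w).
Hypothesis HW : forall f : T -> R, measurable_fun setT f ->
  let Mf := maxop (fun x => (f x)%:E) in
  (\int[mu]_x (Mf x `^ p * (w x)%:E) < +oo)%E ->
  (\int[mu]_x (maxop Mf x `^ p * (w x)%:E) <=
   C1%:E * \int[mu]_x (Mf x `^ p * (w x)%:E))%E.
Hypotheses (C20 : 0 < C2) (delta0 : 0 < delta).
Hypothesis HC : forall c l (E : set T), 0 < l -> measurable E -> E `<=` cube c l ->
  (wm E <= (C2 * (fine (mu E) / l ^+ n) `^ delta)%:E * tail_mass (cube c l))%E.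
Hypothesis wpos : forall c l, 0 < l -> (0 < wm (cube c l) < +oo)%E.

(* The superlevel set is covered by the stopping cells of the 2^n shifted grids,
   in each of which E has density bounded below. *)
Lemma superlevel_weight lam : 0 < lam <= 1 -> exists2 C6, 0 < C6 &
  forall c l (E : set T), 0 < l -> measurable E -> E `<=` cube c l ->
    (wm [set x | (lam%:E < indic_max E x)%E] <= C6%:E * wm E)%E.
Proof.
move=> /andP[lam0 lam1].
have [C3 C30 HT] := tail_mass_cube p1 mw w0 n0 C10 HN HW.
have t0 : 0 < lam / 6 ^+ n by rewrite divr_gt0// exprn_gt0.
have [C5 C50 low] := lower_density p1 C20 C30 delta0 HT HC wpos t0.
pose N := #|{ffun 'I_n -> bool}|.
have N0 : (0 < N)%N by apply/card_gt0P; exists [ffun=> false].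
exists (N%:R * C5) => [|c l E l0 mE Ec]; first by rewrite mulr_gt0// ltr0n.
(* A cube where E has density above lam has side below l/lam, since lam <= 1 and n > 0; one top
   scale therefore serves every cube met here. *)
pose L := 6 * (l / lam); have L0 : 0 < L by rewrite mulr_gt0// divr_gt0.
pose idx s := gidx (gorigin L s : 'rV[R]_n) L.
have midx s k x : measurable (atom (idx s) k x) by exact: measurable_gidx_atom.
have nidx s k x y : idx s k.+1 x = idx s k.+1 y -> idx s k x = idx s k y by exact: gidx_nested.
pose G s k := [set x | ((lam / 6 ^+ n)%:E * mu (atom (idx s) k x) <= mu (atom (idx s) k x `&` E))%E].
have GP s k x y : G s k x -> atom (idx s) k x y -> G s k y.
  by rewrite /G/= => Gx xy; rewrite (atom_eq xy).
have bound s : (wm (\bigcup_k G s k) <= C5%:E * wm E)%E.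
  rewrite -[X in wm X]setIT; apply: (@le_trans _ _ (C5%:E * wm ((\bigcup_k G s k) `&` E))%E).
    apply: (@stopping_measure_le _ _ R _ _ (midx s) (nidx s) (G s) (GP s)) => //; first exact: ltW.
    move=> k x [Gx _]; rewrite setIT.
    have h0 : 0 < L / 2 ^+ k by rewrite divr_gt0// exprn_gt0.
    have aE := gidx_atomE (gorigin L s) k x L0.
    move: Gx; rewrite /G/= [mu (atom _ _ _)]mu_gidx_atom// -EFinM => Gx.
    set P := atom (idx s) k x; pose d := gcorner (gorigin L s) L k x.
    have PE : P = hcube d (L / 2 ^+ k) by [].
    apply: (@le_trans _ _ (wm (cube d (L / 2 ^+ k)))).
      apply: le_measure; rewrite ?inE; [exact: midx|exact: measurable_cube|].
      by rewrite PE; exact: sub_hcube_cube.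
    apply: (low d _ _ h0 (measurableI _ _ (midx s k x) mE) _ Gx).
    by move=> z [zP _]; apply: sub_hcube_cube; rewrite -PE.
  apply: lee_wpmul2l; first by rewrite lee_fin ltW.
  apply: le_measure; rewrite ?inE//.
  by apply: measurableI => //; exact: (measurable_hit (midx s) (nidx s) (GP s)).
have mO s : measurable (\bigcup_k G s k) by exact: (measurable_hit (midx s) (nidx s) (GP s)).
apply: (@le_trans _ _ (wm (\big[setU/set0]_(s : {ffun 'I_n -> bool}) \bigcup_k G s k))).
  apply: le_measure; rewrite ?inE//.
  - exact: (measurable_gt _ (measurable_maxop _)).
  - exact: bigsetU_measurable.
  move=> x /maxop_gtP[c2 [l2 [l20 xc2]]]; rewrite cavg_indic// => lt2.
  have lt2' : ((lam * l2 ^+ n)%:E < mu (E `&` cube c2 l2))%E.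
    by move: lt2; rewrite lte_pdivlMl ?exprn_gt0// -EFinM mulrC.
  have l2l : l2 < l / lam.
    rewrite ltNge; apply/negP => h; move: lt2'; rewrite ltNge => /negP; apply.
    apply: (le_trans (mu_setI_cube_side_le c2 l20 l0 Ec mE)); rewrite lee_fin mulrC -ler_pdivrMr//.
    have : (l / lam) ^+ n <= l2 ^+ n by apply: lerXn2r; rewrite ?nnegrE ?divr_ge0 ?(ltW l0) ?(ltW lam0) ?(ltW l20).
    apply: le_trans; rewrite expr_div_n; apply: ler_wpM2l; first by rewrite exprn_ge0// ltW.
    by rewrite lef_pV2 ?posrE ?exprn_gt0// ler_iXnr// ltW.
  have [s [k [kl sub]]] : exists s k, L / 2 ^+ k <= 6 * l2 /\
      forall x, cube c2 l2 x -> cube c2 l2 `<=` atom (gidx (gorigin L s) L) k x.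
    by apply: cube_in_grid => //; rewrite /L ler_pM2l// ltW.
  rewrite -bigcup_seq; exists s => /=; first by rewrite mem_index_enum.
  exists k => //; rewrite /G/= mu_gidx_atom// -EFinM.
  apply: (@le_trans _ _ (mu (E `&` cube c2 l2))); last first.
    apply: le_measure; rewrite ?inE.
    - by apply: measurableI => //; exact: measurable_cube.
    - exact: measurableI.
    - by move=> z [Ez /(sub _ xc2)].
  apply: (le_trans _ (ltW lt2')); rewrite lee_fin -mulrA ler_pM2l// ler_pdivrMl ?exprn_gt0// -exprMn.
  have Lk0 : 0 <= L / 2 ^+ k by rewrite divr_ge0 ?exprn_ge0// ltW.
  by apply: lerXn2r; rewrite ?nnegrE// mulr_ge0// ltW.
apply: (@le_trans _ _ (\sum_(s : {ffun 'I_n -> bool}) wm (\bigcup_k G s k))%E).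
  suff [] : measurable (\big[setU/set0]_(s : {ffun 'I_n -> bool}) \bigcup_k G s k) /\
    (wm (\big[setU/set0]_(s : {ffun 'I_n -> bool}) \bigcup_k G s k) <=
     \sum_(s : {ffun 'I_n -> bool}) wm (\bigcup_k G s k))%E by [].
  apply: (big_rec2 (fun (B : set T) y => measurable B /\ (wm B <= y)%E)).
    by split; rewrite ?measure0.
  move=> s y B _ [mB By]; split; first exact: measurableU.
  by apply: (le_trans (measureU2 _ (mO s) mB)); exact: leeD.
apply: (@le_trans _ _ (\sum_(s : {ffun 'I_n -> bool}) (C5%:E * wm E))%E).
  by apply: lee_sum => s _; exact: bound.
have Ef : wm E \is a fin_num.
  rewrite ge0_fin_numE//; have /andP[_] := wpos c l0; apply: le_lt_trans.
  by apply: le_measure; rewrite ?inE//; exact: measurable_cube.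
rewrite -(fineK Ef) (eq_bigr (fun=> (C5 * fine (wm E))%:E)); last by move=> s _; rewrite EFinM.
by rewrite sumEFin sumr_const -/N -[X in (X%:E <= _)%E]mulr_natl mulrA EFinM.
Qed.

(** On the whole cube M chi_E is at least the density of E, and the third iterate gains the factor
    [growth j]. Both integrals are controlled by that of (M chi_E)^p w, which absorption and
    [superlevel_weight] bound by w(E). *)
Lemma density_weight : exists2 C7, 1 <= C7 & forall c l (E : set T),
  0 < l -> measurable E -> E `<=` cube c l ->
  (((fine (mu E) / l ^+ n) `^ p)%:E * wm (cube c l) <= C7%:E * wm E)%E /\
  forall j, (mu E <= (lbase ^- j * l ^+ n)%:E)%E ->
  (((growth (n := n) j * (fine (mu E) / l ^+ n)) `^ p)%:E * wm (cube c l) <= C7%:E * wm E)%E.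
Proof.
set J := @level0 R n p C1.
have aJ1 : 1 <= lbase ^+ J by rewrite exprn_ege1// ltW// lbase_gt1.
have lam01 : 0 < lbase ^- J <= 1.
  by rewrite invr_gt0 (lt_le_trans _ aJ1)//= invf_le1// (lt_le_trans _ aJ1).
have [C6 C60 H6] := superlevel_weight lam01.
have C21 : 0 <= C1 ^+ 2 * (2 * C6) by rewrite mulr_ge0 ?exprn_ge0 ?mulr_ge0 ?ltW.
have C61 : 0 <= 2 * C6 by rewrite mulr_ge0 ?ltW.
pose C7 := 1 + 2 * C6 + C1 ^+ 2 * (2 * C6).
have C7a : 2 * C6 <= C7 by rewrite /C7 addrAC lerDr addr_ge0.
have C7b : C1 ^+ 2 * (2 * C6) <= C7 by rewrite /C7 lerDr addr_ge0.
exists C7; first by rewrite /C7 -addrA lerDl addr_ge0.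
move=> c l E l0 mE Ec; have mc : measurable (cube c l : set T) by exact: measurable_cube.
have mu_fin : mu E \is a fin_num.
  rewrite ge0_fin_numE//; apply: (@le_lt_trans _ _ (mu (cube c l))).
    by apply: le_measure; rewrite ?inE.
  by rewrite mu_cube// ltry.
have t0 : 0 <= fine (mu E) / l ^+ n by rewrite divr_ge0 ?fine_ge0// exprn_ge0// ltW.
have tE : (fine (mu E) / l ^+ n)%:E = ((l ^+ n)^-1%:E * mu (E `&` cube c l))%E.
  by rewrite setIidl// -{2}(fineK mu_fin) -EFinM mulrC.
have tm : (tail_mass E <= (2 * C6)%:E * wm E)%E.
  apply: (le_trans (tail_mass_absorb p1 mw w0 C10 HN HW l0 mE Ec)).
  by rewrite EFinM -muleA; apply: lee_wpmul2l => //; exact: (H6 c l).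
split=> [|j Ej].
  apply: (@le_trans _ _ ((2 * C6)%:E * wm E)%E); last first.
    by apply: lee_wpmul2r => //; rewrite lee_fin.
  apply: le_trans tm; apply: (weight_le_integral p1 mw w0 t0 mc) => [|x xc].
    exact: measurable_maxop.
  by rewrite tE; exact: maxop_indic_geI.
apply: (@le_trans _ _ ((C1 ^+ 2 * (2 * C6))%:E * wm E)%E); last first.
  by apply: lee_wpmul2r => //; rewrite lee_fin.
apply: (@le_trans _ _ ((C1 ^+ 2)%:E * tail_mass E)%E); last first.
  by rewrite [(C1 ^+ 2 * _)%:E]EFinM -muleA; apply: lee_wpmul2l => //; rewrite lee_fin exprn_ge0// ltW.
apply: le_trans (indic_max3_bound p1 mw w0 C10 HN HW l0 mE Ec).
apply: (weight_le_integral p1 mw w0 _ mc) => [||x xc].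
- by rewrite mulr_ge0// growth_ge0.
- exact: measurable_maxop.
- by rewrite EFinM tE; apply: indic_max3_ge => //; rewrite setIidl.
Qed.

Lemma powR_le1 (z : R) : 0 <= z -> z `^ (p - 1) <= 1 -> z <= 1.
Proof.
move=> z0; rewrite leNgt => /negP zp; rewrite leNgt; apply/negP => h; apply: zp.
rewrite [ltLHS](_ : 1 = 1 `^ (p - 1)); last by rewrite powR1.
by rewrite gt0_ltr_powR// nnegrE.
Qed.

(** Since (g u)^p = g^p u^(p-1) u, division by A s^(p-1) u gives the ratio; u = 0 is set apart. *)
Lemma powR_ratio_le1 (g u s A : R) : 0 <= g -> 0 <= u -> 0 < s -> 0 < A ->
  (g * u) `^ p * A <= A * s `^ (p - 1) * u -> g `^ p * (u / s) `^ (p - 1) <= 1.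
Proof.
move=> g0 u0 s0 A0; have [->|un0] := eqVneq u 0.
  by rewrite mul0r powR0 ?gt_eqF// mulr0.
have up : 0 < u by rewrite lt_def un0.
have sp : 0 < s `^ (p - 1) by rewrite powR_gt0.
have -> : (g * u) `^ p = g `^ p * ((u / s) `^ (p - 1) * s `^ (p - 1) * u).
  rewrite powRM//; congr (_ * _).
  rewrite -powRM ?divr_ge0 ?(ltW s0)// divfK ?gt_eqF//.
  by rewrite -[X in _ = _ * X](powRr1 u0) -powRD ?subrK ?un0 ?implybT.

set X := (u / s) `^ _; set Y := s `^ _ in sp *; set Z := g `^ p => H.
have k0 : 0 < A * Y * u by rewrite !mulr_gt0.
rewrite -(ler_pM2r k0) mul1r; apply: le_trans H.
by rewrite le_eqVlt; apply/orP; left; apply/eqP; ring.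
Qed.

(** If g > 1 its exponent p may be lowered to p - 1, giving (g y)^(p-1) <= 1; if g <= 1, already y
    <= 1 <= 1/g. *)
Lemma le_inv_growth (y : R) i : 0 <= y -> y `^ (p - 1) <= 1 ->
  growth (n := n) i.+2 `^ p * y `^ (p - 1) <= 1 -> y <= (growth (n := n) i.+2)^-1.
Proof.
move=> y0 y1 gy; set g := growth _ in gy *.
have g0 : 0 < g.
  by rewrite /g growthE mulr_gt0 ?divr_gt0 ?invr_gt0 ?exprn_gt0 ?lbase_gt0// mulr_gt0// subr_gt0 ltr1n.
have gp0 : 0 < g `^ p by rewrite powR_gt0.
have [g1|g1] := leP g 1.
  by apply: (le_trans (powR_le1 y0 y1)); rewrite -(invr1 R) lef_pV2 ?posrE.
rewrite -[leRHS]mul1r ler_pdivlMr//; apply: powR_le1; first by rewrite mulr_ge0// ltW.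
rewrite powRM ?(ltW g0)// mulrC; apply: le_trans gy; apply: ler_wpM2r; first exact: powR_ge0.
by rewrite ler_powR// ?ltW// ltrBlDr ltrDl.
Qed.

(** The reciprocals equal 2 lbase^2/((i+1)(i+2)) and telescope. Indices 0 and 1 are bounded apart
    because [growth] vanishes there. *)
Lemma dual_series_bound (d : nat -> R) :
  (forall i, 0 <= d i) -> d 0%N <= 1 -> d 1%N <= 1 ->
  (forall i, d i.+2 <= (growth (n := n) i.+2)^-1) ->
  (\sum_(i <oo) (d i)%:E <= (2 + 2 * lbase ^+ 2)%:E)%E.
Proof.
move=> d0 d01 d11 dg; have a2 : 0 < lbase ^+ 2 by rewrite exprn_gt0// lbase_gt0.
apply: lime_le; first by apply: is_cvg_nneseries => i _ _; rewrite lee_fin.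
apply: nearW => m; rewrite sumEFin lee_fin.
apply: (@le_trans _ _ (\sum_(0 <= i < m.+2) d i)).
  rewrite !big_nat_recr//= -addrA lerDl addr_ge0//.
rewrite big_nat_recl// big_nat_recl// addrA; apply: lerD; first by lra.
have key k : \sum_(0 <= i < k) d i.+2 <= 2 * lbase ^+ 2 * (1 - k.+1%:R^-1).
  elim: k => [|k IH]; first by rewrite big_nil invr1 subrr mulr0.
  rewrite big_nat_recr//=; apply: (le_trans (lerD IH (dg k))).
  rewrite growthE le_eqVlt; apply/orP; left; apply/eqP.
  rewrite -[k.+2]addn2 -[k.+1]addn1 !natrD.
  have k0 : 0 <= k%:R :> R by [].
  have a0 := @lbase_gt0 R n.
  field; rewrite !gt_eqF//; lra.
apply: (le_trans (key m)); rewrite ler_piMr//; by rewrite mulr_ge0// ltW.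
Qed.


(** In the variable t the weight is W t^(p-1) and its dual a constant times 1/t, so thresholds
    lbase^-i on t are natural levels for both. *)
Lemma powR_scale (W y : R) : 0 < W -> 0 < y -> exists2 t, 0 < t &
  y = W * t `^ (p - 1) /\ y `^ (- (p - 1)^-1) = W `^ (- (p - 1)^-1) * t^-1.
Proof.
move=> W0 y0; have yW : 0 < y / W by rewrite divr_gt0.
exists ((y / W) `^ (p - 1)^-1); first by rewrite powR_gt0.
rewrite -powRrM (mulVf (lt0r_neq0 q1)) (powRr1 (ltW yW)) mulrC divfK ?gt_eqF//; split=> //.
rewrite -powRN -powRM ?(ltW yW) ?(ltW W0)// mulrC divfK// gt_eqF//.
Qed.

Lemma measurable_dualw : measurable_fun setT (dualw p w : T -> \bar R).
Proof.
apply: (@measurable_fun_ifT _ _ _ _ (fun=> +oo%E) (fun x => (w x `^ (- (p - 1)^-1))%:E)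
  (fun x : T => w x == 0)) => //.
- exact: measurable_fun_eqr.
- by apply/measurable_EFinP; apply: measurableT_comp (measurable_powR _) _.
Qed.

Lemma dualw_ge0 (x : T) : (0 <= dualw p w x)%E.
Proof. by rewrite /dualw; case: ifP => // _; rewrite lee_fin powR_ge0. Qed.

(* With A the average of w on the cube and W = A / C7, the sets
   D i = {w < W lbase^(-i(p-1))} have relative measure at most a multiple of
   lbase^-i / (i(i-1)), which makes the layer-cake sum of the dual weight converge. *)
Lemma dual_average : exists K, forall c l, 0 < l ->
  (((l ^+ n)^-1%:E * wm (cube c l)) *
   ((l ^+ n)^-1%:E * \int[mu]_(x in cube c l) dualw p w x) `^ (p - 1) <= K%:E)%E.
Proof.
have a0 := @lbase_gt0 R n; have a1 := @lbase_gt1 R n.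
have [C7 C71 H7] := density_weight.
have C70 : 0 < C7 by exact: lt_le_trans C71.
pose C8 := 1 + lbase * (2 + 2 * lbase ^+ 2).
have C80 : 0 < C8 by rewrite addr_gt0// mulr_gt0// addr_gt0// mulr_gt0// exprn_gt0.
exists (C7 * C8 `^ (p - 1)) => c l l0.
set Q := cube c l; have mQ : measurable (Q : set T) by exact: measurable_cube.
set V := l ^+ n; have V0 : 0 < V by rewrite exprn_gt0.
have /andP[Qp Qoo] := wpos c l0.
have Qf : wm Q \is a fin_num by rewrite ge0_fin_numE// ltW.
pose A := fine (wm Q) / V; have A0 : 0 < A by rewrite divr_gt0// fine_gt0// Qp.
have QE : wm Q = (A * V)%:E by rewrite divfK ?gt_eqF// fineK.
pose s i : R := lbase ^- i; have s0 i : 0 < s i by rewrite invr_gt0 exprn_gt0.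
(* Dividing by [C7] cancels the constant of [density_weight], so the ratios below are bounded by
   exactly 1. *)
pose Wc := A / C7; have Wc0 : 0 < Wc by rewrite divr_gt0.
pose thr i := Wc * s i `^ (p - 1).
have thr0 i : 0 < thr i by rewrite mulr_gt0// powR_gt0.
pose D i : set T := Q `&` [set x | w x < thr i].
have mD i : measurable (D i).
  apply: measurableI => //; rewrite (_ : mkset _ = setT `&` [set x | w x < (cst (thr i)) x]) ?setTI//.
  by rewrite -[X in measurable X]setTI; exact: measurable_fun_ltr.
have DQ i : D i `<=` Q by exact: subIsetl.
have muDf i : mu (D i) \is a fin_num.
  rewrite ge0_fin_numE//; apply: (@le_lt_trans _ _ (mu Q)).
    by apply: le_measure; rewrite ?inE//.
  by rewrite mu_cube// ltry.
pose u i := fine (mu (D i)) / V.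
have u0 i : 0 <= u i by rewrite divr_ge0 ?fine_ge0// ltW.
have muDE i : mu (D i) = (u i * V)%:E by rewrite divfK ?gt_eqF// fineK.
have wD i : (wm (D i) <= (thr i * (u i * V))%:E)%E.
  rewrite EFinM -muDE -integral_cst//; apply: ge0_le_integral => //.
  - exact: measurable_funTS.
  - by move=> x [_ /ltW]; rewrite lee_fin.
have ratio i g : 0 <= g -> (((g * u i) `^ p)%:E * wm Q <= C7%:E * wm (D i))%E ->
    g `^ p * (u i / s i) `^ (p - 1) <= 1.
  move=> g0 H; apply: (@powR_ratio_le1 _ _ _ A) => //.
  have C7e : (0 <= C7%:E)%E by rewrite lee_fin ltW.
  have := le_trans H (lee_wpmul2l C7e (wD i)).
  rewrite QE -!EFinM lee_fin => H'.
  rewrite -(ler_pM2r V0); apply: (le_trans (_ : _ <= (g * u i) `^ p * (A * V))).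
    by rewrite mulrA.
  apply: (le_trans H'); rewrite /thr /Wc le_eqVlt; apply/orP; left; apply/eqP.
  by field; rewrite gt_eqF.
have d1 i : (u i / s i) `^ (p - 1) <= 1.
  have [+ _] := H7 _ _ _ l0 (mD i) (DQ i); rewrite -/V -/(u i) -[X in X `^ p]mul1r => /(ratio _ _ ler01).
  by rewrite powR1 mul1r.
pose d i := u i / s i; have d0 i : 0 <= d i by rewrite divr_ge0// ltW.
have dle1 i : d i <= 1 by exact: powR_le1 (d0 i) (d1 i).
have dg i : d i.+2 <= (growth (n := n) i.+2)^-1.
  apply: (le_inv_growth (d0 _) (d1 _)); apply: ratio; first exact: growth_ge0.
  have [_] := H7 _ _ _ l0 (mD i.+2) (DQ i.+2); apply.
  have := dle1 i.+2; rewrite ler_pdivrMr// mul1r => us.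
  by rewrite muDE lee_fin ler_pM2r.
have sumd := dual_series_bound d0 (dle1 0%N) (dle1 1%N) dg.
(* Layer-cake for 1/t: if j+1 is the first index with s_(j+1) <= t, then x lies in [D j] and 1/t <=
   1/s_(j+1). If t >= 1, the constant 1 in [dualS] suffices. *)
pose S (x : T) : \bar R := (\sum_(i <oo) ((s i.+1)^-1 * \1_(D i) x)%:E)%E.
have term0 i x : (0 <= ((s i.+1)^-1 * \1_(D i) x)%:E)%E.
  by rewrite lee_fin mulr_ge0// invr_ge0 ltW.
have S0 x : (0 <= S x)%E by apply: nneseries_ge0 => i _ _; exact: term0.
have Sge i x : D i x -> ((s i.+1)^-1%:E <= S x)%E.
  move=> Dx; apply: (@le_trans _ _ (\sum_(0 <= j < i.+1) ((s j.+1)^-1 * \1_(D j) x)%:E)%E).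
    rewrite big_nat_recr//= indicE mem_set// mulr1 leeDr//.
    by apply: sume_ge0 => j _; exact: term0.
  by apply: nneseries_lim_ge => j _ _; exact: term0.
pose Wi := Wc `^ (- (p - 1)^-1); have Wi0 : 0 < Wi by rewrite powR_gt0.
have dualS x : Q x -> (dualw p w x <= Wi%:E * (1 + S x))%E.
  move=> Qx; rewrite /dualw; case: eqVneq => wx.
    (* A zero of w lies in every [D j], so the series diverges there, matching the value of
       [dualw]. *)
    have -> : S x = +oo%E.
      apply/eqyP => b b0.
      have [j jb] := @expr_lt_eventually R lbase^-1 b^-1 (ltac:(by rewrite invr_ge0 (ltW a0) invf_lt1)) (ltac:(by rewrite invr_gt0)).
      have Dj : D j x by split => //=; rewrite wx.
      apply: le_trans (Sge j x Dj); rewrite lee_fin -[leLHS]invrK lef_pV2 ?posrE ?invr_gt0 ?exprn_gt0//.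
      apply: le_trans (ltW jb); rewrite /s exprVn lef_pV2 ?posrE ?exprn_gt0//.
      by rewrite ler_eXn2l.
    by rewrite addey// gt0_muley ?lte_fin.
  have wp : 0 < w x by rewrite lt_def wx w0.
  have [t tp [wE ->]] := powR_scale Wc0 wp.
  rewrite EFinM; apply: lee_wpmul2l; first by rewrite lee_fin ltW.
  have ex : exists j, s j <= t.
    have [j jb] := @expr_lt_eventually R lbase^-1 t (ltac:(by rewrite invr_ge0 (ltW a0) invf_lt1)) tp.
    by exists j; rewrite /s -exprVn ltW.
  case: (ex_minnP ex) => -[|j] jt jmin.
    apply: (@le_trans _ _ 1%E); last by rewrite leeDl.
    by rewrite lee_fin invf_le1//; move: jt; rewrite /s expr0 invr1.
  have Dj : D j x.
    split => //=; rewrite wE /thr ltr_pM2l// gt0_ltr_powR// ?nnegrE ?(ltW tp) ?(ltW (s0 j))//.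
    by rewrite ltNge; apply/negP => /jmin; rewrite ltnn.
  apply: (@le_trans _ _ (S x)); last by rewrite leeDr.
  by apply: le_trans (Sge j x Dj); rewrite lee_fin lef_pV2 ?posrE.
have mterm i : measurable_fun setT (fun x : T => ((s i.+1)^-1 * \1_(D i) x)%:E : \bar R).
  by apply/measurable_EFinP; apply: measurable_funM => //; exact: measurable_indic.
have mS : measurable_fun setT S.
  by apply: ge0_emeasurable_sum => // i x _ _; exact: term0.
have intS : (\int[mu]_(x in Q) S x = (lbase * V)%:E * \sum_(i <oo) (d i)%:E)%E.
  rewrite integral_nneseries//; last by move=> i; exact: measurable_funTS.
  rewrite -nneseriesZl//; last by move=> i _; rewrite lee_fin.
  apply: eq_eseriesr => i _.
  transitivity ((s i.+1)^-1%:E * mu (D i))%E.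
    rewrite -[in RHS](setIidl (DQ i)) -integral_indic// -ge0_integralZl//.
    - apply: measurable_funTS; exact: measurable_indice.
    - by rewrite lee_fin invr_ge0 ltW.
  rewrite muDE -!EFinM; congr EFin; rewrite /d /s exprS; field.
  by rewrite expf_neq0 ?gt_eqF.
have bound : (\int[mu]_(x in Q) dualw p w x <= (Wi * (C8 * V))%:E)%E.
  apply: (@le_trans _ _ (\int[mu]_(x in Q) (Wi%:E * (1 + S x)))%E).
    apply: ge0_le_integral => //.
    - by move=> x _; exact: dualw_ge0.
    - apply: measurable_funTS; exact: measurable_dualw.
    - by apply: measurable_funTS; apply: measurable_funeM; exact: emeasurable_funD.
  rewrite ge0_integralZl//; last 3 first.
  - by apply: measurable_funTS; exact: emeasurable_funD.
  - by move=> x _; rewrite adde_ge0.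
  - by rewrite lee_fin ltW.
  rewrite EFinM; apply: lee_wpmul2l; first by rewrite lee_fin ltW.
  rewrite ge0_integralD//; last by exact: measurable_funTS.
  rewrite integral_cst// mul1e [X in (X + _)%E]mu_cube// intS /C8 mulrDl mul1r EFinD; apply: leeD => //.
  rewrite mulrAC [X in (_ <= X)%E]EFinM; apply: lee_wpmul2l => //.
  by rewrite lee_fin mulr_ge0// ltW.
(* Since Wi^(p-1) = C7/A, the average A of w cancels and C7 C8^(p-1) remains. *)
rewrite QE -EFinM mulrCA mulVf ?gt_eqF// mulr1.
apply: (@le_trans _ _ (A%:E * ((Wi * C8) `^ (p - 1))%:E)%E).
  apply: lee_wpmul2l; first by rewrite lee_fin ltW.
  rewrite -poweR_EFin; apply: le_poweR2r; first exact: ltW.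
    rewrite mule_ge0// ?lee_fin ?invr_ge0 ?(ltW V0)//.
    by apply: integral_ge0 => x _; exact: dualw_ge0.
  rewrite lee_pdivrMl// -EFinM; apply: (le_trans bound).
  by rewrite lee_fin mulrA mulrC.
rewrite -EFinM lee_fin powRM ?(ltW Wi0) ?(ltW C80)//.
have -> : Wi `^ (p - 1) = Wc^-1.
  by rewrite /Wi -powRrM mulNr mulVf ?gt_eqF// powR_inv1// ltW.
rewrite /Wc invf_div le_eqVlt; apply/orP; left; apply/eqP; field.
by rewrite gt_eqF.
Qed.

End dual_average.

(** * Reduction to Borel weights *)

Lemma bigcup_count_null d (T : measurableType d) (R : realType)
    (m : {measure set T -> \bar R}) (I : countType) (F : I -> set T) :
  (forall i, measurable (F i)) -> (forall i, m (F i) = 0%E) -> m (\bigcup_i F i) = 0%E.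
Proof.
move=> mF F0; apply/negligibleP; first exact: bigcup_count_measurable.
have -> : \bigcup_i F i = \bigcup_k (if unpickle k is Some i then F i else set0).
  apply/seteqP; split => [x [i _ Fx]|x [k _]]; first by exists (pickle i) => //; rewrite pickleK.
  by case: (unpickle k) => [i|//] Fx; exists i.
apply: negligible_bigcup => k; case: unpickle => [i|]; last exact: negligible_set0.
by apply/negligibleP => //; exact: F0.
Qed.

Section null_modification.
Context {R : realType} {n : nat}.
Local Notation mu := (@mu R n).
Local Notation T := (borelT R n).

(** The passage from Lebesgue measurable sets and weights to Borel ones, with which they agree off a
    null set. *)
Lemma integ_ae (N E E' : set T) (f g : T -> \bar R) : measurable N -> mu N = 0%E ->
  measurable E' -> (forall x, 0 <= f x)%E -> (forall x, 0 <= g x)%E -> measurable_fun setT g ->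
  (forall x, ~ N x -> (E x <-> E' x) /\ f x = g x) ->
  integ E f = (\int[mu]_(x in E') g x)%E.
Proof.
move=> mN N0 mE' f0 g0 mg H; rewrite integral_mkcond; apply: (lint_ae mN N0).
- by move=> x; case: ifP.
- by move=> x; rewrite patchE; case: ifP.
- by apply/(measurable_restrictT _ mE'); exact: measurable_funTS.
- move=> x /H[EE' ->]; rewrite patchE; congr (if _ then _ else _).
  by apply/idP/idP; rewrite !inE => /EE'.
Qed.

Lemma eq_integ_ae (N E : set T) (f g : T -> \bar R) : measurable N -> mu N = 0%E ->
  measurable E -> (forall x, 0 <= f x)%E -> (forall x, 0 <= g x)%E -> measurable_fun setT g ->
  (forall x, ~ N x -> f x = g x) -> integ E f = integ E g.
Proof.
move=> mN N0 mE f0 g0 mg fg; rewrite [RHS]integE//.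
by apply: (integ_ae mN N0) => // x /fg.
Qed.

Lemma lebmeas_borel (E : set T) : measurable E -> lebmeas E.
Proof. by move=> mE; exists E, E; split => //; rewrite setDv lebE. Qed.

Lemma lebmeas_fun_borel (f : T -> R) : measurable_fun setT f -> lebmeas_fun (fun x => (f x)%:E).
Proof.
move=> mf a; apply: lebmeas_borel.
rewrite [X in measurable X](_ : _ = setT `&` [set x | f x < cst a x]); last first.
  by rewrite setTI; apply/seteqP; split => x /=; rewrite lte_fin.
exact: measurable_fun_ltr.
Qed.

Lemma lebmeas_modulo (E : set T) : lebmeas E -> exists E' N : set T,
  [/\ measurable E', measurable N, mu N = 0%E, E' `<=` E & E `\` E' `<=` N].
Proof.
move=> [A [B [mA mB AE EB AB]]]; exists A, (B `\` A); split => //.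
- exact: (@measurableD _ T).
- by rewrite -lebE//; exact: (@measurableD _ T).
- by move=> x [/EB].
Qed.

(** The null set is gathered from the countably many sublevel sets at rational levels; off it, the
    sublevel set at a real level is a union of rational ones. *)
Lemma lebmeas_fun_modulo (f : T -> R) : lebmeas_fun (fun x => (f x)%:E) ->
  exists N : set T, [/\ measurable N, mu N = 0%E &
    forall c, measurable_fun setT (fun x => if x \in N then c else f x)].
Proof.
move=> Lf.
have /choice[A HA] q := lebmeas_modulo (Lf (ratr q)).
have /choice[M HM] q := HA q.
pose N := \bigcup_q M q.
have mN : measurable N.
  by apply: bigcup_count_measurable => q _; have [] := HM q.
exists N; split => //.
  by apply: bigcup_count_null => q; have [] := HM q.
move=> c; apply: (measurability _ (RGenInftyO.measurableE R)) => //.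
move=> _ [_ [y ->] <-]; rewrite setTI.
rewrite [X in measurable X](_ : _ = (N `&` [set _ | c < y]) `|`
    \bigcup_(q in [set q : rat | ratr q < y]) (A q `\` N)).
  apply: measurableU.
    apply: measurableI => //; have [h|h] := boolP (c < y).
      by rewrite [X in measurable X](_ : _ = setT)//; apply/seteqP; split.
    by rewrite [X in measurable X](_ : _ = set0)//; apply/seteqP; split => // x /=; rewrite (negbTE h).
  by apply: bigcup_count_measurable => q _; apply: measurableD => //; have [] := HM q.
apply/seteqP; split => x /=; rewrite in_itv/=.
  case: ifPn => [/set_mem xN cy|]; first by left.
  rewrite notin_setE => xN fy; right.
  have [q] := rat_in_itvoo fy; rewrite in_itv/= => /andP[q1 q2].
  exists q => //=; split=> //; apply: contrapT => Aq; apply: xN; exists q => //.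
  by have [_ _ _ _] := HM q; apply; split => //=; rewrite lte_fin.
move=> [[xN cy]|[q /= qy [Aq xN]]]; first by rewrite mem_set.
rewrite memNset//; have [_ _ _ sub _] := HM q.
by apply: lt_trans qy; have := sub _ Aq; rewrite /= lte_fin.
Qed.

(** * Invariance of the classes under changes on a null set *)

Section transfer.
Variables (p : R) (w v : T -> R) (N : set T).
Hypotheses (w0 : forall x, 0 <= w x) (v0 : forall x, 0 <= v x) (mv : measurable_fun setT v).
Hypotheses (mN : measurable N) (N0 : mu N = 0%E) (wv : forall x, ~ N x -> w x = v x).

Let mve : measurable_fun setT (fun x => (v x)%:E). Proof. exact/measurable_EFinP. Qed.

Lemma integ_weight_ae (g : T -> \bar R) : (forall x, 0 <= g x)%E -> measurable_fun setT g ->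
  integ setT (fun x => (g x * (w x)%:E)%E) = integ setT (fun x => (g x * (v x)%:E)%E).
Proof.
move=> g0 mg; apply: (eq_integ_ae mN N0) => //.
- by move=> x; rewrite mule_ge0 ?lee_fin.
- by move=> x; rewrite mule_ge0 ?lee_fin.
- exact: emeasurable_funM.
- by move=> x /wv ->.
Qed.

Lemma cavg_weight_ae c l : cavg c l (fun x => (w x)%:E) = cavg c l (fun x => (v x)%:E).
Proof.
rewrite /cavg; congr (_ * _)%E; apply: (eq_integ_ae mN N0) => //.
- exact: measurable_cube.
- by move=> x /wv ->.
Qed.

Lemma cavg_dualw_ae c l : cavg c l (dualw p w) = cavg c l (dualw p v).
Proof.
rewrite /cavg; congr (_ * _)%E; apply: (eq_integ_ae mN N0) => //.
- exact: measurable_cube.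
- exact: dualw_ge0.
- exact: dualw_ge0.
- exact: measurable_dualw.
- by move=> x /wv; rewrite /dualw => ->.
Qed.

Lemma Ap_ae : Ap p w <-> Ap p v.
Proof.
rewrite /Ap (_ : [set a | _] = [set a | exists c l, 0 < l /\
  a = (cavg c l (fun x => (v x)%:E) * cavg c l (dualw p v) `^ (p - 1))%E])//.
by apply/seteqP; split => _ [c [l [l0 ->]]]; exists c, l; split => //; rewrite cavg_weight_ae cavg_dualw_ae.
Qed.

Lemma measurable_maxop_poweR (f : T -> \bar R) :
  measurable_fun setT (fun x : T => (maxop f x `^ p)%E).
Proof. exact: measurableT_comp (measurable_poweR _) (measurable_maxop _). Qed.

Lemma Np_ae : Np p w <-> Np p v.
Proof.
rewrite /Np; have e0 (x : T) : 0 < 1 + enorm x by rewrite ltr_pwDl// sqrtr_ge0.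
have E (u : T -> R) : (fun x => (u x / (1 + enorm x) `^ (n%:R * p))%:E) =
    (fun x : T => ((1 + enorm x) `^ (- (n%:R * p)))%:E * (u x)%:E)%E.
  by apply/funext => x; rewrite powRN -EFinM mulrC.
rewrite !E integ_weight_ae//; first by move=> x; rewrite lee_fin powR_ge0.
apply/measurable_EFinP; apply: measurableT_comp (measurable_powR _) _.
by apply: measurable_funD => //; exact: measurable_enorm.
Qed.

Lemma Wp_ae : Wp p w <-> Wp p v.
Proof.
have E f : integ setT (fun x => (maxop f x `^ p * (w x)%:E)%E) =
    integ setT (fun x => (maxop f x `^ p * (v x)%:E)%E).
  by apply: integ_weight_ae; [move=> x; exact: poweR_ge0|exact: measurable_maxop_poweR].
by split => -[/Np_ae HN [C [C0 H]]]; split => //; exists C; split => // f Lf;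
  have := H f Lf; rewrite /= !E.
Qed.

Lemma Cp_ae : Cp p w <-> Cp p v.
Proof.
have E f : integ setT (fun x => (maxop f x `^ p * (w x)%:E)%E) =
    integ setT (fun x => (maxop f x `^ p * (v x)%:E)%E).
  by apply: integ_weight_ae; [move=> x; exact: poweR_ge0|exact: measurable_maxop_poweR].
have I (F : set T) : lebmeas F -> integ F (fun x => (w x)%:E) = integ F (fun x => (v x)%:E).
  move=> /lebmeas_modulo[F' [M [mF' mM M0 F'F FF']]].
  have mNM : measurable (N `|` M) by exact: measurableU.
  have NM0 : mu (N `|` M) = 0%E.
    by have := measureU0 mN mM M0; rewrite N0.
  have FE x : ~ (N `|` M) x -> F x <-> F' x.
    move=> NMx; split => [Fx|/F'F//]; apply: contrapT => F'x; apply: NMx; right.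
    by apply: FF'.
  transitivity (\int[mu]_(x in F') (v x)%:E)%E.
    apply: (integ_ae mNM NM0) => // x NMx; split; first exact: FE.
    by rewrite wv// => Nx; apply: NMx; left.
  apply/esym; apply: (integ_ae mNM NM0) => // x NMx; split => //; exact: FE.
by split => -[C [delta [C0 d0 H]]]; exists C, delta; split => // c l F l0 LF Fc;
  have := H c l F l0 LF Fc; rewrite I// E.
Qed.

End transfer.

Lemma Cp_of_borel (p : R) (v : T -> R) : (forall x, 0 <= v x) -> measurable_fun setT v ->
  (exists C delta, [/\ 0 < C, 0 < delta & forall c l (E : set T),
     0 < l -> measurable E -> E `<=` cube c l ->
     (\int[mu]_(x in E) (v x)%:E <= C%:E * ((fine (mu E) / l ^+ n) `^ delta)%:E *
       tail_mass p v (cube c l))%E]) -> Cp p v.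
Proof.
move=> v0 mv [C [delta [C0 d0 H]]]; exists C, delta; split => // c l E l0 LE Ec.
have mve : measurable_fun setT (fun x => (v x)%:E) by exact/measurable_EFinP.
have [E' [M [mE' mM M0 E'E EE']]] := lebmeas_modulo LE.
have FE x : ~ M x -> E x <-> E' x.
  by move=> Mx; split => [Ex|/E'E//]; apply: contrapT => E'x; apply: Mx; apply: EE'.
rewrite (integ_ae mM M0 mE' (g := fun x => (v x)%:E))//; last first.
  by move=> x Mx; split => //; exact: FE.
have -> : leb E = mu E'.
  rewrite /leb (integ_ae mM M0 mE' (g := cst 1%E))//; last first.
    by move=> x Mx; split => //; exact: FE.
  by rewrite integral_cst// mul1e.
rewrite integE//.
- by apply: H => //; exact: subset_trans Ec.
- by move=> x; rewrite mule_ge0 ?poweR_ge0 ?lee_fin.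
- by apply: emeasurable_funM => //; exact: measurable_maxop_poweR.
Qed.

End null_modification.

(** * Degenerate weights and the two implications *)

Section assembly.
Context {R : realType} {n : nat}.
Local Notation mu := (@mu R n).
Local Notation T := (borelT R n).

Lemma cube_join (c d : 'rV[R]_n) l k : 0 < l -> 0 < k -> exists e m,
  [/\ 0 < m, cube c l `<=` cube e m & cube d k `<=` cube e m].
Proof.
move=> l0 k0; pose s := \sum_i `|c 0 i - d 0 i|.
have sP i : `|c 0 i - d 0 i| <= s by rewrite /s (bigD1 i)//= lerDl sumr_ge0.
have s0 : 0 <= s by exact: sumr_ge0.
exists (\row_i Num.min (c 0 i) (d 0 i)), (l + k + s); split; first by lra.
- move=> x xc i; have /andP[? ?] := xc i; have := sP i; rewrite ler_norml mxE => /andP[? ?].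
  by have [?|?] := leP (c 0 i) (d 0 i); apply/andP; split; lra.
- move=> x xc i; have /andP[? ?] := xc i; have := sP i; rewrite ler_norml mxE => /andP[? ?].
  by have [?|?] := leP (c 0 i) (d 0 i); apply/andP; split; lra.
Qed.

Lemma bigcup_cube : \bigcup_(k : nat) cube (const_mx (- k.+1%:R) : 'rV[R]_n) (2 * k.+1%:R) = setT.
Proof.
apply/seteqP; split => // x _; pose s := \sum_i `|x 0 i|.
have sP i : `|x 0 i| <= s by rewrite /s (bigD1 i)//= lerDl sumr_ge0.
have s0 : 0 <= s by exact: sumr_ge0.
exists (Num.bound s) => // i; rewrite mxE.
have := archi_boundP s0; have := sP i; rewrite ler_norml => /andP[? ?] h.
by rewrite -natr1; apply/andP; split; lra.
Qed.

Lemma null_of_cubes (m : {measure set T -> \bar R}) (Z : set T) : measurable Z ->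
  (forall c l, 0 < l -> m (Z `&` cube c l) = 0%E) -> m Z = 0%E.
Proof.
move=> mZ H; rewrite -[Z]setIT -bigcup_cube setI_bigcupr.
apply: bigcup_count_null => k; last by apply: H; rewrite mulr_gt0.
by apply: measurableI => //; exact: measurable_cube.
Qed.

Lemma Ap_bound (p : R) (v : T -> R) : Ap p v -> exists2 K, 0 < K & forall c l, 0 < l ->
  (cavg c l (fun x => (v x)%:E) * (cavg c l (dualw p v)) `^ (p - 1) <= K%:E)%E.
Proof.
rewrite /Ap; set S := [set a | _] => Sfin.
exists (1 + `|fine (ereal_sup S)|); first by rewrite ltr_pwDl.
move=> c l l0; have : (cavg c l (fun x => (v x)%:E) * (cavg c l (dualw p v)) `^ (p - 1) <= ereal_sup S)%E.
  by apply: ereal_sup_ubound; exists c, l.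
move=> /le_trans; apply; move: Sfin; case: (ereal_sup S) => [r _| //|_]; last exact: leNye.
by rewrite lee_fin/= (le_trans (ler_norm r))// lerDr.
Qed.

Lemma ApP (p : R) (v : T -> R) (K : R) : (forall c l, 0 < l ->
  (cavg c l (fun x => (v x)%:E) * (cavg c l (dualw p v)) `^ (p - 1) <= K%:E)%E) -> Ap p v.
Proof.
move=> H; apply: (@le_lt_trans _ _ K%:E); last exact: ltry.
by apply: ge_ereal_sup => _ [c [l [l0 ->]]]; exact: H.
Qed.

Section borel_weight.
Variables (p : R) (v : T -> R).
Hypotheses (p1 : 1 < p) (mv : measurable_fun setT v) (v0 : forall x, 0 <= v x).
Let q1 : 0 < p - 1. Proof. by rewrite subr_gt0. Qed.
Let ve0 x : (0 <= (v x)%:E)%E. Proof. by rewrite lee_fin. Qed.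
Let mve : measurable_fun setT (fun x => (v x)%:E). Proof. exact/measurable_EFinP. Qed.
Local Notation wm := (mdens mu ve0 mve).
Hypothesis wfin : forall c l, 0 < l -> (wm (cube c l) < +oo)%E.

Lemma cavg_weight c l : cavg c l (fun x => (v x)%:E) = ((l ^+ n)^-1%:E * wm (cube c l))%E.
Proof. by rewrite cavgE. Qed.

Lemma cavg_dualw c l :
  cavg c l (dualw p v) = ((l ^+ n)^-1%:E * \int[mu]_(x in cube c l) dualw p v x)%E.
Proof. by rewrite cavgE//; [exact: dualw_ge0|exact: measurable_dualw]. Qed.

Lemma integral_weightE (f : T -> \bar R) :
  integ setT (fun x => (maxop f x `^ p * (v x)%:E)%E) = (\int[mu]_x (maxop f x `^ p * (v x)%:E))%E.
Proof.
rewrite integE//; first by move=> x; rewrite mule_ge0 ?poweR_ge0.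
by apply: emeasurable_funM => //; exact: measurable_maxop_poweR.
Qed.

(** Any cube lies with the given one inside a larger cube, so the weight is zero almost everywhere.
    All weighted integrals are then 0, and so is the A_p product, even when the dual average is
    infinite. *)
Lemma vanishing_weight c0 l0 : 0 < l0 ->
  (forall c l, 0 < l -> cube c0 l0 `<=` cube c l -> wm (cube c l) = 0%E) ->
  [/\ Ap p v, Wp p v & Cp p v].
Proof.
move=> l00 H.
have Q0 c l : 0 < l -> wm (cube c l) = 0%E.
  move=> l1; have [e [m [m0 sub0 sub]]] := cube_join c0 c l00 l1.
  apply: (subset_measure0 (measurable_cube c l) (measurable_cube e m) sub).
  exact: H.
have wT0 : wm setT = 0%E.
  apply: null_of_cubes => // c l l1; rewrite setTI; exact: Q0.
have I0 (g : T -> \bar R) : (forall x, 0 <= g x)%E -> measurable_fun setT g ->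
    (\int[mu]_x (g x * (v x)%:E) = 0)%E.
  move=> g0 mg; rewrite -integral_mdens//; last by move=> x; rewrite ltry.
  exact: null_set_integral.
have e0 (x : T) : 0 < 1 + enorm x by rewrite ltr_pwDl// sqrtr_ge0.
split.
- by apply: (@ApP _ _ 0) => c l l1; rewrite cavg_weight Q0// mule0 mul0e.
- split; last first.
    exists 1; split => // f _ Mf _; rewrite !integral_weightE I0 ?mule_ge0//.
    + by apply: integral_ge0 => x _; rewrite mule_ge0 ?poweR_ge0.
    + by move=> x; exact: poweR_ge0.
    + exact: measurable_maxop_poweR.
  rewrite /Np (_ : (fun x => _) = (fun x : T => ((1 + enorm x) `^ (- (n%:R * p)))%:E * (v x)%:E)%E); last first.
    by apply/funext => x; rewrite powRN -EFinM mulrC.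
  have mk : measurable_fun setT (fun x : T => ((1 + enorm x) `^ (- (n%:R * p)))%:E).
    apply/measurable_EFinP; apply: measurableT_comp (measurable_powR _) _.
    by apply: measurable_funD => //; exact: measurable_enorm.
  rewrite integE ?I0//.
  + by move=> x; rewrite lee_fin powR_ge0.
  + by move=> x; rewrite mule_ge0// lee_fin powR_ge0.
  + exact: emeasurable_funM.
- apply: Cp_of_borel => //; exists 1, 1; split => // c l E l1 mE Ec.
  have -> : (\int[mu]_(x in E) (v x)%:E = 0)%E.
    exact: (subset_measure0 (mu := wm) mE (measurable_cube c l) Ec (Q0 _ _ l1)).
  rewrite !mule_ge0 ?lee_fin ?powR_ge0//.
  by apply: integral_ge0 => x _; rewrite mule_ge0 ?poweR_ge0.
Qed.

Lemma Wp_Cp_of_Ap_gt0 : (forall x, 0 < v x) -> Ap p v -> Wp p v /\ Cp p v.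
Proof.
move=> vp /Ap_bound[K K0 HK].
have sgE x : dualw p v x = (sigmaw p v x)%:E by rewrite /dualw gt_eqF.
have sg0 x : (0 <= (sigmaw p v x)%:E)%E by rewrite lee_fin powR_ge0.
have msg : measurable_fun setT (fun x => (sigmaw p v x)%:E).
  by apply/measurable_EFinP; exact: measurableT_comp (measurable_powR _) mv.
pose sm : {measure set T -> \bar R} := mdens mu sg0 msg.
have dE c l : cavg c l (dualw p v) = ((l ^+ n)^-1%:E * sm (cube c l))%E.
  by rewrite cavg_dualw; congr (_ * _)%E; apply: eq_integral => x _; exact: sgE.
have wpos c l : 0 < l -> (0 < wm (cube c l))%E.
  move=> l1; apply: mdens_gt0 => //; first exact: measurable_cube.
  by rewrite mu_cube// lte_fin exprn_gt0.
(* An infinite dual mass would make the A_p product infinite, because w(Q) > 0. *)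
have sfin c l : 0 < l -> (sm (cube c l) < +oo)%E.
  move=> l1; rewrite ltNge leye_eq; apply/negP => /eqP soo.
  have := HK c l l1; rewrite dE cavg_weight soo gt0_muley ?lte_fin ?invr_gt0 ?exprn_gt0//.
  rewrite poweRyr ?gt_eqF// gt0_muley; first by rewrite leNgt ltry.
  by rewrite mule_gt0 ?wpos// lte_fin invr_gt0 exprn_gt0.
have Apw c l : 0 < l ->
    ((l ^+ n)^-1 * fine (wm (cube c l))) * ((l ^+ n)^-1 * fine (sm (cube c l))) `^ (p - 1) <= K.
  move=> l1; have wE : wm (cube c l) = (fine (wm (cube c l)))%:E.
    by rewrite fineK// ge0_fin_numE// wfin.
  have sE : sm (cube c l) = (fine (sm (cube c l)))%:E by rewrite fineK// ge0_fin_numE// sfin.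
  have := HK c l l1; rewrite dE cavg_weight {1}wE {1}sE.
  by rewrite -!EFinM lee_fin.
split; first exact: (@Ap_Wp R n p K v p1 K0 mv vp wfin sfin Apw).
apply: Cp_of_borel => //.
have [C [delta [C0 d0 H]]] := @Ap_Cp_borel R n p K v p1 K0 mv vp wfin sfin Apw.
exists C, delta; split => // c l E l1 mE Ec; apply: (le_trans (H c l E l1 mE Ec)).
apply: lee_wpmul2l; last exact: (le_wm_tail_mass p1 mv v0).
by rewrite -EFinM lee_fin mulr_ge0 ?powR_ge0// ltW.
Qed.

Lemma Ap_of_Wp_Cp : (0 < n)%N -> Wp p v -> Cp p v -> Ap p v.
Proof.
move=> n0 [HN [C1 [C10 HW]]] [C2 [delta [C20 d0 HC]]].
have HW' (f : T -> R) : measurable_fun setT f ->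
    let Mf := maxop (fun x => (f x)%:E) in
    (\int[mu]_x (Mf x `^ p * (v x)%:E) < +oo)%E ->
    (\int[mu]_x (maxop Mf x `^ p * (v x)%:E) <=
     C1%:E * \int[mu]_x (Mf x `^ p * (v x)%:E))%E.
  by move=> mf Mf; have := HW f (lebmeas_fun_borel mf); rewrite /= !integral_weightE.
have HC' c l (E : set T) : 0 < l -> measurable E -> E `<=` cube c l ->
    (wm E <= (C2 * (fine (mu E) / l ^+ n) `^ delta)%:E * tail_mass p v (cube c l))%E.
  move=> l1 mE Ec; have := HC c l E l1 (lebmeas_borel mE) Ec.
  by rewrite lebE// integral_weightE integE// EFinM.
have [C3 C30 HT] := tail_mass_cube p1 mv v0 n0 C10 HN HW'.
(* If one cube has no mass, doubling empties every larger cube and the weight is degenerate;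
   otherwise all cubes have positive mass, as [dual_average] asks. *)
have [[c [l [l1 w0]]]|wn0] := pselect (exists c l, 0 < l /\ wm (cube c l) = 0%E).
  have [//|HA _ _] := @vanishing_weight c l l1; last by [].
  move=> d k k0 sub; apply/eqP; rewrite -measure_le0.
  have H : (wm (cube d k) <= (((2 * (k / l)) ^+ n) `^ p * C3)%:E * wm (cube c l))%E.
    exact: (wm_subcube p1 HT k0 l1 sub).
  by move: H; rewrite w0 mule0.
have wpos c l : 0 < l -> (0 < wm (cube c l) < +oo)%E.
  move=> l1; rewrite wfin// andbT lt0e measure_ge0 andbT; apply/eqP => h.
  by apply: wn0; exists c, l.
have [K HK] := dual_average p1 n0 C10 HN HW' C20 d0 HC' wpos.
by apply: (@ApP _ _ K) => c l l1; rewrite cavg_weight cavg_dualw; exact: HK.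
Qed.

End borel_weight.

Lemma Wp_Cp_of_Ap (p : R) (v : T -> R) (p1 : 1 < p) (mv : measurable_fun setT v)
    (v0 : forall x, 0 <= v x) :
  (forall c l, 0 < l -> (\int[mu]_(x in cube c l) (v x)%:E < +oo)%E) ->
  Ap p v -> Wp p v /\ Cp p v.
Proof.
move=> wfin HA; have q1 : 0 < p - 1 by rewrite subr_gt0.
have ve0 x : (0 <= (v x)%:E)%E by rewrite lee_fin.
have mve : measurable_fun setT (fun x => (v x)%:E) by exact/measurable_EFinP.
pose wm : {measure set T -> \bar R} := mdens mu ve0 mve.
 have [K K0 HK] := Ap_bound HA.
pose Z : set T := [set x | v x == 0].
have mb : measurable_fun setT (fun x : T => v x == 0) by exact: measurable_fun_eqr.
have mZ : measurable Z.
  by rewrite -[Z]setTI; exact: (mb measurableT [set true]).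
(* If w vanishes on a set of positive measure in some cube, the dual weight has infinite integral
   over every larger cube, and the A_p bound forces w(Q) = 0 there. Otherwise w is positive off a
   null set, on which it is reset to 1. *)
have [[c [l [l1 Zp]]]|Z0] := pselect (exists c l, 0 < l /\ (0 < mu (Z `&` cube c l))%E).
  have [//|_ HW HC] := @vanishing_weight p v mv v0 c l l1; last by [].
  move=> d k k0 sub; have mc := measurable_cube c l; have md := measurable_cube d k.
  have soo : (\int[mu]_(x in cube d k) dualw p v x = +oo)%E.
    apply/eqP; rewrite -leye_eq; apply: (@le_trans _ _ (\int[mu]_(x in Z `&` cube c l) cst +oo x)%E).
      by rewrite integral_cst ?gt0_mulye//; exact: measurableI.
    rewrite (eq_integral (dualw p v : T -> \bar R)); last by move=> x /set_mem[Zx _]; rewrite /dualw Zx.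
    apply: ge0_subset_integral => //.
    - exact: measurableI.
    - by apply: measurable_funTS; exact: measurable_dualw.
    - by move=> x _; exact: dualw_ge0.
    - by move=> x [_ /sub].
  have kn : 0 < (k ^+ n)^-1 by rewrite invr_gt0 exprn_gt0.
  have := HK d k k0; rewrite (cavg_dualw _ mv) (cavg_weight mv v0) soo gt0_muley ?lte_fin// poweRyr ?gt_eqF//.
  apply: contraTeq => w0; have wp : (0 < wm (cube d k))%E by rewrite lt0e w0 measure_ge0.
  by rewrite gt0_muley ?mule_gt0 ?lte_fin// -ltNge ltry.
have mZ0 : mu Z = 0%E.
  apply: null_of_cubes => // c l l1; apply/eqP; rewrite -measure_le0 leNgt; apply/negP => h.
  by apply: Z0; exists c, l.
pose u x := if v x == 0 then 1 else v x.
have mu' : measurable_fun setT (u : T -> R) by apply: measurable_fun_ifT.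
have up x : 0 < u x by rewrite /u; case: eqVneq => // h; rewrite lt_def h v0.
have vu x : ~ Z x -> v x = u x by rewrite /Z/u/= => /negP/negbTE ->.
have u0 x : 0 <= u x by exact: ltW.
have ufin c l : 0 < l -> (\int[mu]_(x in cube c l) (u x)%:E < +oo)%E.
  move=> l1; have mc := measurable_cube c l.
  have mue : measurable_fun setT (fun x : T => (u x)%:E) by exact/measurable_EFinP.
  have <- : integ (cube c l) (fun x => (v x)%:E) = (\int[mu]_(x in cube c l) (u x)%:E)%E.
    by apply: (integ_ae mZ mZ0) => // x /vu ->.
  by rewrite integE// wfin.
have HAu := (Ap_ae p v0 u0 mu' mZ mZ0 vu).1 HA.
have [HW HC] := @Wp_Cp_of_Ap_gt0 p u p1 mu' u0 ufin up HAu.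
by split; [apply/(Wp_ae p v0 u0 mu' mZ mZ0 vu)|apply/(Cp_ae p v0 u0 mu' mZ mZ0 vu)].
Qed.


End assembly.

(** In dimension 0 every cube is the single point and the product is 1 or 0. The case is separate
    because the covering arguments towards A_p use n > 0. *)
Lemma Ap_rV0 (R : realType) (p : R) (w : 'rV[R]_0 -> R) : 1 < p -> (forall x, 0 <= w x) -> Ap p w.
Proof.
move=> p1 w0; have q1 : p - 1 != 0 by rewrite subr_eq0 gt_eqF.
apply: (@ApP _ _ _ _ 1) => c l l0.
have c0 : cube c l 0 by case.
rewrite /cavg /integ /= mem_set// expr0 invr1 !mul1e /dualw.
have [->|h] := eqVneq (w 0) 0; first by rewrite mul0e.
rewrite poweR_EFin -powRrM mulNr mulVf// powR_inv1// -EFinM mulfV//.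
Qed.

Theorem theorem1p2 (R : realType) (n : nat) (p : R) (w : 'rV[R]_n -> R) :
  1 < p -> weight w -> (Ap p w <-> Wp p w /\ Cp p w).
Proof.
move=> p1 [w0 Lw wfin]; have [N [mN N0 /(_ 0) mv]] := lebmeas_fun_modulo Lw.
set v := (fun x => _) in mv.
have v0 x : 0 <= v x by rewrite /v; case: ifP.
have wv x : ~ N x -> w x = v x by move=> Nx; rewrite /v memNset.
have mve : measurable_fun setT (fun x : borelT R n => (v x)%:E) by exact/measurable_EFinP.
have vfin c l : 0 < l -> (\int[mu R n]_(x in cube c l) (v x)%:E < +oo)%E.
  move=> l0; rewrite -(integ_ae mN N0 (E := cube c l) (f := fun x => (w x)%:E))//.
  - exact: wfin.
  - exact: measurable_cube.
  - by move=> x /wv ->.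
have AE := Ap_ae p w0 v0 mv mN N0 wv; have WE := Wp_ae p w0 v0 mv mN N0 wv.
have CE := Cp_ae p w0 v0 mv mN N0 wv.
split.
  by move=> /AE/(Wp_Cp_of_Ap p1 mv v0 vfin)[/WE ? /CE ?].
have [n0|n0] := posnP n; first by subst n => _; exact: Ap_rV0.
by move=> [/WE HW /CE HC]; apply/AE; exact: (Ap_of_Wp_Cp p1 vfin n0 HW HC).
Qed.
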